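(* Let $q,\rho_{12},\rho_{13},\rho_{23}\in(-1,1)$, put $r=\rho_{12}\rho_{13}\rho_{23}$, and let $(X,Y,Z)$ have the joint density $f_{3D}(x,y,z|\rho_{12},\rho_{13},\rho_{23},q)$ defined in the context. Then the one-dimensional conditional moments, say $E(H_n(Y|q)|Z=z)$, are polynomials of order not exceeding $n$ in $z$. More precisely, for $n=2m+1$, $m\ge 0$, $$E(H_{2m+1}(Y|q)|Z=z)=\sum_{s=0}^{m}{2m+1\brack s}_q\left(\rho_{23}^{2m+1-s}+(\rho_{12}\rho_{13})^{2m+1-s}\right)W_{s,2m+1-s}(z|r,q),$$ and for $n=2m$, $m\ge1$, $$E(H_{2m}(Y|q)|Z=z)={2m\brack m}_q r^mW_{m,m}(z|r,q)+\sum_{s=0}^{m-1}{2m\brack s}_q\left(\rho_{23}^{2m-s}+(\rho_{12}\rho_{13})^{2m-s}\right)W_{s,2m-s}(z|r,q),$$ where the polynomials $W_{k,m}(z|r,q)$, $k,m\ge0$, are defined in the context. In particular, $$E(Y|Z=z)=\frac{\rho_{23}+\rho_{12}\rho_{13}}{1+r}\,z,$$ and $$E(Y^2|Z=z)=\frac{(\rho_{23}^2+\rho_{12}^2\rho_{13}^2)(1-qr)+r(1-r)(1+q)}{(1+r)(1-qr^2)}\,z^2+\frac{1+r^2-\rho_{23}^2-\rho_{12}^2\rho_{13}^2}{1-qr^2}.$$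
   Context: For $|q|<1$ let $S(q)=[-2/\sqrt{1-q},2/\sqrt{1-q}]$, $[0]_q=0$, $[n]_q=1+q+\dots+q^{n-1}$ for $n\ge1$, $[0]_q!=1$, $[n]_q!=\prod_{i=1}^n[i]_q$ for $n\ge1$, ${n\brack k}_q=\frac{[n]_q!}{[k]_q![n-k]_q!}$ for $0\le k\le n$ and $0$ otherwise; $(a)_0=1$, $(a)_j=\prod_{k=1}^j(1-aq^{k-1})$ for $j\ge1$, $(a)_\infty=\prod_{k=0}^\infty(1-aq^k)$. Define $$l_q(x|a)=(1+a)^2-(1-q)ax^2,\qquad \omega_q(x,y|\rho)=(1-\rho^2)^2-(1-q)xy\rho(1+\rho^2)+(1-q)\rho^2(x^2+y^2),$$ $$f_N(x|q)=\frac{(q)_\infty\sqrt{1-q}\sqrt{4-(1-q)x^2}}{2\pi}\prod_{i=1}^\infty l_q(x|q^i),\quad x\in S(q).$$ The three-dimensional density is, for $x,y,z\in S(q)$, $$f_{3D}(x,y,z|\rho_{12},\rho_{13},\rho_{23},q)=f_N(x|q)f_N(y|q)f_N(z|q)\frac{C_{3D}(\rho_{12}^2)_\infty(\rho_{13}^2)_\infty(\rho_{23}^2)_\infty}{\prod_{i=0}^\infty\left(\omega_q(x,y|\rho_{12}q^i)\,\omega_q(x,z|\rho_{13}q^i)\,\omega_q(y,z|\rho_{23}q^i)\right)},$$ with $C_{3D}$ the constant making it a probability density on $S(q)^3$. The $q$-Hermite polynomials are given by $H_{-1}(x|q)=0$, $H_0(x|q)=1$, $H_{n+1}(x|q)=xH_n(x|q)-[n]_qH_{n-1}(x|q)$.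 The (monic) Rogers polynomials $R_n(x|\beta,q)$ are given by $R_{-1}=0$, $R_0=1$, $$xR_n(x|\beta,q)=R_{n+1}(x|\beta,q)+[n]_q\frac{1-\beta^2q^{n-1}}{(1-\beta q^{n-1})(1-\beta q^n)}R_{n-1}(x|\beta,q).$$ For $k,m\ge0$ put $$W_{k,m}(x|r,q)=\sum_{s=0}^k\frac{q^{\binom s2}(-r)^s(r)_{m+s}}{(r^2)_{m+s}}H_{k-s}(x|q)R_{m+s}(x|r,q).$$ Equalities involving conditional expectations hold almost surely with respect to the distribution of the conditioning random variable.
   Formalization: Two misprints corrected: with n=2m+1 or 2m the coefficient of W_{s,n-s} is r^s(ρ23^{n-2s}+(ρ12ρ13)^{n-2s}), not ρ23^{n-s}+(ρ12ρ13)^{n-s} (false for ρ12=0, ρ23≠0, n=3), and the s-th term of W_{k,m} gets the factor [k choose s]_q. *)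

(* Defs.v *)
From HB Require Import structures.
From mathcomp Require Import all_boot all_order all_algebra.
From mathcomp Require Import all_classical all_reals all_analysis.
From mathcomp Require Import measurable_realfun.
Set Implicit Arguments.
Unset Strict Implicit.
Unset Printing Implicit Defensive.
Import Order.TTheory GRing.Theory Num.Theory.
Import numFieldNormedType.Exports.
Local Open Scope classical_set_scope.
Local Open Scope ring_scope.

Definition qnum (R : realType) (q : R) (n : nat) : R := \sum_(i < n) q ^+ i.

Definition qfact (R : realType) (q : R) (n : nat) : R :=
  \prod_(1 <= i < n.+1) qnum q i.

Definition qbinom (R : realType) (q : R) (n k : nat) : R :=
  if (k <= n)%N then qfact q n / (qfact q k * qfact q (n - k)) else 0.

(* (a)_n for the base q *)
Definition qpoch (R : realType) (a q : R) (n : nat) : R :=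
  \prod_(1 <= k < n.+1) (1 - a * q ^+ k.-1).

Definition infprod (R : realType) (u : nat -> R) : R :=
  limn (fun n => \prod_(0 <= i < n) u i).

Definition qpoch_inf (R : realType) (a q : R) : R :=
  infprod (fun k => 1 - a * q ^+ k).

Definition Sq (R : realType) (q : R) : set R :=
  `[- (2 / Num.sqrt (1 - q)), 2 / Num.sqrt (1 - q)].

Definition lq (R : realType) (q x a : R) : R :=
  (1 + a) ^+ 2 - (1 - q) * a * x ^+ 2.

Definition omegaq (R : realType) (q x y rho : R) : R :=
  (1 - rho ^+ 2) ^+ 2 - (1 - q) * x * y * rho * (1 + rho ^+ 2)
  + (1 - q) * rho ^+ 2 * (x ^+ 2 + y ^+ 2).

Definition fN (R : realType) (q x : R) : R :=
  qpoch_inf q q * Num.sqrt (1 - q) * Num.sqrt (4 - (1 - q) * x ^+ 2) / (2 * pi)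
  * infprod (fun i => lq q x (q ^+ i.+1)).

Definition Sq3 (R : realType) (q : R) : set (R * R * R) :=
  Sq q `*` Sq q `*` Sq q.

(* The type is inferred, so that it is a product of copies of measurableTypeR R,
   the type on which lebesgue_measure is a measure, rather than R * R * R. *)
Definition lebesgue3 (R : realType) :=
  ((@lebesgue_measure R \x @lebesgue_measure R) \x @lebesgue_measure R)%E.

(* f_3D with the normalizing constant C_3D left out *)
Definition f3D_unnorm (R : realType) (rho12 rho13 rho23 q : R)
    (p : R * R * R) : R :=
  let: (x, y, z) := p in
  fN q x * fN q y * fN q z
  * (qpoch_inf (rho12 ^+ 2) q * qpoch_inf (rho13 ^+ 2) q
     * qpoch_inf (rho23 ^+ 2) q
     / infprod (fun i => omegaq q x y (rho12 * q ^+ i)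
                         * omegaq q x z (rho13 * q ^+ i)
                         * omegaq q y z (rho23 * q ^+ i))).

Definition C3D (R : realType) (rho12 rho13 rho23 q : R) : R :=
  (fine (\int[@lebesgue3 R]_(p in Sq3 q)
          (f3D_unnorm rho12 rho13 rho23 q p)%:E)%E)^-1.

Definition f3D (R : realType) (rho12 rho13 rho23 q : R) (p : R * R * R) : R :=
  C3D rho12 rho13 rho23 q * f3D_unnorm rho12 rho13 rho23 q p.

(* The joint law of (X, Y, Z) is carried by S(q)^3 and has density f_3D there. *)
Definition has_density_f3D (d : measure_display) (T : measurableType d)
    (R : realType) (P : probability T R) (X Y Z : {RV P >-> R})
    (rho12 rho13 rho23 q : R) : Prop :=
  forall A : set (R * R * R), measurable A ->
    P ((fun w => (X w, Y w, Z w)) @^-1` A) =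
    (\int[@lebesgue3 R]_(p in A `&` Sq3 q) (f3D rho12 rho13 rho23 q p)%:E)%E.

(* h is a version of z |-> E(U | V = z); as versions are unique up to null sets
   of the law of V, this is the almost sure equality E(U | V = z) = h(z). *)
Definition cond_exp_is (d : measure_display) (T : measurableType d)
    (R : realType) (P : probability T R) (U : T -> R) (V : {RV P >-> R})
    (h : R -> R) : Prop :=
  [/\ P.-integrable setT (EFin \o U),
      measurable_fun setT h,
      P.-integrable setT (EFin \o (h \o V)) &
      forall B : set R, measurable B ->
        (\int[P]_(w in V @^-1` B) (U w)%:E =
         \int[P]_(w in V @^-1` B) (h (V w))%:E)%E].

(* The pair (p_{n-1}, p_n) for the monic three-term recurrence
   p_{n+1} = x p_n - c_n p_{n-1}, p_0 = 1, p_{-1} = 0. *)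
Fixpoint monic_rec (R : realType) (c : nat -> R) (n : nat) :
    {poly R} * {poly R} :=
  if n is m.+1 then
    let: (a, b) := monic_rec c m in (b, 'X * b - c m *: a)
  else (0, 1).

Definition qHermite (R : realType) (q : R) (n : nat) : {poly R} :=
  (monic_rec (qnum q) n).2.

(* At n = 0 the exponent n - 1 is irrelevant since qnum q 0 = 0. *)
Definition Rogers (R : realType) (beta q : R) (n : nat) : {poly R} :=
  (monic_rec (fun n => qnum q n * ((1 - beta ^+ 2 * q ^+ n.-1)
       / ((1 - beta * q ^+ n.-1) * (1 - beta * q ^+ n)))) n).2.

(* The factor qbinom q k s comes from the Carlitz expansion
   sum_j rho^j / [j]_q! H_{j+k}(x) H_{j+m}(y) of the Poisson-Mehler kernel;
   it is missing from the printed definition of W_{k,m}, with which the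
   formula for the fourth moment is false unless q or r vanishes. *)
Definition Wpoly (R : realType) (r q : R) (k m : nat) : {poly R} :=
  \sum_(s < k.+1)
    (qbinom q k s * q ^+ 'C(s, 2) * (- r) ^+ s * qpoch r q (m + s)
     / qpoch (r ^+ 2) q (m + s)) *: (qHermite q (k - s) * Rogers r q (m + s)).

(* The moments of U given V = v are polynomials in v, of degree at most n for
   the n-th moment, both for the powers of U and for H_n(U|q). *)
Definition poly_cond_moments (d : measure_display) (T : measurableType d)
    (R : realType) (P : probability T R) (q : R) (U V : {RV P >-> R}) : Prop :=
  forall n : nat,
    (exists2 p : {poly R}, (size p <= n.+1)%N &
       cond_exp_is (fun w => (qHermite q n).[U w]) V (fun v => p.[v])) /\
    (exists2 p : {poly R}, (size p <= n.+1)%N &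
       cond_exp_is (fun w => U w ^+ n) V (fun v => p.[v])).

(* Main.v *)
Require Import Defs.
From HB Require Import structures.
From mathcomp Require Import all_boot all_order all_algebra.
From mathcomp Require Import all_classical all_reals all_analysis.
From mathcomp Require Import measurable_realfun.
From mathcomp Require Import ring lra zify.
Set Implicit Arguments.
Unset Strict Implicit.
Unset Printing Implicit Defensive.
Import Order.TTheory GRing.Theory Num.Theory.
Import numFieldNormedType.Exports.
Local Open Scope classical_set_scope.
Local Open Scope ring_scope.

(** Conditional moments for the three-dimensional density built from
    Poisson-Mehler kernels.

    Write K_rho(x, y) for the sum of rho^n / [n]! H_n(x) H_n(y) over n.  On
    S(q) the Poisson-Mehler formula [mehler_product_cvg] says that K_rho equals
    (rho^2)_oo / prod_i omega(x, y | rho q^i), so the density is a constant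
    times
    f_N(x) f_N(y) f_N(z) K_{12}(x, y) K_{13}(x, z) K_{23}(y, z).
    The formula is proved on the side of the series: both sides satisfy the
    same first-order q-difference equation in rho ([mehler_qdiff]), a five-term
    identity between consecutive coefficients, and both tend to 1 at rho = 0.
    The series converges because H_n grows subexponentially, up to the factor
    (1 - q)^(-n/2), on S(q) ([hermite_growth]).

    The H_n are orthogonal for f_N ([fN_int_orth]).  Orthogonality to constants
    suffices, products being linearized by [hermite_linearization]; it is read
    off from the Chebyshev moments of f_N.  Truncating the infinite product in
    f_N leaves a polynomial times the semicircle density, whose Chebyshev
    moments obey a first-order recurrence ([cheb_finite_ratio]) that passes to
    the limit, and the limiting moments determine all moments of H_n U_k
    ([cheb_hermite_orth]).

    Now integrate u(X) v(Y) w(Z) against the density.  Expanding the three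
    kernels gives a triple series of one-dimensional Hermite moments
    ([triple_integral_cvg]); it is symmetric under permutations of the
    variables, so one pair, (Y, Z), represents all six.  For u = 1
    orthogonality collapses K_{12} K_{13} to K_a with a = rho_12 rho_13, and
    linearization turns the integral of f_N(y) H_n(y) K_a(y, z) K_b(y, z) over
    y, where b = rho_23, into a constant times
      sum_s [n choose s] a^s b^(n-s) V_{s,n-s}(z),
      V_{k,m}(z) = sum_j r^j / [j]! H_{j+k}(z) H_{j+m}(z),  r = a b
    ([triple_integral_hermite]).  Finally V_{k,m} = K_r(z, z) W_{k,m}(z): shifting k
    reduces to k = 0 ([carlitz_expansion]), and for k = 0 the symmetry of V in
    its indices yields the three-term recurrence of the Rogers polynomials
    ([mehler_Rogers]).  The factor K_r(z, z) is also what n = 0 produces, and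
    it cancels in the conditional expectation. *)

(** * q-integers and q-binomial coefficients *)

Section QCalculus.
Variables (R : realType) (q : R).
Hypothesis hq : -1 < q < 1.

Lemma qnumr0 : qnum q 0 = 0.
Proof. by rewrite /qnum big_ord0. Qed.

Lemma qnumr1 : qnum q 1 = 1.
Proof. by rewrite /qnum big_ord1 expr0. Qed.

Lemma qnumSr n : qnum q n.+1 = qnum q n + q ^+ n.
Proof. by rewrite /qnum big_ord_recr. Qed.

Lemma qnumD m n : qnum q (m + n) = qnum q m + q ^+ m * qnum q n.
Proof.
elim: n => [|n IH]; first by rewrite addn0 qnumr0 mulr0 addr0.
by rewrite addnS !qnumSr IH exprD mulrDr addrA.
Qed.

Lemma qnum_closed n : (1 - q) * qnum q n = 1 - q ^+ n.
Proof.
elim: n => [|n IH]; first by rewrite qnumr0 expr0; ring.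
by rewrite qnumSr mulrDr IH exprS; ring.
Qed.

Lemma normq_lt1 : `|q| < 1.
Proof. by rewrite ltr_norml. Qed.

(** Everything below is divided by q-integers, q-factorials and q-shifted
    factorials; for -1 < q < 1, q possibly negative, their positivity comes
    from this inequality. *)
Lemma onem_mul_expr_gt0 a n : `|a| < 1 -> 0 < 1 - a * q ^+ n.
Proof.
move=> a1; rewrite subr_gt0; apply: le_lt_trans (ler_norm _) _.
rewrite normrM normrX; apply: le_lt_trans a1.
by rewrite ler_piMr// exprn_ile1// ltW// normq_lt1.
Qed.

Lemma onem_exprS_gt0 n : 0 < 1 - q ^+ n.+1.
Proof. by rewrite exprS onem_mul_expr_gt0// normq_lt1. Qed.

Lemma onemq_gt0 : 0 < 1 - q.
Proof. by have := onem_exprS_gt0 0; rewrite expr1. Qed.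

Lemma qnumS_gt0 n : 0 < qnum q n.+1.
Proof.
by rewrite -(pmulr_rgt0 _ onemq_gt0) qnum_closed onem_exprS_gt0.
Qed.

Lemma qnumS_neq0 n : qnum q n.+1 != 0.
Proof. exact: lt0r_neq0 (qnumS_gt0 n). Qed.

Lemma qfact0 : qfact q 0 = 1.
Proof. by rewrite /qfact big_geq. Qed.

Lemma qfactS n : qfact q n.+1 = qnum q n.+1 * qfact q n.
Proof. by rewrite /qfact big_nat_recr//= mulrC. Qed.

Lemma qfact_gt0 n : 0 < qfact q n.
Proof.
elim: n => [|n IH]; first by rewrite qfact0.
by rewrite qfactS mulr_gt0// qnumS_gt0.
Qed.

Lemma qfact_neq0 n : qfact q n != 0.
Proof. exact: lt0r_neq0 (qfact_gt0 n). Qed.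

Lemma qbinom0 n : qbinom q n 0 = 1.
Proof. by rewrite /qbinom leq0n qfact0 mul1r subn0 divff// qfact_neq0. Qed.

Lemma qbinomnn n : qbinom q n n = 1.
Proof. by rewrite /qbinom leqnn subnn qfact0 mulr1 divff// qfact_neq0. Qed.

Lemma qbinom_small n k : (n < k)%N -> qbinom q n k = 0.
Proof. by move=> nk; rewrite /qbinom leqNgt nk. Qed.

Lemma qbinomD m k : qbinom q (k + m) k = qfact q (k + m) / (qfact q k * qfact q m).
Proof. by rewrite /qbinom leq_addr addKn. Qed.

Lemma qbinom_sub n k : (k <= n)%N -> qbinom q n (n - k) = qbinom q n k.
Proof.
by move=> kn; rewrite /qbinom leq_subr kn subKn// [X in _ / X]mulrC.
Qed.

Lemma qbinom_pascal n k :
  qbinom q n.+1 k.+1 = qbinom q n k.+1 + q ^+ (n - k) * qbinom q n k.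
Proof.
have [kn|nk|->] := ltngtP k n; last first.
- by rewrite subnn expr0 !qbinomnn mul1r (@qbinom_small n)// add0r.
- by rewrite !qbinom_small ?mulr0 ?addr0// ltnW.
have -> : n = (k + (n - k.+1).+1)%N by lia.
set m := (n - k.+1)%N.
rewrite addKn qbinomD.
have -> : (k + m.+1).+1 = (k.+1 + m.+1)%N by lia.
rewrite qbinomD.
have -> : (k + m.+1)%N = (k.+1 + m)%N by lia.
rewrite qbinomD addnS !qfactS.
have -> : (k.+1 + m).+1 = (m.+1 + k.+1)%N by lia.
rewrite qnumD.
by field; rewrite !qfact_neq0 !qnumS_neq0.
Qed.

Lemma qbinom_absorb n k :
  qbinom q n.+1 k * qnum q (n.+1 - k) = qnum q n.+1 * qbinom q n k.
Proof.
have [kn|nk|->] := ltngtP k n.+1; last first.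
- by rewrite subnn qnumr0 mulr0 (@qbinom_small n)// mulr0.
- by rewrite !qbinom_small ?mulr0 ?mul0r// ltnW.
rewrite -(subnKC (kn : (k <= n)%N)); set m := (n - k)%N.
rewrite -addnS !qbinomD addKn addnS !qfactS.
by field; rewrite !qfact_neq0 !qnumS_neq0.
Qed.

End QCalculus.

(** * Polynomials given by a monic three-term recurrence *)

Section MonicRec.
Variables (R : realType) (c : nat -> R).

Lemma monic_rec_fst n : (monic_rec c n.+1).1 = (monic_rec c n).2.
Proof. by rewrite /=; case: (monic_rec c n). Qed.

Lemma monic_rec0 : (monic_rec c 0).2 = 1. Proof. by []. Qed.

Lemma monic_rec1 : (monic_rec c 1).2 = 'X.
Proof. by rewrite /= mulr1 scaler0 subr0. Qed.

Lemma monic_recSS n :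
  (monic_rec c n.+2).2 = 'X * (monic_rec c n.+1).2 - c n.+1 *: (monic_rec c n).2.
Proof.
rewrite -(monic_rec_fst n).
have -> : monic_rec c n.+2 = let: (a, b) := monic_rec c n.+1 in
  (b, 'X * b - c n.+1 *: a) by [].
by case: (monic_rec c n.+1).
Qed.

Lemma monic_rec_size_monic n :
  ((monic_rec c n).2 \is monic) /\ size (monic_rec c n).2 = n.+1.
Proof.
suff: forall n, (((monic_rec c n).2 \is monic) /\ size (monic_rec c n).2 = n.+1)
  /\ (((monic_rec c n.+1).2 \is monic) /\ size (monic_rec c n.+1).2 = n.+2).
  by move=> /(_ n)[].
elim=> {n} [|n [[m1 s1] [m2 s2]]].
  by rewrite monic_rec0 monic_rec1 monic1 size_poly1 monicX size_polyX.
split; first by split.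
have nz : (monic_rec c n.+1).2 != 0 by rewrite monic_neq0.
have sX : size ('X * (monic_rec c n.+1).2) = n.+3.
  by rewrite mulrC size_mulX// s2.
have lt : (size (- (c n.+1 *: (monic_rec c n).2)%R)%R <
           size ('X * (monic_rec c n.+1).2)%R)%N.
  rewrite sX size_polyN; apply: leq_ltn_trans (size_scale_leq _ _) _.
  by rewrite s1; lia.
rewrite monic_recSS; split; last by rewrite size_polyDl.
rewrite monicE lead_coefDl// mulrC lead_coefMX.
by rewrite -monicE.
Qed.

End MonicRec.

(** * Linearization of products of q-Hermite polynomials *)

Section HermiteAlgebra.
Variables (R : realType) (q : R).
Hypothesis hq : -1 < q < 1.
Local Notation H n x := (qHermite q n).[x].

Lemma hermite0 x : H 0 x = 1.
Proof. by rewrite /qHermite monic_rec0 hornerE. Qed.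

Lemma hermite1 x : H 1 x = x.
Proof. by rewrite /qHermite monic_rec1 hornerE. Qed.

(** With the predecessor instead of n - 1 the recurrence also holds at n = 0,
    where [0] = 0 removes the junk value. *)
Lemma hermiteS n x : H n.+1 x = x * H n x - qnum q n * H n.-1 x.
Proof.
case: n => [|n]; first by rewrite hermite0 hermite1 qnumr0; ring.
by rewrite /qHermite monic_recSS !hornerE.
Qed.

(** The falling q-factorial [i]! / [i - s]!, zero for s > i because the factor
    [0] appears; sums over s then need no case split at s = i. *)
Definition qffact (i s : nat) : R := \prod_(t < s) qnum q (i - t).

Lemma qffact0 i : qffact i 0 = 1.
Proof. by rewrite /qffact big_ord0. Qed.

Lemma qffactS i s : qffact i s.+1 = qffact i s * qnum q (i - s).
Proof. by rewrite /qffact big_ord_recr. Qed.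

Lemma qffact_small i s : (i < s)%N -> qffact i s = 0.
Proof.
move=> si; rewrite /qffact (bigD1 (Ordinal si))//= subnn qnumr0 mul0r.
by [].
Qed.

Lemma qffact_fact s j : qffact (j + s) s * qfact q j = qfact q (j + s).
Proof.
elim: s j => [|s IH] j; first by rewrite qffact0 mul1r addn0.
rewrite qffactS addnS -addSn addnK -IH qfactS; ring.
Qed.

(** Induction on n through H_(n+1) H_i = x H_n H_i - [n] H_(n-1) H_i.  The
    second conjunct of the induction puts the last term in the range of the
    first sum: [n] [n-1 choose s] = [n choose s] [n - s].  Then
    [n + i - 2s] - [n - s] = q^(n-s) [i - s] and the Pascal rule finish. *)
Lemma hermite_linearization n i x :
  H n x * H i x =
  \sum_(s < n.+1) qbinom q n s * qffact i s * H (n + i - s.*2) x.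
Proof.
suff [] : (H n x * H i x =
    \sum_(s < n.+1) qbinom q n s * qffact i s * H (n + i - s.*2) x) /\
  qnum q n * (H n.-1 x * H i x) =
    \sum_(s < n.+1) qbinom q n s * qnum q (n - s) * qffact i s *
      H (n + i - s.*2).-1 x by [].
elim: n => [|n [IH IH']].
  rewrite !big_ord1 /= hermite0 qbinom0// qffact0 qnumr0 add0n subn0.
  by rewrite !mul1r !mul0r.
split; last first.
  rewrite big_ord_recr/= subnn qnumr0 mulr0 !mul0r addr0 IH big_distrr/=.
  apply: eq_bigr => s _; rewrite qbinom_absorb// !mulrA.
  have [si|si] := ltnP i s; first by rewrite qffact_small// !(mulr0,mul0r).
  by congr (_ * H _ _); have := ltn_ord s; lia.
(* x H_k = H_(k+1) + [k] H_(k-1) with k = (n - s) + (i - s): the raised terms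
   form the first sum, the lowered ones cancel against [n] H_(n-1) H_i up to
   q^(n-s) [i - s]. *)
have E : x * (H n x * H i x) - qnum q n * (H n.-1 x * H i x) =
    \sum_(s < n.+1) (qbinom q n s * qffact i s * H (n.+1 + i - s.*2) x) +
    \sum_(s < n.+1) (q ^+ (n - s) * qbinom q n s * qffact i s.+1 *
                     H (n.+1 + i - s.+1.*2) x).
  rewrite IH IH' big_distrr/= -sumrB -big_split/=.
  apply: eq_bigr => s _; rewrite qffactS.
  have [si|si] := ltnP i s; first by rewrite qffact_small//; ring.
  have sn : (s <= n)%N by rewrite -ltnS.
  have -> : (n.+1 + i - s.*2)%N = (n + i - s.*2).+1 by lia.
  have -> : (n.+1 + i - s.+1.*2)%N = (n + i - s.*2).-1 by lia.
  rewrite hermiteS.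
  have -> : (n + i - s.*2)%N = ((n - s) + (i - s))%N by lia.
  by rewrite qnumD; ring.
have -> : H n.+1 x * H i x =
    x * (H n x * H i x) - qnum q n * (H n.-1 x * H i x).
  by rewrite hermiteS; ring.
rewrite E [RHS]big_ord_recl.
have -> : qbinom q n.+1 0 = qbinom q n 0 by rewrite !qbinom0.
rewrite [X in _ = _ + X](eq_bigr (fun s : 'I_n.+1 =>
    (qbinom q n s.+1 * qffact i s.+1 * H (n.+1 + i - s.+1.*2) x) +
    (q ^+ (n - s) * qbinom q n s * qffact i s.+1 *
                     H (n.+1 + i - s.+1.*2) x))); last first.
  by move=> s _; rewrite /= /bump/= add1n qbinom_pascal//; ring.
rewrite big_split/= addrA; congr (_ + _).
rewrite -(big_ord_recl n.+1 (fun s => qbinom q n s * qffact i s * H (n.+1 + i - s.*2) x)).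
by rewrite [RHS]big_ord_recr/= (@qbinom_small _ _ n n.+1)// !mul0r addr0.
Qed.

End HermiteAlgebra.

(** * Mixed moments of Chebyshev and q-Hermite polynomials *)

Section ChebyshevFunctional.
Variables (R : realType) (q : R).
Hypothesis hq : -1 < q < 1.

(** Here a N k stands for the integral of U_2k against the semicircle density
    times the first N factors (1 + q^i)^2 - (1 - q) q^i x^2 of the weight; the
    hypotheses spell out how one more factor acts on U_2k.  The closed form is
    a finite Jacobi triple product,
    a N k = (-1)^k q^(k(k+1)/2) [2N+1 choose N-k] a 0 0, and the conclusion is
    its ratio in k, which is enough in the limit. *)
Lemma cheb_finite_ratio (a : nat -> nat -> R) :
  (forall k, a 0 k.+1 = 0) ->
  (forall N, a N.+1 0 = (1 + q ^+ N.+1 ^+ 2) * a N 0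
                          - q ^+ N.+1 * (a N 1 - a N 0)) ->
  (forall N k, a N.+1 k.+1 = (1 + q ^+ N.+1 ^+ 2) * a N k.+1
                          - q ^+ N.+1 * (a N k + a N k.+2)) ->
  forall N k, (1 - q ^+ (N + k).+2) * a N k.+1 =
              - (q ^+ k.+1 - q ^+ N.+1) * a N k.
Proof.
move=> a0 aS0 aSS; elim=> [|N IH] k.
  rewrite a0 mulr0; case: k => [|k]; last by rewrite a0 mulr0.
  by rewrite subrr oppr0 mul0r.
have nz j : 1 - q ^+ j.+1 != 0 by rewrite lt0r_neq0// onem_exprS_gt0.
have solve j : a N j.+1 =
    - (q ^+ j.+1 - q ^+ N.+1) / (1 - q ^+ (N + j).+2) * a N j.
  by rewrite mulrAC -IH mulrAC divff ?mul1r// nz.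
case: k => [|k].
  rewrite aSS aS0 !solve.
  have := nz N.+1; have := nz N.+2; rewrite !addn0 !addn1.
  rewrite !exprS !expr0; set Q := q ^+ N => n1 n2.
  by field; rewrite n1 n2.
rewrite !aSS !solve.
have := nz (N + k).+1; have := nz (N + k).+2; have := nz (N + k).+3.
rewrite !addnS !addSn !exprS !exprD; set Q := q ^+ N; set K := q ^+ k.
move=> n1 n2 n3.
by field; rewrite n1 n2 n3.
Qed.

(** M n k stands for the moment of h_n U_k, with h_n a rescaled H_n.  The two
    recurrences in n determine M from the moments of the U_k alone, and when
    those are theta coefficients they are solved by
    M n (n + 2j) = (-1)^j q^(j(j+1)/2) (q)_(n+j) / (q)_j M 0 0, all other
    moments being 0; in particular M n 0 = 0 for n > 0. *)
Lemma cheb_hermite_orth (M : nat -> nat -> R) :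
  (forall n, M n.+1 0 = M n 1 - (1 - q ^+ n) * M n.-1 0) ->
  (forall n k, M n.+1 k.+1 = M n k.+2 + M n k - (1 - q ^+ n) * M n.-1 k.+1) ->
  (forall j, M 0 j.*2.+1 = 0) ->
  (forall j, M 0 j.+1.*2 = - q ^+ j.+1 * M 0 j.*2) ->
  forall n, M n.+1 0 = 0.
Proof.
move=> H0 HS Modd Meven.
pose p n : R := \prod_(i < n) (1 - q ^+ i.+1).
have p0 : p 0 = 1 by rewrite /p big_ord0.
have pS n : p n.+1 = (1 - q ^+ n.+1) * p n by rewrite /p big_ord_recr/= mulrC.
have nz j : 1 - q ^+ j.+1 != 0 by rewrite lt0r_neq0// onem_exprS_gt0.
have pn0 n : p n != 0.
  by elim: n => [|n IH]; rewrite ?p0 ?oner_neq0// pS mulf_neq0.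
pose F n j := M 0 j.*2 * (p (n + j)%N / p j).
pose P n := [/\ forall j, M n (n + j.*2)%N = F n j,
  forall j, M n (n + j.*2).+1%N = 0 & forall k, (k < n)%N -> M n k = 0].
suff PP : forall n, P n /\ P n.+1 by move=> n; have [_ [_ _ C]] := PP n; exact: C.
have P0 : P 0.
  split=> [j|j|]; rewrite ?add0n ?Modd//.
  by rewrite /F add0n divff// mulr1.
have step n : P n -> P n.-1 -> P n.+1.
  move=> [A B C] [A' B' C']; split=> [j|j|k].
  - rewrite addSn HS.
    have -> : M n (n + j.*2).+2%N = F n j.+1 by rewrite -A doubleS !addnS.
    rewrite A.
    have -> : (1 - q ^+ n) * M n.-1 (n + j.*2).+1%N = (1 - q ^+ n) * F n.-1 j.+1.
      case: n {A B C B' C'} A' => [|n] A'; first by rewrite expr0 subrr !mul0r.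
      by rewrite -A' doubleS/= !addnS addSn.
    case: n {A B C A' B' C'} => [|n].
      rewrite /F Meven add1n !add0n !pS expr0.
      by field; rewrite nz pn0.
    rewrite /F Meven /= !addSn !addnS !pS.
    have := nz j; have := pn0 j; rewrite !exprS exprD => n1 n2.
    by field; rewrite n1 n2.
  - rewrite HS.
    have -> : M n (n.+1 + j.*2).+2%N = M n (n + j.+1.*2).+1%N.
      by rewrite doubleS !addnS addSn.
    rewrite B addSn B.
    case: n {A B C A' C'} B' => [|n] B'; first by rewrite expr0; ring.
    have -> : (n.+1 + j.*2).+2 = (n + j.+1.*2).+1 by rewrite doubleS; lia.
    by rewrite B'; ring.
  - case: k => [_|k kn].
      rewrite H0; case: n A B C A' B' C' => [|[|n]] A B C A' B' C'.
      + by have := B 0%N; rewrite addn0 => ->; rewrite expr0; ring.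
      + have := A 0%N; rewrite addn0 => ->; have := A' 0%N.
        rewrite addn0/= => ->; rewrite /F addn0 addn0 pS p0 expr1; by field.
      + by rewrite (C 1%N)// (C' 0%N)//; ring.
    rewrite HS (C k)//.
    case: n A B C A' B' C' kn => [//|n] A B C A' B' C' kn.
    have [kn1|] := ltnP k.+2 n.+1.
      by rewrite (C k.+2)// (C' k.+1)//; ring.
    rewrite leq_eqVlt => /orP[/eqP kn1|kn1]; last first.
      have -> : k = n by lia.
      have := B 0%N; rewrite addn0 => ->; have := B' 0%N.
      by rewrite addn0/= => ->; ring.
    have -> : k.+2 = (n.+1 + 0.*2)%N by rewrite addn0.
    have -> : k.+1 = (n.+1.-1 + 0.*2)%N by rewrite addn0/=; lia.
    rewrite A A' /F !addn0 /= pS p0; by field.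
by elim=> [|n [IH1 IH2]]; split=> //; apply: step.
Qed.

End ChebyshevFunctional.

(** * Series and products dominated by a geometric sequence *)

Section GeometricallyDominated.
Variable R : realType.
Implicit Types (u : nat -> R) (C t : R).

Lemma geo_dominated_ge0 C t u : (forall n, `|u n| <= C * t ^+ n) -> 0 <= C.
Proof.
by move=> hu; have := le_trans (normr_ge0 _) (hu 0%N); rewrite expr0 mulr1.
Qed.

Lemma geo_partial_sum_le C t u n : 0 <= t < 1 ->
  (forall n, `|u n| <= C * t ^+ n) -> `|series u n| <= C / (1 - t).
Proof.
move=> /andP[t0 t1] hu; have C0 := geo_dominated_ge0 hu.
have t10 : 0 < 1 - t by rewrite subr_gt0.
apply: le_trans (ler_norm_sum _ _ _) _.
apply: le_trans (ler_sum _ (fun i _ => hu i)) _.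
rewrite -big_distrr/= ler_wpM2l// -[X in _ <= X]mul1r ler_pdivlMr//.
have -> : (\sum_(0 <= i < n) t ^+ i) * (1 - t) = 1 - t ^+ n.
  elim: n => [|n IH]; first by rewrite big_geq// mul0r expr0 subrr.
  by rewrite big_nat_recr//= mulrDl IH exprS; ring.
by rewrite gerBl exprn_ge0.
Qed.

Lemma geo_series_cvg C t u : 0 <= t < 1 ->
  (forall n, `|u n| <= C * t ^+ n) -> cvgn (series u).
Proof.
move=> /andP[t0 t1] hu; have C0 := geo_dominated_ge0 hu.
apply: normed_cvg.
apply: (series_le_cvg (v_ := geometric C t)) => [n|n|n|].
- exact: normr_ge0.
- by rewrite /= mulr_ge0// exprn_ge0.
- exact: hu.
- by apply: is_cvg_geometric_series; rewrite ger0_norm.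
Qed.

Lemma geo_prod_bounded C t u n : 0 <= t < 1 ->
  (forall n, `|u n| <= C * t ^+ n) ->
  `|\prod_(0 <= i < n) (1 + u i)| <= expR (C / (1 - t)).
Proof.
move=> ht hu; have C0 := geo_dominated_ge0 hu.
have ht0 : 0 <= t by case/andP: ht.
apply: le_trans (_ : expR (\sum_(0 <= i < n) C * t ^+ i) <= _); last first.
  rewrite ler_expR; have := @geo_partial_sum_le C t (fun i => C * t ^+ i) n ht.
  rewrite ger0_norm; last by apply: sumr_ge0 => i _; rewrite mulr_ge0// exprn_ge0.
  by apply=> i; rewrite ger0_norm// mulr_ge0// exprn_ge0.
rewrite normr_prod; elim: n => [|n IH]; first by rewrite !big_geq// expR0.
rewrite !big_nat_recr//= expRD ler_pM// ?prodr_ge0//.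
apply: le_trans (expR_ge1Dx _).
by apply: le_trans (ler_normD _ _) _; rewrite normr1 lerD2l.
Qed.

(** The increments of the partial products are again geometrically dominated,
    the partial products being bounded. *)
Lemma geo_prod_cvg C t u : 0 <= t < 1 ->
  (forall n, `|u n| <= C * t ^+ n) ->
  cvgn (fun n => \prod_(0 <= i < n) (1 + u i)).
Proof.
move=> ht hu; set p := (X in cvgn X).
have -> : p = (fun n => p 0%N + series (telescope p) n).
  by apply/funext => n; rewrite -eq_sum_telescope.
apply: is_cvgD; first exact: is_cvg_cst.
apply: (@geo_series_cvg (expR (C / (1 - t)) * C) t) => // n.
rewrite /telescope /= /p big_nat_recr//= mulrDr mulr1 [X in X - _]addrC addrK.
by rewrite normrM -mulrA ler_pM// geo_prod_bounded.
Qed.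

(** The inverse product is of the same kind: (1 + u)^-1 = 1 - u / (1 + u). *)
Lemma geo_prod_inv_bounded C t d u : 0 <= t < 1 ->
  (forall n, `|u n| <= C * t ^+ n) -> 0 < d -> (forall n, d <= 1 + u n) ->
  exists2 M, 0 < M & forall n, (\prod_(0 <= i < n) (1 + u i))^-1 <= M.
Proof.
move=> ht hu d0 hd; exists (expR (C / d / (1 - t))); first exact: expR_gt0.
move=> n.
have pos i : 0 < 1 + u i by apply: lt_le_trans (hd i).
have -> : (\prod_(0 <= i < n) (1 + u i))^-1 =
    \prod_(0 <= i < n) (1 + - u i / (1 + u i)).
  rewrite -prodfV; apply: eq_bigr => i _.
  by field; rewrite lt0r_neq0.
apply: le_trans (ler_norm _) _; apply: geo_prod_bounded => // i.
rewrite normrM normrN normfV (gtr0_norm (pos i)) mulrAC.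
rewrite ler_pM// ?invr_ge0 ?(ltW (pos i))//.
by rewrite lef_pV2 ?posrE.
Qed.

Lemma geo_prod_lim_gt0 C t d u : 0 <= t < 1 ->
  (forall n, `|u n| <= C * t ^+ n) -> 0 < d -> (forall n, d <= 1 + u n) ->
  0 < limn (fun n => \prod_(0 <= i < n) (1 + u i)).
Proof.
move=> ht hu d0 hd; have [M M0 hM] := geo_prod_inv_bounded ht hu d0 hd.
apply: lt_le_trans (_ : M^-1 <= _); first by rewrite invr_gt0.
apply: limr_ge; first exact: geo_prod_cvg ht hu.
apply: nearW => n; rewrite -[X in _ <= X]invrK lef_pV2 ?posrE//.
rewrite invr_gt0 prodr_gt0// => i _; exact: lt_le_trans (hd i).
Qed.

End GeometricallyDominated.

(** * q-shifted factorials *)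

Section QPochhammer.
Variables (R : realType) (q : R).
Hypothesis hq : -1 < q < 1.

Lemma normq_itv : 0 <= `|q| < 1.
Proof. by rewrite normr_ge0 normq_lt1. Qed.

Let dom (a : R) n : `|- (a * q ^+ n)| <= `|a| * `|q| ^+ n.
Proof. by rewrite normrN normrM normrX. Qed.

Let low a n : `|a| < 1 -> 1 - `|a| <= 1 + - (a * q ^+ n).
Proof.
move=> a1; rewrite lerD2l lerN2; apply: le_trans (ler_norm _) _.
rewrite normrM normrX ler_piMr// exprn_ile1//.
by have /andP[_ /ltW] := normq_itv.
Qed.

Lemma qpoch_partial_cvg a :
  (fun n => \prod_(0 <= k < n) (1 - a * q ^+ k)) @ \oo --> qpoch_inf a q.
Proof. exact: geo_prod_cvg normq_itv (dom a). Qed.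

Lemma qpoch_inf_gt0 a : `|a| < 1 -> 0 < qpoch_inf a q.
Proof.
move=> a1; apply: geo_prod_lim_gt0 normq_itv (dom a) _ (fun n => low n a1).
by rewrite subr_gt0.
Qed.

Lemma qpochS a n : qpoch a q n.+1 = qpoch a q n * (1 - a * q ^+ n).
Proof. by rewrite /qpoch big_nat_recr. Qed.

Lemma qpoch0 a : qpoch a q 0 = 1.
Proof. by rewrite /qpoch big_geq. Qed.

Lemma qpoch_gt0 a n : `|a| < 1 -> 0 < qpoch a q n.
Proof.
move=> a1; elim: n => [|n IH]; first by rewrite qpoch0.
by rewrite qpochS mulr_gt0// onem_mul_expr_gt0.
Qed.

(** [n]! (1 - q)^n = (q)_n, whose inverse is bounded in n. *)
Lemma qfact_inv_bounded :
  exists2 M, 0 < M & forall n, (qfact q n)^-1 <= M * (1 - q) ^+ n.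
Proof.
have [|M M0 hM] := geo_prod_inv_bounded normq_itv (dom q) _
    (fun n => low n (normq_lt1 hq)).
  by rewrite subr_gt0 normq_lt1.
exists M => // n; have q0 := onemq_gt0 hq.
rewrite -ler_pdivrMr ?exprn_gt0// -invfM.
suff -> : qfact q n * (1 - q) ^+ n = \prod_(0 <= i < n) (1 + - (q * q ^+ i)).
  exact: hM.
elim: {hM} n => [|n IH]; first by rewrite qfact0 expr0 big_geq// mul1r.
rewrite big_nat_recr//= -IH qfactS exprSr.
have <- : (1 - q) * qnum q n.+1 = 1 + - (q * q ^+ n).
  by rewrite qnum_closed exprS.
by ring.
Qed.

End QPochhammer.

(** * Linear combinations and shifts of series *)

Section SeriesTools.
Variable R : realType.
Implicit Types (u v : nat -> R).

Lemma series_cvgD u v a b : series u @ \oo --> a -> series v @ \oo --> b ->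
  series (fun n => u n + v n) @ \oo --> a + b.
Proof.
move=> ua vb; rewrite (_ : series _ = (fun n => series u n + series v n)).
  exact: cvgD.
by apply/funext => n; rewrite /series/= big_split.
Qed.

Lemma series_cvgZ u k a : series u @ \oo --> a ->
  series (fun n => k * u n) @ \oo --> k * a.
Proof.
move=> ua; rewrite (_ : series _ = (fun n => k * series u n)).
  by apply: cvgM => //; exact: cvg_cst.
by apply/funext => n; rewrite /series/= big_distrr.
Qed.

Definition delay u n := if n is n'.+1 then u n' else 0.

Lemma series_cvg_delay u a : series u @ \oo --> (a : R) ->
  series (delay u) @ \oo --> (a : R).
Proof.
move=> ua; rewrite -cvg_shiftS.
suff -> : [sequence series (delay u) n.+1]_n = series u by [].
by apply/funext => n; rewrite /series/= big_nat_recl//= add0r.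
Qed.

End SeriesTools.

(** * Growth of the q-Hermite polynomials on S(q) *)

Section HermiteGrowth.
Variables (R : realType) (q : R).
Hypothesis hq : -1 < q < 1.
Local Notation H n x := (qHermite q n).[x].
Local Notation s := (Num.sqrt (1 - q)).

Lemma sqrt_onemq_gt0 : 0 < s.
Proof. by rewrite sqrtr_gt0 onemq_gt0. Qed.

Lemma sqr_sqrt_onemq : s ^+ 2 = 1 - q.
Proof. by rewrite sqr_sqrtr// ltW// onemq_gt0. Qed.

Lemma Sq_scaled_le2 x : Sq q x -> `|s * x| <= 2.
Proof.
rewrite /Sq /= in_itv/= => /andP[x1 x2].
have s0 := sqrt_onemq_gt0.
rewrite normrM gtr0_norm// mulrC -ler_pdivlMr// ler_norml x1 x2.
by [].
Qed.

Lemma Sq_scaled_sqr x : Sq q x -> (1 - q) * x ^+ 2 <= 4.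
Proof.
move=> /Sq_scaled_le2; have := sqr_sqrt_onemq; set r := s => <- h.
rewrite -exprMn -real_normK ?num_real//.
have := normr_ge0 (r * x); nra.
Qed.

Lemma hermite_scaledS n x :
  s ^+ n.+1 * H n.+1 x =
  (s * x) * (s ^+ n * H n x) - (1 - q ^+ n) * (s ^+ n.-1 * H n.-1 x).
Proof.
rewrite hermiteS -qnum_closed; have := sqr_sqrt_onemq; set r := s => <-.
case: n => [|n]; first by rewrite qnumr0 expr0 expr1; ring.
by rewrite /= !exprS; ring.
Qed.

(** With s x = 2 cos th and h_n = s^n H_n(x), the quantity
    E_n = h_(n+1)^2 - s x h_(n+1) h_n + h_n^2 is the squared modulus of
    h_(n+1) - exp(i th) h_n.  It would be constant for Chebyshev polynomials
    and changes only through the perturbation q^n h_(n-1), so that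
    |h_(n+1)| <= |h_n| + sqrt E_n,
    sqrt E_(n+1) <= sqrt E_n + |q|^(n+1) |h_n|.
    Weighting sqrt E_n by K = 1 / (t - 1), the sum |h_n| + K sqrt E_n grows by
    at most the factor t (1 + K |q|^(n+1)) at each step, and the product of the
    second factors is bounded. *)
Lemma hermite_growth t : 1 < t -> exists2 C, 0 <= C &
  forall n x, Sq q x -> `|s ^+ n * H n x| <= C * t ^+ n.
Proof.
move=> t1; pose K := (t - 1)^-1.
have K0 : 0 < K by rewrite invr_gt0 subr_gt0.
have tK : t = 1 + K^-1 by rewrite invrK; ring.
have domK n : `|K * `|q| ^+ n.+1| <= K * `|q| ^+ n.
  rewrite ger0_norm; last by rewrite mulr_ge0 ?exprn_ge0// ltW.
  rewrite ler_pM2l// exprS ler_piMl ?exprn_ge0//.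
  by have /andP[_ /ltW] := normq_itv hq.
exists (expR (K / (1 - `|q|)) * (1 + K)).
  by rewrite mulr_ge0 ?expR_ge0//; lra.
move=> n x Sx; set xi := s * x.
have xi2 : `|xi| <= 2 := Sq_scaled_le2 Sx.
pose h n := s ^+ n * H n x.
pose E n := h n.+1 ^+ 2 - xi * h n.+1 * h n + h n ^+ 2.
have xi24 : xi ^+ 2 <= 4.
  by rewrite -real_normK ?num_real//; have := normr_ge0 xi; nra.
have E_sq n' : (xi * h n'.+1 - 2 * h n') ^+ 2 <= 4 * E n'.
  have -> : 4 * E n' = (xi * h n'.+1 - 2 * h n') ^+ 2 + (4 - xi ^+ 2) * h n'.+1 ^+ 2.
    by rewrite /E; ring.
  by rewrite lerDl mulr_ge0 ?sqr_ge0// subr_ge0.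
have E0 n' : 0 <= E n'.
  by have := le_trans (sqr_ge0 _) (E_sq n'); rewrite pmulr_rge0.
have h_step n' : `|h n'.+1| <= `|h n'| + Num.sqrt (E n').
  rewrite -lerBlDl; apply: le_trans (ler_norm _) _.
  rewrite -sqrtr_sqr ler_wsqrtr// /E.
  rewrite -[h n'.+1 ^+ 2]real_normK ?num_real// -[h n' ^+ 2]real_normK ?num_real//.
  have : xi * h n'.+1 * h n' <= 2 * (`|h n'.+1| * `|h n'|).
    apply: le_trans (ler_norm _) _.
    rewrite -mulrA (normrM xi) (normrM (h _)).
    by apply: ler_wpM2r => //; exact: mulr_ge0.
  by lra.
have E_step n' : Num.sqrt (E n'.+1) <= Num.sqrt (E n') + `|q| ^+ n'.+1 * `|h n'|.
  set e := q ^+ n'.+1 * h n'.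
  have -> : `|q| ^+ n'.+1 * `|h n'| = `|e| by rewrite /e (normrM (q ^+ _)) normrX.
  have -> : E n'.+1 = E n' + e ^+ 2 + e * (xi * h n'.+1 - 2 * h n').
    rewrite /E (_ : h n'.+2 = xi * h n'.+1 - h n' + e); first by ring.
    by rewrite /h /e hermite_scaledS /= -/(h n'.+1) -/(h n') -/xi; ring.
  have r0 : 0 <= Num.sqrt (E n') + `|e| by rewrite addr_ge0 ?sqrtr_ge0.
  rewrite -(ger0_norm r0) -sqrtr_sqr ler_wsqrtr//.
  set Z := xi * h n'.+1 - 2 * h n'.
  have Z2 : `|Z| <= 2 * Num.sqrt (E n').
    have -> : 2 * Num.sqrt (E n') = Num.sqrt (4 * E n').
      rewrite sqrtrM//; congr (_ * _).
      by rewrite (_ : 4 = 2 ^+ 2 :> R) ?sqrtr_sqr ?ger0_norm//; ring.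
    by rewrite -(sqrtr_sqr Z) ler_wsqrtr//; exact: E_sq.
  have eZ : e * Z <= `|e| * (2 * Num.sqrt (E n')).
    apply: le_trans (ler_norm _) _; rewrite (normrM e).
    by apply: ler_wpM2l => //; exact: normr_ge0.
  have e2 : e ^+ 2 = `|e| ^+ 2 by rewrite real_normK ?num_real.
  have d2 : E n' = Num.sqrt (E n') ^+ 2 by rewrite sqr_sqrtr.
  rewrite e2 {1}d2 sqrrD -mulr_natr -addrA addrAC.
  by move: eZ; clear; set d := Num.sqrt (E n'); lra.
pose M n := `|h n| + K * Num.sqrt (E n).
suff : M n <= (\prod_(0 <= i < n) (1 + K * `|q| ^+ i.+1)) * (t ^+ n * (1 + K)).
  move=> hM; apply: le_trans (_ : M n <= _).
    by rewrite lerDl mulr_ge0 ?sqrtr_ge0// ltW.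
  apply: le_trans hM _.
  rewrite [t ^+ n * _]mulrC mulrA ler_wpM2r ?exprn_ge0//; first by lra.
  rewrite ler_wpM2r//; first by lra.
  apply: le_trans (ler_norm _) _.
  exact: geo_prod_bounded (normq_itv hq) domK.
elim: n => [|n IH].
  rewrite big_geq// expr0 !mul1r /M /E /h.
  rewrite hermite0 hermite1 expr0 expr1 mul1r normr1 -/xi.
  have -> : xi ^+ 2 - xi * xi * 1 + 1 ^+ 2 = 1 by ring.
  by rewrite sqrtr1 mulr1.
apply: le_trans (_ : (1 + K * `|q| ^+ n.+1) * t * M n <= _); last first.
  rewrite big_nat_recr//= (exprS t); set A := 1 + K * _.
  set P := \prod_(_ <= _ < _) _ in IH *.
  rewrite [leRHS](_ : _ = A * (t * (P * (t ^+ n * (1 + K))))); last by ring.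
  rewrite -mulrA.
  rewrite ler_wpM2l//; first by rewrite /A addr_ge0// mulr_ge0 ?exprn_ge0// ltW.
  by rewrite ler_wpM2l//; lra.
rewrite /M.
have h1 := h_step n; have h2 := E_step n.
set a := `|h n| in h1 h2 *; set d := Num.sqrt (E n) in h1 h2 *.
set Q := `|q| ^+ n.+1 in h2 *.
have a0 : 0 <= a by exact: normr_ge0.
have d0 : 0 <= d by exact: sqrtr_ge0.
have Q0 : 0 <= Q by exact: exprn_ge0.
apply: le_trans (_ : a + d + K * (d + Q * a) <= _).
  by apply: lerD => //; rewrite ler_pM2l.
have Kt : t * K = K + 1.
  by rewrite tK mulrDl mul1r mulVf ?gt_eqF.
have -> : (1 + K * Q) * t * (a + K * d) =
  (t * a + (t * K) * d) + K * Q * (t * a + (t * K) * d) by ring.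
rewrite Kt.
have KQ : 0 <= K * Q by rewrite mulr_ge0// ltW.
have Kd : 0 <= (K + 1) * d by rewrite mulr_ge0//; lra.
have ta : a <= t * a by rewrite ler_peMl// ltW.
have : K * Q * a <= K * Q * (t * a + (K + 1) * d) by rewrite ler_wpM2l//; lra.
by lra.
Qed.

End HermiteGrowth.

(** * The Poisson-Mehler kernel *)

Section MehlerKernel.
Variables (R : realType) (q : R).
Hypothesis hq : -1 < q < 1.
Local Notation H n x := (qHermite q n).[x].
Local Notation s := (Num.sqrt (1 - q)).
Implicit Types rho x y : R.

Definition mehler_term (rho : R) (k m : nat) (x y : R) (j : nat) : R :=
  rho ^+ j / qfact q j * (H (j + k) x * H (j + m) y).

(** For k = m = 0 this is the Poisson-Mehler kernel; the shifted series are the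
    ones that Carlitz expands. *)
Definition mehler (rho : R) (k m : nat) (x y : R) : R :=
  limn (series (mehler_term rho k m x y)).

(** [hermite_growth] is used with t = 2 / (1 + |rho|): then t > 1 while
    |rho| t^2 < 1, since 4 |rho| < (1 + |rho|)^2. *)
Lemma mehler_dominated rho k m : `|rho| < 1 ->
  exists C t, 0 <= t < 1 /\ forall j x y, Sq q x -> Sq q y ->
    `|mehler_term rho k m x y j| <= C * t ^+ j.
Proof.
move=> r1; set a := `|rho| in r1 *; have a0 : 0 <= a := normr_ge0 _.
pose t := 2 / (1 + a).
have t1 : 1 < t by rewrite /t ltr_pdivlMr ?mul1r; lra.
have t0 : 0 < t by lra.
have at1 : a * t ^+ 2 < 1.
  by rewrite /t expr_div_n mulrA ltr_pdivrMr ?exprn_gt0 ?mul1r; nra.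
clearbody t; have [C C0 hC] := hermite_growth hq t1.
have [M M0 hM] := qfact_inv_bounded hq.
have s0 := sqrt_onemq_gt0 hq.
have ss n : 0 < s ^+ n by rewrite exprn_gt0.
exists (M * (C * t ^+ k / s ^+ k) * (C * t ^+ m / s ^+ m)), (a * t ^+ 2).
split=> [|j x y Sx Sy].
  by rewrite mulr_ge0 ?exprn_ge0 ?(ltW t0).
have hH n z : Sq q z -> `|H n z| <= C * t ^+ n / s ^+ n.
  move=> Sz; rewrite ler_pdivlMr//; apply: le_trans (hC n z Sz).
  by rewrite normrM mulrC (gtr0_norm (ss n)).
have qf0 : 0 < (qfact q j)^-1 by rewrite invr_gt0 qfact_gt0.
rewrite /mehler_term !normrM normrX -/a (gtr0_norm qf0).
apply: le_trans (_ : a ^+ j * (M * (1 - q) ^+ j) *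
  ((C * t ^+ (j + k) / s ^+ (j + k)) * (C * t ^+ (j + m) / s ^+ (j + m))) <= _).
  apply: ler_pM; rewrite ?mulr_ge0 ?exprn_ge0 ?(ltW qf0)//.
  - by rewrite ler_wpM2l ?exprn_ge0.
  - by apply: ler_pM => //; exact: hH.
have -> : (1 - q) ^+ j = (s ^+ j) ^+ 2.
  by rewrite -exprM mulnC exprM sqr_sqrt_onemq.
rewrite exprMn (_ : (t ^+ 2) ^+ j = (t ^+ j) ^+ 2); last first.
  by rewrite -!exprM mulnC.
rewrite !exprD.
have := ss j; have := ss k; have := ss m.
set Sj := s ^+ j; set Sk := s ^+ k; set Sm := s ^+ m => m0 k0 j0.
rewrite le_eqVlt; apply/orP; left; apply/eqP; field.
by rewrite !gt_eqF.
Qed.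

Lemma mehler_cvg rho k m x y : `|rho| < 1 -> Sq q x -> Sq q y ->
  series (mehler_term rho k m x y) @ \oo --> mehler rho k m x y.
Proof.
move=> r1 Sx Sy; have [C [t [ht hC]]] := mehler_dominated k m r1.
by apply: geo_series_cvg ht _ => n; exact: hC.
Qed.

Lemma mehler_partial_bounded rho k m : `|rho| < 1 ->
  exists2 C, 0 <= C & forall N x y, Sq q x -> Sq q y ->
    `|series (mehler_term rho k m x y) N| <= C.
Proof.
move=> r1; have [C [t [ht hC]]] := mehler_dominated k m r1.
exists (`|C| / (1 - t)).
  by case/andP: ht => _ t1; rewrite divr_ge0// subr_ge0 ltW.
move=> N x y Sx Sy; apply: (@geo_partial_sum_le _ _ t) => // n.
apply: le_trans (hC _ _ _ Sx Sy) _.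
by case/andP: ht => t0 _; rewrite ler_wpM2r ?exprn_ge0 ?ler_norm.
Qed.

Lemma mehlerC rho k m x y : mehler rho k m x y = mehler rho m k y x.
Proof.
by rewrite /mehler; congr (limn (series _)); apply/funext => j;
  rewrite /mehler_term [X in _ * X = _]mulrC.
Qed.

(** The recurrence of H_(j+k), with [j + k] = [k] + q^k [j]; the factor [j]
    cancels one factor of [j]! and shifts the series by one. *)
Lemma mehler_shift rho k m x y : `|rho| < 1 -> Sq q x -> Sq q y ->
  mehler rho k.+1 m x y =
  x * mehler rho k m x y - qnum q k * mehler rho k.-1 m x y
    - q ^+ k * rho * mehler rho k m.+1 x y.
Proof.
move=> r1 Sx Sy; apply: cvg_lim => //.
have -> : mehler_term rho k.+1 m x y = fun j =>
    x * mehler_term rho k m x y j + (- qnum q k) * mehler_term rho k.-1 m x y j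
    + (- (q ^+ k * rho)) * delay (mehler_term rho k m.+1 x y) j.
  apply/funext => j; rewrite /mehler_term/= addnS hermiteS addnC qnumD.
  have e : qnum q k * H (j + k.-1) x = qnum q k * H (k + j).-1 x.
    case: k => [|k]; first by rewrite qnumr0 !mul0r.
    by rewrite addSn/= addnC.
  rewrite [- qnum q k * _](_ : _ = - (rho ^+ j / qfact q j *
      (qnum q k * H (k + j).-1 x) * H (j + m) y)); last by rewrite -e; ring.
  case: j {e} => [|j]; first by rewrite qnumr0 addn0/=; ring.
  rewrite /= qfactS addnS /= exprS addSnnS [(j + k)%N]addnC.
  by field; rewrite qfact_neq0// qnumS_neq0.
rewrite -!mulNr.
by do 2?[apply: series_cvgD]; apply: series_cvgZ;
  try apply: series_cvg_delay; exact: mehler_cvg.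
Qed.

(** The product (rho^2)_oo / prod_i omega(x, y | rho q^i) satisfies this
    equation by inspection.  For the series, comparing coefficients of rho^n
    leaves an identity between five consecutive products H_j(x) H_j(y), which
    follows from the recurrence by expressing them through two consecutive
    H_j. *)
Lemma mehler_qdiff rho x y : `|rho| < 1 -> Sq q x -> Sq q y ->
  omegaq q x y rho * mehler rho 0 0 x y =
  (1 - rho ^+ 2) * (1 - q * rho ^+ 2) * mehler (rho * q) 0 0 x y.
Proof.
move=> r1 Sx Sy.
have rq1 : `|rho * q| < 1.
  rewrite normrM; apply: le_lt_trans r1; rewrite ler_piMr//.
  exact/ltW/normq_lt1.
have G := @mehler_cvg rho 0 0 x y r1 Sx Sy.
have Gq := @mehler_cvg (rho * q) 0 0 x y rq1 Sx Sy.
set u := mehler_term rho 0 0 x y in G.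
set v := mehler_term (rho * q) 0 0 x y in Gq.
pose a := (1 - q) * x * y; pose b := (1 - q) * (x ^+ 2 + y ^+ 2) - 2.
have dl := fun w (l : R) => @series_cvg_delay R w l.
have zl := fun w k (l : R) => @series_cvgZ R w k l.
have L := series_cvgD (series_cvgD (series_cvgD (series_cvgD G
  (zl _ (- (a * rho)) _ (dl _ _ G)))
  (zl _ (b * rho ^+ 2) _ (dl _ _ (dl _ _ G))))
  (zl _ (- (a * rho ^+ 3)) _ (dl _ _ (dl _ _ (dl _ _ G)))))
  (zl _ (rho ^+ 4) _ (dl _ _ (dl _ _ (dl _ _ (dl _ _ G))))).
have L' := series_cvgD (series_cvgD Gq
  (zl _ (- ((1 + q) * rho ^+ 2)) _ (dl _ _ (dl _ _ Gq))))
  (zl _ (q * rho ^+ 4) _ (dl _ _ (dl _ _ (dl _ _ (dl _ _ Gq))))).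
have -> : omegaq q x y rho * mehler rho 0 0 x y =
  mehler rho 0 0 x y + - (a * rho) * mehler rho 0 0 x y
  + b * rho ^+ 2 * mehler rho 0 0 x y + - (a * rho ^+ 3) * mehler rho 0 0 x y
  + rho ^+ 4 * mehler rho 0 0 x y by rewrite /omegaq /a /b; ring.
have -> : (1 - rho ^+ 2) * (1 - q * rho ^+ 2) * mehler (rho * q) 0 0 x y =
  mehler (rho * q) 0 0 x y
  + - ((1 + q) * rho ^+ 2) * mehler (rho * q) 0 0 x y
  + q * rho ^+ 4 * mehler (rho * q) 0 0 x y by ring.
set lw := (X in X = _); set lv := (X in _ = X).
suff E : (fun n => u n + - (a * rho) * delay u n
    + b * rho ^+ 2 * delay (delay u) n + - (a * rho ^+ 3) * delay (delay (delay u)) n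
    + rho ^+ 4 * delay (delay (delay (delay u))) n) =
  (fun n => v n + - ((1 + q) * rho ^+ 2) * delay (delay v) n
    + q * rho ^+ 4 * delay (delay (delay (delay v))) n).
  have {}L : series (fun n => u n + - (a * rho) * delay u n
    + b * rho ^+ 2 * delay (delay u) n + - (a * rho ^+ 3) * delay (delay (delay u)) n
    + rho ^+ 4 * delay (delay (delay (delay u))) n) @ \oo --> lw := L.
  by rewrite E in L; exact: (cvg_unique _ L L').
apply/funext => n.
have q0 : 1 - q != 0 by rewrite lt0r_neq0// onemq_gt0.
have nz j : 1 - q ^+ j.+1 != 0 by rewrite lt0r_neq0// onem_exprS_gt0.
have qn j : qnum q j = (1 - q ^+ j) / (1 - q).
  by rewrite -qnum_closed mulrAC divff// mul1r.
rewrite /u /v /a /b.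
case: n => [|[|[|[|n]]]]; rewrite /mehler_term /delay ?addn0.
- by rewrite !hermite0 qfact0; field.
- rewrite !hermite1 !hermite0 qfactS qfact0 qn; have := nz 0%N.
  by rewrite !expr1 => n1; field; rewrite q0.
- rewrite !hermiteS/= !hermite0 !qfactS qfact0 !qn ?expr0.
  have := nz 1%N => n2.
  by rewrite expr1; field; rewrite q0 n2.
- rewrite !hermiteS/= !hermite0 !qfactS qfact0 !qn ?expr0.
  have := nz 1%N => n2; have := nz 2%N => n3.
  by rewrite expr1; field; rewrite q0 n2 n3.
have n1 := nz n; have n2 := nz n.+1; have n3 := nz n.+2; have n4 := nz n.+3.
have f0 := qfact_neq0 hq n.
rewrite !(hermiteS q n.+3) !(hermiteS q n.+2) !(hermiteS q n.+1) /=.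
rewrite !qfactS !qn !exprMn !exprS in n1 n2 n3 n4 *.
move: (H n x) (H n y) (H n.+1 x) (H n.+1 y) (qfact q n) f0 => A A' B B' f f0.
set Q := q ^+ n in n1 n2 n3 n4 *; set P := rho ^+ n.
by field; rewrite q0 n1 n2 n3 n4 f0.
Qed.

(** As a polynomial in x, omega has discriminant proportional to
    (1 - q) y^2 - 4, which is nonpositive on S(q). *)
Lemma omegaq_ge0 rho x y : Sq q x -> Sq q y -> 0 <= omegaq q x y rho.
Proof.
move=> Sx Sy.
have -> : omegaq q x y rho =
  (1 - q) * (rho * x - (1 + rho ^+ 2) * y / 2) ^+ 2 +
  (1 - rho ^+ 2) ^+ 2 * (4 - (1 - q) * y ^+ 2) / 4.
  by rewrite /omegaq; field.
apply: addr_ge0; first by rewrite mulr_ge0 ?sqr_ge0// ltW// onemq_gt0.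
by rewrite divr_ge0// mulr_ge0 ?sqr_ge0// subr_ge0 Sq_scaled_sqr.
Qed.

Lemma mehler_at0 rho x y : `|rho| < 1 -> Sq q x -> Sq q y ->
  (fun N => mehler (rho * q ^+ N) 0 0 x y) @ \oo --> (1 : R).
Proof.
move=> r1 Sx Sy; have [C [t [ht hC]]] := mehler_dominated 0 0 r1.
have ht0 : 0 <= t by case/andP: ht.
have C0 : 0 <= C by apply: (@geo_dominated_ge0 _ C t) => n; exact: (hC n x y).
have bnd N : `|mehler (rho * q ^+ N) 0 0 x y - 1| <= C / (1 - t) * `|q| ^+ N.
  set r := rho * q ^+ N.
  have qN1 : `|q| ^+ N <= 1 by rewrite exprn_ile1// ltW// normq_lt1.
  have rN : `|r| < 1.
    by rewrite normrM normrX; apply: le_lt_trans r1; rewrite ler_piMr.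
  have cv := @mehler_cvg r 0 0 x y rN Sx Sy.
  have cv1 : (fun n => series (mehler_term r 0 0 x y) n.+1 - 1) @ \oo
             --> mehler r 0 0 x y - 1.
    by apply: cvgB; [rewrite (cvg_shiftS (series _))|exact: cvg_cst].
  have cvn : (fun n => `|series (mehler_term r 0 0 x y) n.+1 - 1|) @ \oo
      --> `|mehler r 0 0 x y - 1| by exact: cvg_norm.
  apply: (cvgr_to_le cvn); apply: nearW => n /=.
  rewrite /series/= big_nat_recl//= {1}/mehler_term.
  rewrite expr0 qfact0 !hermite0 !mulr1 divr1 addrC addKr.
  rewrite mulrC mulrA.
  apply: (@geo_partial_sum_le _ _ t (fun i => mehler_term r 0 0 x y i.+1)) => // j.
  rewrite /mehler_term /r exprMn.
  have -> : rho ^+ j.+1 * (q ^+ N) ^+ j.+1 / qfact q j.+1 *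
      (H (j.+1 + 0) x * H (j.+1 + 0) y) =
      (q ^+ N) ^+ j.+1 * mehler_term rho 0 0 x y j.+1.
    by rewrite /mehler_term; field; rewrite qfact_neq0.
  rewrite normrM normrX normrX -mulrA.
  apply: ler_pM => //; rewrite ?exprn_ge0//.
    by rewrite exprS ler_piMr ?exprn_ge0// exprn_ile1// exprn_ge0.
  apply: le_trans (hC _ _ _ Sx Sy) _; rewrite ler_wpM2l// exprS.
  by rewrite ler_piMl ?exprn_ge0//; case/andP: ht => _ /ltW.
have cq : (fun N => C / (1 - t) * `|q| ^+ N) @ \oo --> (0 : R).
  by apply: cvg_geometric; rewrite normr_id normq_lt1.
apply/cvgrPdist_le => e e0.
have /cvgrPdist_le/(_ e e0) := cq.
apply: filterS => N; rewrite sub0r normrN => hN.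
rewrite distrC; apply: le_trans (bnd N) _.
exact: le_trans (ler_norm _) hN.
Qed.

(** Iterating [mehler_qdiff] N times and letting rho q^N tend to 0 multiplies
    the kernel by the partial products of omega and gives (rho^2)_oo in the
    limit.  As (rho^2)_oo > 0, the kernel cannot vanish; hence the infinite
    product converges and is positive without a separate lower bound on
    omega. *)
Lemma mehler_product_cvg rho x y : `|rho| < 1 -> Sq q x -> Sq q y ->
  0 < mehler rho 0 0 x y /\
  (fun N => \prod_(0 <= i < N) omegaq q x y (rho * q ^+ i)) @ \oo -->
    qpoch_inf (rho ^+ 2) q / mehler rho 0 0 x y.
Proof.
move=> r1 Sx Sy.
have r2 : `|rho ^+ 2| < 1 by rewrite normrX exprn_ilt1.
have rN N : `|rho * q ^+ N| < 1.
  rewrite normrM normrX; apply: le_lt_trans r1; rewrite ler_piMr// exprn_ile1//.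
  exact/ltW/normq_lt1.
have iter N : (\prod_(0 <= i < N) omegaq q x y (rho * q ^+ i)) *
    mehler rho 0 0 x y =
  (\prod_(0 <= k < N.*2) (1 - rho ^+ 2 * q ^+ k)) *
    mehler (rho * q ^+ N) 0 0 x y.
  elim: N => [|N IH]; first by rewrite !big_geq// expr0 mulr1.
  rewrite doubleS !big_nat_recr//= mulrAC IH.
  have := mehler_qdiff (rN N) Sx Sy.
  rewrite (_ : rho * q ^+ N * q = rho * q ^+ N.+1); last by rewrite exprSr mulrA.
  rewrite exprMn -exprM muln2 => e.
  by rewrite [LHS]mulrAC -[LHS]mulrA e (exprS q N.*2); ring.
have dbl : (fun N => \prod_(0 <= k < N.*2) (1 - rho ^+ 2 * q ^+ k)) @ \oo -->
    qpoch_inf (rho ^+ 2) q.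
  apply: (cvg_comp _ _ _ (@qpoch_partial_cvg _ _ hq (rho ^+ 2))).
  apply/cvgnyPge => A; near=> n.
  rewrite -addnn; apply: leq_trans (leq_addr _ _).
  by near: n; exact: nbhs_infty_ge.
have lim1 : (fun N => (\prod_(0 <= i < N) omegaq q x y (rho * q ^+ i)) *
    mehler rho 0 0 x y) @ \oo --> qpoch_inf (rho ^+ 2) q.
  under eq_fun do rewrite iter.
  have -> : qpoch_inf (rho ^+ 2) q = qpoch_inf (rho ^+ 2) q * 1 by rewrite mulr1.
  by apply: cvgM => //; exact: mehler_at0.
have pos := qpoch_inf_gt0 hq r2.
have m0 : mehler rho 0 0 x y != 0.
  apply/eqP => m0; move: lim1; rewrite m0; under eq_fun do rewrite mulr0.
  move=> c0; move: pos; rewrite -(cvg_lim _ c0)//.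
  by rewrite lim_cst// ltxx.
have lim2 : (fun N => \prod_(0 <= i < N) omegaq q x y (rho * q ^+ i)) @ \oo -->
    qpoch_inf (rho ^+ 2) q / mehler rho 0 0 x y.
  have : (fun N => (\prod_(0 <= i < N) omegaq q x y (rho * q ^+ i)) *
    mehler rho 0 0 x y / mehler rho 0 0 x y) @ \oo -->
    qpoch_inf (rho ^+ 2) q / mehler rho 0 0 x y.
    by apply: cvgM; [exact: lim1|apply: cvg_cst].
  by under eq_fun => N do rewrite (mulfK m0).
split=> //.
have : 0 <= qpoch_inf (rho ^+ 2) q / mehler rho 0 0 x y.
  apply: cvgr_to_ge lim2 _; apply: nearW => N.
  by apply: prodr_ge0 => i _; exact: omegaq_ge0.
by rewrite pmulr_rge0// invr_ge0 lt0r m0.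
Unshelve. all: by end_near.
Qed.

End MehlerKernel.

(** * Diagonal kernels and Rogers polynomials *)

Section Carlitz.
Variables (R : realType) (q : R).
Hypothesis hq : -1 < q < 1.
Local Notation H n x := (qHermite q n).[x].
Implicit Types r z : R.

(** Shifting the first index of the pair (0, m) relates (1, m) to (0, m + 1), and
    so does shifting the second index, because on the diagonal the kernels are
    symmetric in the two indices.  Eliminating (1, m) leaves a recurrence in m
    alone. *)
Lemma mehler_diag_rec r z m : `|r| < 1 -> Sq q z ->
  (1 - r ^+ 2 * q ^+ m) * mehler q r 0 m.+1 z z =
  z * (1 - r * q ^+ m) * mehler q r 0 m z z - qnum q m * mehler q r 0 m.-1 z z.
Proof.
move=> r1 Sz.
have e1 := @mehler_shift _ _ hq r 0 m z z r1 Sz Sz.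
have e2 := @mehler_shift _ _ hq r m 0 z z r1 Sz Sz.
rewrite qnumr0 expr0 mul0r subr0 mul1r in e1.
rewrite ![mehler q r _ 0 z z]mehlerC [mehler q r m 1 z z]mehlerC e1 in e2.
rewrite mulrBl mul1r {1}e2; ring.
Qed.

Lemma RogersSS r z m : (Rogers r q m.+2).[z] = z * (Rogers r q m.+1).[z] -
  qnum q m.+1 * ((1 - r ^+ 2 * q ^+ m) /
    ((1 - r * q ^+ m) * (1 - r * q ^+ m.+1))) * (Rogers r q m).[z].
Proof. by rewrite /Rogers monic_recSS hornerD hornerN hornerM hornerX hornerZ. Qed.

Lemma mehler_Rogers r z m : `|r| < 1 -> Sq q z ->
  mehler q r 0 m z z =
  mehler q r 0 0 z z * (qpoch r q m / qpoch (r ^+ 2) q m * (Rogers r q m).[z]).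
Proof.
move=> r1 Sz.
have r2 : `|r ^+ 2| < 1 by rewrite normrX exprn_ilt1.
have p1 n := lt0r_neq0 (onem_mul_expr_gt0 hq n r1).
have p2 n := lt0r_neq0 (onem_mul_expr_gt0 hq n r2).
have P1 n := lt0r_neq0 (qpoch_gt0 hq n r1).
have P2 n := lt0r_neq0 (qpoch_gt0 hq n r2).
suff [] : (fun m => mehler q r 0 m z z = mehler q r 0 0 z z *
    (qpoch r q m / qpoch (r ^+ 2) q m * (Rogers r q m).[z])) m /\
  (fun m => mehler q r 0 m z z = mehler q r 0 0 z z *
    (qpoch r q m / qpoch (r ^+ 2) q m * (Rogers r q m).[z])) m.+1 by [].
elim: m => [|m [IH IH1]].
  have e := @mehler_diag_rec r z 0 r1 Sz.
  have n0 := p2 0%N; rewrite expr0 mulr1 in n0.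
  rewrite /Rogers monic_rec0 monic_rec1 hornerX -polyC1 hornerC.
  rewrite !qpochS !qpoch0 !expr0; split; first by field.
  rewrite qnumr0 expr0 !mulr1 mul0r subr0 in e.
  apply: (mulfI n0); rewrite e; field; exact: n0.
split=> //.
have e := @mehler_diag_rec r z m.+1 r1 Sz.
apply: (mulfI (p2 m.+1)); rewrite e IH IH1 RogersSS !qpochS.
have := p1 m; have := p1 m.+1; have := p2 m; have := p2 m.+1.
rewrite /= => n1 n2 n3 n4.
by field; rewrite n1 n2 n3 n4 P2.
Qed.

(** Both sides satisfy the recurrence in k of [mehler_shift]; for the sum this
    uses only the Pascal rule, whatever the sequence in place of the
    kernels with first index 0. *)
Lemma carlitz_expansion r z k m : `|r| < 1 -> Sq q z ->
  mehler q r k m z z = \sum_(s < k.+1) qbinom q k s * q ^+ 'C(s, 2) *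
    (- r) ^+ s * H (k - s) z * mehler q r 0 (m + s) z z.
Proof.
move=> r1 Sz; pose Wf k m := \sum_(s < k.+1) qbinom q k s * q ^+ 'C(s, 2) *
    (- r) ^+ s * H (k - s) z * mehler q r 0 (m + s) z z.
have W0 n : Wf 0%N n = mehler q r 0 n z z.
  by rewrite /Wf big_ord1/= qbinom0// hermite0 addn0 bin0n !expr0 !mul1r.
have WS j n : Wf j.+1 n = z * Wf j n - qnum q j * Wf j.-1 n
    - q ^+ j * r * Wf j n.+1.
  have E1 : qnum q j * Wf j.-1 n = \sum_(s < j.+1) qbinom q j s *
      qnum q (j - s) * q ^+ 'C(s, 2) * (- r) ^+ s * H (j - s).-1 z *
      mehler q r 0 (n + s) z z.
    case: j => [|j]; first by rewrite big_ord1 qnumr0 mulr0 !mul0r.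
    rewrite [RHS]big_ord_recr/= subnn qnumr0 mulr0 !mul0r addr0 big_distrr/=.
    apply: eq_bigr => s _; rewrite qbinom_absorb// !mulrA.
    by rewrite (_ : (j.+1 - s).-1 = j - s)%N//; have := ltn_ord s; lia.
  have E2 : z * Wf j n - qnum q j * Wf j.-1 n =
      \sum_(s < j.+1) qbinom q j s * q ^+ 'C(s, 2) * (- r) ^+ s *
        H (j.+1 - s) z * mehler q r 0 (n + s) z z.
    rewrite E1 big_distrr/= -sumrB; apply: eq_bigr => s _.
    rewrite subSn; last by rewrite -ltnS.
    by rewrite hermiteS; ring.
  rewrite E2 /Wf [LHS]big_ord_recl.
  rewrite [X in _ + X = _](eq_bigr (fun s : 'I_j.+1 =>
    qbinom q j s.+1 * q ^+ 'C(s.+1, 2) * (- r) ^+ s.+1 * H (j.+1 - s.+1) z *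
      mehler q r 0 (n + s.+1) z z +
    q ^+ j * - r * (qbinom q j s * q ^+ 'C(s, 2) * (- r) ^+ s * H (j - s) z *
      mehler q r 0 (n.+1 + s) z z))); last first.
    move=> s _; rewrite /= /bump/= add1n qbinom_pascal// subSS addSnnS.
    rewrite binS bin1 exprD.
    have -> : q ^+ j = q ^+ (j - s) * q ^+ s.
      by rewrite -exprD subnK// -ltnS.
    by rewrite exprS; ring.
  rewrite big_split/= -big_distrr/= mulrN mulNr addrA; congr (_ - _).
  rewrite (_ : qbinom q j.+1 0 = qbinom q j 0); last by rewrite !qbinom0.
  rewrite -(big_ord_recl j.+1 (fun s => qbinom q j s * q ^+ 'C(s, 2) *
    (- r) ^+ s * H (j.+1 - s) z * mehler q r 0 (n + s) z z)).
  by rewrite [LHS]big_ord_recr/= (@qbinom_small _ _ j j.+1)// !mul0r addr0.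
suff [] : (forall n, mehler q r k n z z = Wf k n) /\
  (forall n, mehler q r k.-1 n z z = Wf k.-1 n) by [].
elim: k => [|k [IH IH1]]; first by split=> n; rewrite W0.
by split=> // n; rewrite mehler_shift// WS !IH IH1.
Qed.

Lemma mehler_Wpoly r z k m : `|r| < 1 -> Sq q z ->
  mehler q r k m z z = mehler q r 0 0 z z * (Wpoly r q k m).[z].
Proof.
move=> r1 Sz; rewrite carlitz_expansion// /Wpoly horner_sum big_distrr/=.
by apply: eq_bigr => s _; rewrite mehler_Rogers// hornerZ hornerM; ring.
Qed.

Lemma size_Wpoly r k m : (size (Wpoly r q k m) <= (k + m).+1)%N.
Proof.
clear hq; apply: leq_trans (size_sum _ _ _) _; apply/bigmax_leqP => s _.
apply: leq_trans (size_scale_leq _ _) _.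
apply: leq_trans (size_polyMleq _ _) _.
rewrite /qHermite /Rogers !(proj2 (monic_rec_size_monic _ _)).
by have := ltn_ord s; lia.
Qed.

End Carlitz.

(** * The semicircle density and Chebyshev polynomials *)

Section Semicircle.
Variables (R : realType) (q : R).
Hypothesis hq : -1 < q < 1.
Local Notation s := (Num.sqrt (1 - q)).
Local Notation mu := (@lebesgue_measure R).

Definition semicircle (x : R) : R := Num.sqrt (4 - (1 - q) * x ^+ 2).

Lemma measurable_Sq : measurable (Sq q : set R).
Proof. exact: measurable_itv. Qed.

Lemma compact_Sq : compact (Sq q : set R).
Proof. exact: segment_compact. Qed.

Lemma Sq_finite_measure : (mu (Sq q) < +oo)%E.
Proof. by apply: compact_finite_measure; exact: compact_Sq. Qed.

Lemma continuous_semicircle : continuous semicircle.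
Proof.
rewrite (_ : semicircle = Num.sqrt \o (fun x => 4 - (1 - q) * x ^+ 2))//.
move=> x; apply: continuous_comp; last exact: sqrt_continuous.
apply: cvgB; first exact: cvg_cst.
by apply: cvgM; [exact: cvg_cst|exact: exprn_continuous].
Qed.

Lemma semicircle_bounded x : Sq q x -> `|semicircle x| <= 2.
Proof.
move=> Sx; rewrite ger0_norm ?sqrtr_ge0//.
have -> : 2 = Num.sqrt 4 :> R.
  by rewrite (_ : 4 = 2 ^+ 2 :> R) ?sqrtr_sqr ?ger0_norm//; ring.
rewrite ler_wsqrtr// lerBlDr lerDl mulr_ge0 ?sqr_ge0//.
exact/ltW/onemq_gt0.
Qed.

Definition semicircle_moment (p : {poly R}) : R :=
  \int[mu]_(x in Sq q) (semicircle x * p.[x]).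

Lemma semicircle_integrable (p : {poly R}) :
  mu.-integrable (Sq q) (EFin \o (fun x => semicircle x * p.[x])).
Proof.
apply: continuous_compact_integrable; first exact: compact_Sq.
apply: continuous_subspaceT => x.
by apply: cvgM; [exact: continuous_semicircle|exact: continuous_horner].
Qed.

Lemma semicircle_momentD p r :
  semicircle_moment (p + r) = semicircle_moment p + semicircle_moment r.
Proof.
rewrite /semicircle_moment -RintegralD; last 3 first.
- exact: measurable_Sq.
- exact: semicircle_integrable.
- exact: semicircle_integrable.
by apply: eq_Rintegral => x _; rewrite hornerD mulrDr.
Qed.

Lemma semicircle_momentZ a p :
  semicircle_moment (a *: p) = a * semicircle_moment p.
Proof.
rewrite /semicircle_moment -RintegralZl; last 2 first.
- exact: measurable_Sq.
- exact: semicircle_integrable.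
by apply: eq_Rintegral => x _; rewrite hornerZ mulrCA.
Qed.

(** The monic Chebyshev polynomials of the second kind in s x, where x runs
    over S(q): U_n(s x / 2) in the usual notation. *)
Definition cheb (n : nat) : {poly R} :=
  (monic_rec (fun=> 1) n).2 \Po (s *: 'X).

(** cheb (n - 1), with U_(-1) = 0 so that the recurrence starts at n = 0. *)
Definition cheb_prev (n : nat) : {poly R} := if n is n'.+1 then cheb n' else 0.

Lemma cheb0 : cheb 0 = 1.
Proof. by rewrite /cheb monic_rec0 -polyC1 comp_polyC. Qed.

Lemma cheb1 : cheb 1 = s *: 'X.
Proof. by rewrite /cheb monic_rec1 comp_polyX. Qed.

Lemma cheb_rec n : (s *: 'X) * cheb n = cheb n.+1 + cheb_prev n.
Proof.
case: n => [|n]; first by rewrite cheb0 cheb1 mulr1 addr0.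
rewrite /= /cheb monic_recSS scale1r comp_polyB comp_polyM comp_polyX.
by rewrite subrK.
Qed.

Lemma chebSS n : cheb n.+2 = (s *: 'X) * cheb n.+1 - cheb n.
Proof. by rewrite cheb_rec addrK. Qed.

(** With s x = 2 cos th, U_n = sin((n + 1) th) / sin th, and this is the formula
    for the derivative of sin((n + 1) th), where
    2 cos((n + 1) th) = U_(n+1) - U_(n-1). *)
Lemma cheb_deriv n (x : R) :
  (4 - (1 - q) * x ^+ 2) * (cheb n)^`().[x] - (1 - q) * x * (cheb n).[x] =
  - (s * n.+1%:R * ((cheb n.+1).[x] - (cheb_prev n).[x])).
Proof.
have s2 := sqr_sqrt_onemq hq.
suff [] : (fun n => (4 - (1 - q) * x ^+ 2) * (cheb n)^`().[x] -
    (1 - q) * x * (cheb n).[x] =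
    - (s * n.+1%:R * ((cheb n.+1).[x] - (cheb_prev n).[x]))) n /\
  (fun n => (4 - (1 - q) * x ^+ 2) * (cheb n)^`().[x] -
    (1 - q) * x * (cheb n).[x] =
    - (s * n.+1%:R * ((cheb n.+1).[x] - (cheb_prev n).[x]))) n.+1 by [].
have hrec k : s * x * (cheb k).[x] = (cheb k.+1).[x] + (cheb_prev k).[x].
  by rewrite -hornerD -cheb_rec hornerM hornerZ hornerX.
have hSS k : (cheb k.+2).[x] = s * x * (cheb k.+1).[x] - (cheb k).[x].
  by rewrite chebSS hornerD hornerN hornerM hornerZ hornerX.
have hder k : (cheb k.+2)^`().[x] =
    s * (cheb k.+1).[x] + s * x * (cheb k.+1)^`().[x] - (cheb k)^`().[x].
  rewrite chebSS derivB derivM derivZ derivX hornerD hornerN hornerD !hornerM.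
  by rewrite !hornerZ (hornerC 1) (hornerX x) mulr1.
elim: n => [|n [IH1 IH2]].
  rewrite /= cheb0 cheb1 hSS cheb0 cheb1 horner0.
  have h1 : (1 : {poly R}).[x] = 1 by rewrite -polyC1 hornerC.
  have d1 : (1 : {poly R})^`() = 0 by rewrite -polyC1 derivC.
  rewrite d1 horner0 derivZ derivX !hornerZ hornerX h1.
  move: s2; set t := s => <-.
  by split; ring.
split=> //.
have e1 := hrec n.+2; have e2 := hrec n.+1; have e3 := hrec n.
have e4 := hSS n.
rewrite hder (hSS n) /= in e1 e2 IH2 *.
move: IH1 IH2; set t := s in s2 e1 e2 e3 e4 *; rewrite -s2.
set a := (cheb n).[x] in e1 e3 *; set b := (cheb n.+1).[x] in e1 e3 *.
set p := (cheb_prev n).[x] in e3 *; set a' := (cheb n)^`().[x].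
set b' := (cheb n.+1)^`().[x] => IH1 IH2.
have -> : (4 - t ^+ 2 * x ^+ 2) * (t * b + t * x * b' - a') -
  t ^+ 2 * x * (t * x * b - a) = (4 - t ^+ 2 * x ^+ 2) * t * b +
   t * x * ((4 - t ^+ 2 * x ^+ 2) * b' - t ^+ 2 * x * b) -
   ((4 - t ^+ 2 * x ^+ 2) * a' - t ^+ 2 * x * a) by ring.
rewrite IH1 IH2.
rewrite -[n.+3%:R]natr1 -[n.+2%:R]natr1.
have -> : p = t * x * a - b by rewrite e3; ring.
have -> : (cheb n.+3).[x] = t * x * (t * x * b - a) - b.
  by rewrite e1; ring.
ring.
Qed.

Lemma Sq_endpoint_semicircle : semicircle (2 / s) = 0.
Proof.
have := sqr_sqrt_onemq hq; have := sqrt_onemq_gt0 hq.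
rewrite /semicircle; set t := s => /lt0r_neq0 t0 <-.
by rewrite (_ : 4 - _ = 0) ?sqrtr0//; field.
Qed.

(** In the variable th the integrand is sin th sin((n + 2) th), with primitive
    a combination of sin((n + 1) th) and sin((n + 3) th).  This is where the
    polynomial Q comes from: the primitive is sqrt(4 - (1 - q) x^2) Q(x), which
    vanishes at both ends of S(q). *)
Lemma semicircle_cheb n : semicircle_moment (cheb n.+1) = 0.
Proof.
have s0 := sqrt_onemq_gt0 hq; have s2 := sqr_sqrt_onemq hq.
pose Q : {poly R} := (s^-1 / n.+3%:R) *: cheb n.+2 + (- s^-1 / n.+1%:R) *: cheb n.
pose F x := semicircle x * Q.[x].
have contF : continuous F.
  by move=> x; apply: cvgM; [exact: continuous_semicircle|exact: continuous_horner].
have ab : - (2 / s) < 2 / s by rewrite gtrN// divr_gt0.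
have ode x : (4 - (1 - q) * x ^+ 2) * Q^`().[x] - (1 - q) * x * Q.[x] =
    (4 - (1 - q) * x ^+ 2) * (cheb n.+1).[x].
  have d1 := cheb_deriv n x; have d2 := cheb_deriv n.+2 x.
  rewrite /Q derivD !derivZ !hornerD !hornerZ.
  have n1 : n.+1%:R != 0 :> R by rewrite pnatr_eq0.
  have n3 : n.+3%:R != 0 :> R by rewrite pnatr_eq0.
  have hrec k : s * x * (cheb k).[x] = (cheb k.+1).[x] + (cheb_prev k).[x].
    by rewrite -hornerD -cheb_rec hornerM hornerZ hornerX.
  have e2 := hrec n.+2; have e1 := hrec n.+1; have e0 := hrec n.
  rewrite /= in e0 e1 e2 d2.
  set L := (X in X = _).
  have -> : L = s^-1 / n.+3%:R * ((4 - (1 - q) * x ^+ 2) * (cheb n.+2)^`().[x]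
      - (1 - q) * x * (cheb n.+2).[x])
    + - s^-1 / n.+1%:R * ((4 - (1 - q) * x ^+ 2) * (cheb n)^`().[x]
      - (1 - q) * x * (cheb n).[x]) by rewrite /L; ring.
  rewrite d1 d2; move: s2 s0 e0 e1 e2.
  set t := s => <- /lt0r_neq0 t0 e0 e1 e2.
  have -> : (cheb_prev n).[x] = t * x * (cheb n).[x] - (cheb n.+1).[x].
    by rewrite e0; ring.
  have -> : (cheb n.+3).[x] = t * x * (cheb n.+2).[x] - (cheb n.+1).[x].
    by rewrite e2; ring.
  have -> : (cheb n.+2).[x] = t * x * (cheb n.+1).[x] - (cheb n).[x].
    by rewrite e1; ring.
  move: n1 n3; move: (n.+1%:R : R) (n.+3%:R : R) => N1 N3 n1 n3.
  by field; rewrite t0 n1 n3.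
have dF x : x \in `]- (2 / s), 2 / s[ ->
    is_derive x (1 : R) F (semicircle x * (cheb n.+1).[x]).
  rewrite in_itv/= => /andP[x1 x2].
  have pos : 0 < 4 - (1 - q) * x ^+ 2.
    rewrite subr_gt0 -s2 -exprMn -[ltLHS]real_normK ?num_real//.
    have : `|s * x| < 2.
      rewrite normrM gtr0_norm// mulrC -ltr_pdivlMr//.
      by rewrite ltr_norml x1 x2.
    by have := normr_ge0 (s * x); set y := `|s * x|; nra.
  have dw : is_derive x (1 : R) semicircle
      (- ((1 - q) * x) / semicircle x).
    rewrite (_ : semicircle = Num.sqrt \o (fun x => 4 - (1 - q) * x ^+ 2))//.
    have dsq := is_derive1_sqrt pos.
    have din : is_derive x (1 : R) (fun x : R => 4 - (1 - q) * x ^+ 2)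
        (- ((1 - q) * (2 * x))).
      by apply: is_derive_eq; rewrite /GRing.scale/=; ring.
    have dc := @is_derive1_comp _ Num.sqrt (fun x => 4 - (1 - q) * x ^+ 2) x _ _
      dsq din.
    apply: (is_derive_eq dc).
    have w0 : Num.sqrt (4 - (1 - q) * x ^+ 2) != 0 by rewrite gt_eqF// sqrtr_gt0.
    by rewrite /=; field.
  have w0 : semicircle x != 0 by rewrite gt_eqF// sqrtr_gt0.
  have w2 : semicircle x ^+ 2 = 4 - (1 - q) * x ^+ 2 by rewrite sqr_sqrtr// ltW.
  apply: (is_derive_eq (is_deriveM dw (is_derive_poly Q x))).
  rewrite /GRing.scale/=; apply: (mulfI w0).
  rewrite [RHS]mulrA -[semicircle x * semicircle x]expr2 w2 -ode -w2.
  by field; exact: w0.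
rewrite /semicircle_moment /Rintegral.
rewrite (@continuous_FTC2 _ _ F)//.
- rewrite /F Sq_endpoint_semicircle.
  have -> : semicircle (- (2 / s)) = 0.
    by rewrite -Sq_endpoint_semicircle /semicircle sqrrN.
  by rewrite !mul0r sube0.
- apply: continuous_subspaceT => x.
  by apply: cvgM; [exact: continuous_semicircle|exact: continuous_horner].
- split.
  + by move=> x xab; have := dF x xab => dFx; exact: ex_derive.
  + by apply: cvg_at_right_filter; exact: contF.
  + by apply: cvg_at_left_filter; exact: contF.
- by move=> x xab; rewrite derive1E; have := dF x xab => dFx; exact: derive_val.
Qed.

End Semicircle.

(** * Bounded convergence on a set of finite measure *)

Section BoundedConvergence.
Context d (T : measurableType d) (R : realType).
Variables (mu : {measure set T -> \bar R}) (D : set T).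
Hypotheses (mD : measurable D) (finD : (mu D < +oo)%E).

Lemma bounded_integrable (f : T -> R) M : measurable_fun D f ->
  (forall x, D x -> `|f x| <= M) -> mu.-integrable D (EFin \o f).
Proof.
move=> mf hM; apply: measurable_bounded_integrable => //.
exists M; split; first exact: num_real.
by move=> N MN x Dx; apply: le_trans (hM x Dx) (ltW MN).
Qed.

Lemma bounded_convergence (f_ : nat -> T -> R) (f : T -> R) M :
  (forall n, measurable_fun D (f_ n)) ->
  (forall x, D x -> f_ ^~ x @ \oo --> f x) ->
  (forall n x, D x -> `|f_ n x| <= M) ->
  (fun n => \int[mu]_(x in D) f_ n x) @ \oo --> \int[mu]_(x in D) f x.
Proof.
move=> mf_ cf hM.
have mf : measurable_fun D f by exact: measurable_fun_cvg mf_ cf.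
have ig : mu.-integrable D (EFin \o (fun=> M)).
  apply: (@bounded_integrable _ `|M|); first exact: measurable_cst.
  by [].
have [|||||intf _ cI] := @dominated_convergence _ _ _ mu D mD
    (fun n => EFin \o f_ n) (EFin \o f) (EFin \o (fun=> M)).
- by move=> n; exact/measurable_EFinP.
- exact/measurable_EFinP.
- by apply: aeW => x Dx /=; apply: cvg_EFin; [exact: nearW|exact: cf].
- exact: ig.
- by apply: aeW => x n Dx /=; rewrite lee_fin; exact: hM.
apply: fine_cvg; rewrite fineK; first exact: cI.
exact: integrable_fin_num.
Qed.

End BoundedConvergence.

(** * The q-Hermite polynomials integrate to 0 against f_N *)

Section HermiteFunctional.
Variables (R : realType) (q : R).
Hypothesis hq : -1 < q < 1.
Local Notation s := (Num.sqrt (1 - q)).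
Local Notation mu := (@lebesgue_measure R).
Local Notation H n x := (qHermite q n).[x].

(** The first N factors of the product in f_N, as a polynomial. *)
Definition weight_poly (N : nat) : {poly R} :=
  \prod_(0 <= i < N) (((1 + q ^+ i.+1) ^+ 2)%:P -
                      q ^+ i.+1 *: ((s *: 'X) * (s *: 'X))).

Lemma weight_polyE N x :
  (weight_poly N).[x] = \prod_(0 <= i < N) lq q x (q ^+ i.+1).
Proof.
rewrite /weight_poly; elim: N => [|N IH].
  by rewrite !big_geq// -polyC1 hornerC.
rewrite !big_nat_recr//= hornerM IH hornerD hornerN !hornerZ hornerM hornerC.
congr (_ * _); rewrite !hornerZ !hornerX /lq.
by have := sqr_sqrt_onemq hq; set t := s => <-; ring.
Qed.

Let lq_pert (x : R) i := 2 * q ^+ i.+1 + (q ^+ i.+1) ^+ 2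
                 - (1 - q) * q ^+ i.+1 * x ^+ 2.

Let lq_pertE x i : lq q x (q ^+ i.+1) = 1 + lq_pert x i.
Proof. by rewrite /lq /lq_pert; ring. Qed.

Let lq_pert_le x i : Sq q x -> `|lq_pert x i| <= 7 * `|q| ^+ i.
Proof.
move=> Sx; rewrite /lq_pert; set Q := q ^+ i.+1.
have q1 := ltW (normq_lt1 hq).
have Qi : `|Q| <= `|q| ^+ i.
  by rewrite normrX exprS ler_piMl ?exprn_ge0.
have Q1 : `|Q| <= 1 by rewrite normrX exprn_ile1.
have -> : 2 * Q + Q ^+ 2 - (1 - q) * Q * x ^+ 2 =
  (2 + Q - (1 - q) * x ^+ 2) * Q by ring.
rewrite normrM; apply: ler_pM => //.
have := Sq_scaled_sqr hq Sx.
have x0 : 0 <= (1 - q) * x ^+ 2 by rewrite mulr_ge0 ?sqr_ge0// ltW// onemq_gt0.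
by move: Q1; rewrite !ler_norml => /andP[Q1 Q2] x4; apply/andP; split; lra.
Qed.

Lemma weight_poly_cvg x : Sq q x ->
  (fun N => (weight_poly N).[x]) @ \oo --> infprod (fun i => lq q x (q ^+ i.+1)).
Proof.
move=> Sx; under eq_fun do rewrite weight_polyE.
suff : cvgn (fun N => \prod_(0 <= i < N) lq q x (q ^+ i.+1)) by [].
rewrite (_ : (fun N => _) = fun N => \prod_(0 <= i < N) (1 + lq_pert x i)).
  apply: geo_prod_cvg (normq_itv hq) _ => i; exact: lq_pert_le.
by apply/funext => N; apply: eq_bigr => i _; exact: lq_pertE.
Qed.

Lemma weight_poly_bounded : exists2 B, 0 < B & forall N x, Sq q x ->
  `|(weight_poly N).[x]| <= B.
Proof.
exists (expR (7 / (1 - `|q|))); first exact: expR_gt0.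
move=> N x Sx; rewrite weight_polyE.
under eq_bigr do rewrite lq_pertE.
by apply: geo_prod_bounded (normq_itv hq) _ => i; exact: lq_pert_le.
Qed.

Lemma lq_ge0 x a : -1 <= a <= 1 -> Sq q x -> 0 <= lq q x a.
Proof.
move=> /andP[a1 a2] Sx; have := Sq_scaled_sqr hq Sx.
have x0 : 0 <= (1 - q) * x ^+ 2 by rewrite mulr_ge0 ?sqr_ge0// ltW// onemq_gt0.
have -> : lq q x a = (1 + a) ^+ 2 - a * ((1 - q) * x ^+ 2) by rewrite /lq; ring.
move: x0; set y := (1 - q) * x ^+ 2 => y0 y4.
have [a0|/ltW a0] := leP 0 a.
  have : a * y <= a * 4 by rewrite ler_wpM2l.
  by have := sqr_ge0 (1 - a); rewrite !expr2; lra.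
have : a * y <= 0 by rewrite mulr_le0_ge0.
by have := sqr_ge0 (1 + a); lra.
Qed.

Let c0 := qpoch_inf q q * s / (2 * pi).

Let c0_gt0 : 0 < c0.
Proof.
rewrite /c0 divr_gt0//; last by rewrite mulr_gt0 ?pi_gt0.
rewrite mulr_gt0 ?sqrt_onemq_gt0//; apply: qpoch_inf_gt0 => //.
exact: normq_lt1.
Qed.

Let fNE x : fN q x =
  c0 * (semicircle q x * infprod (fun i => lq q x (q ^+ i.+1))).
Proof.
rewrite /fN /c0 /semicircle; have := pi_gt0 R.
by move: (pi : R) => p /lt0r_neq0 p0; field.
Qed.

Let fN_cvg x : Sq q x ->
  (fun N => c0 * (semicircle q x * (weight_poly N).[x])) @ \oo --> fN q x.
Proof.
move=> Sx; rewrite fNE.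
apply: cvgM; first exact: cvg_cst.
apply: cvgM; first exact: cvg_cst.
exact: weight_poly_cvg.
Qed.

Let mhorner (p : {poly R}) (D : set R) : measurable_fun D (horner p).
Proof.
apply: measurable_funTS; apply: continuous_measurable_fun.
exact: continuous_horner.
Qed.

Let msemi (D : set R) : measurable_fun D (semicircle q).
Proof.
apply: measurable_funTS; apply: continuous_measurable_fun.
exact: continuous_semicircle.
Qed.

Lemma measurable_fN : measurable_fun (Sq q) (fN q).
Proof.
apply: (@measurable_fun_cvg _ _ _ _
  (fun N x => c0 * (semicircle q x * (weight_poly N).[x]))) => //.
move=> N; apply: measurable_funM; first exact: measurable_cst.
by apply: measurable_funM; [exact: msemi|exact: mhorner].
Qed.

Lemma fN_bounded : exists2 B, 0 < B & forall x, Sq q x -> `|fN q x| <= B.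
Proof.
have [B B0 hB] := weight_poly_bounded; exists (c0 * (2 * B)).
  by rewrite mulr_gt0 ?c0_gt0// mulr_gt0.
move=> x Sx.
have cv : (fun N => `|c0 * (semicircle q x * (weight_poly N).[x])|) @ \oo
    --> `|fN q x| by apply: cvg_norm; exact: fN_cvg.
apply: cvgr_to_le cv _; apply: nearW => N.
rewrite normrM (gtr0_norm c0_gt0) ler_pM2l// normrM.
by apply: ler_pM => //; [exact: semicircle_bounded|exact: hB].
Qed.

Lemma fN_ge0 x : Sq q x -> 0 <= fN q x.
Proof.
move=> Sx; apply: cvgr_to_ge (fN_cvg Sx) _; apply: nearW => N.
rewrite mulr_ge0 ?(ltW c0_gt0)// mulr_ge0 ?sqrtr_ge0// weight_polyE.
apply: prodr_ge0 => i _; apply: lq_ge0 => //.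
rewrite -ler_norml normrX exprn_ile1//; exact/ltW/normq_lt1.
Qed.

Definition fN_int (g : R -> R) : R := \int[mu]_(x in Sq q) (g x * fN q x).

Definition bdd_meas (g : R -> R) : Prop :=
  measurable_fun (Sq q) g /\ exists2 M, 0 <= M & forall x, Sq q x -> `|g x| <= M.

Lemma bdd_meas_horner p : bdd_meas (horner p).
Proof.
split; first exact: mhorner.
have : compact (horner p @` Sq q).
  apply: continuous_compact; last exact: compact_Sq.
  by apply: continuous_subspaceT; exact: continuous_horner.
move=> /compact_bounded[M [_ hM]]; exists (`|M| + 1); first by rewrite addr_ge0.
move=> x Sx; apply: hM; first by rewrite ltr_pwDr// ler_norm.
by exists x.
Qed.

Lemma bdd_measM f g : bdd_meas f -> bdd_meas g -> bdd_meas (fun x => f x * g x).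
Proof.
move=> [mf [M M0 hM]] [mg [N N0 hN]]; split; first exact: measurable_funM.
exists (M * N); first exact: mulr_ge0.
by move=> x Sx; rewrite normrM ler_pM ?hM ?hN.
Qed.

Lemma bdd_meas_integrable g : bdd_meas g ->
  mu.-integrable (Sq q) (EFin \o (fun x => g x * fN q x)).
Proof.
move=> [mg [M M0 hM]]; have [B B0 hB] := fN_bounded.
apply: (@bounded_integrable _ _ _ _ _ _ _ _ (M * B)).
- exact: measurable_Sq.
- exact: Sq_finite_measure.
- by apply: measurable_funM => //; exact: measurable_fN.
- by move=> x Sx; rewrite normrM ler_pM ?hM ?hB.
Qed.

Lemma fN_intD f g : bdd_meas f -> bdd_meas g ->
  fN_int (fun x => f x + g x) = fN_int f + fN_int g.
Proof.
move=> bf bg; rewrite /fN_int -RintegralD; last 3 first.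
- exact: measurable_Sq.
- exact: bdd_meas_integrable.
- exact: bdd_meas_integrable.
by apply: eq_Rintegral => x _; rewrite mulrDl.
Qed.

Lemma fN_intZ k g : bdd_meas g ->
  fN_int (fun x => k * g x) = k * fN_int g.
Proof.
move=> bg; rewrite /fN_int -RintegralZl; last 2 first.
- exact: measurable_Sq.
- exact: bdd_meas_integrable.
by apply: eq_Rintegral => x _; rewrite mulrA.
Qed.

Lemma eq_fN_int f g : (forall x, Sq q x -> f x = g x) ->
  fN_int f = fN_int g.
Proof. by move=> fg; apply: eq_Rintegral => x /set_mem /fg ->. Qed.

Let fN_intDp p r : fN_int (horner (p + r)) =
  fN_int (horner p) + fN_int (horner r).
Proof.
rewrite -fN_intD; [|exact: bdd_meas_horner|exact: bdd_meas_horner].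
by apply: eq_fN_int => x _; rewrite hornerD.
Qed.

Let fN_intZp k p : fN_int (horner (k *: p)) = k * fN_int (horner p).
Proof.
rewrite -fN_intZ; last exact: bdd_meas_horner.
by apply: eq_fN_int => x _; rewrite hornerZ.
Qed.

Let fN_int_cvg p :
  (fun N => c0 * semicircle_moment q (weight_poly N * p)) @ \oo -->
  fN_int (horner p).
Proof.
have [B B0 hB] := weight_poly_bounded.
have [_ [M M0 hM]] := bdd_meas_horner p.
have E N : c0 * semicircle_moment q (weight_poly N * p) =
    \int[mu]_(x in Sq q) (c0 * (semicircle q x * (weight_poly N * p).[x])).
  rewrite RintegralZl//; first exact: measurable_Sq.
  exact: semicircle_integrable.
under eq_fun do rewrite E.
rewrite /fN_int.
apply: (@bounded_convergence _ _ _ mu _ (measurable_Sq q) (Sq_finite_measure q)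
    (fun N x => c0 * (semicircle q x * (weight_poly N * p).[x]))
    (fun x => p.[x] * fN q x) (c0 * (2 * (B * M)))).
- move=> N; apply: measurable_funM; first exact: measurable_cst.
  by apply: measurable_funM; [exact: msemi|exact: mhorner].
- move=> x Sx; rewrite [X in _ --> X]mulrC.
  rewrite (_ : (fun N => _) = fun N =>
    c0 * (semicircle q x * (weight_poly N).[x]) * p.[x]).
    by apply: cvgM; [exact: fN_cvg|exact: cvg_cst].
  by apply/funext => N; rewrite hornerM; ring.
- move=> N x Sx; rewrite normrM (gtr0_norm c0_gt0) ler_pM2l// normrM hornerM.
  rewrite normrM; apply: ler_pM; rewrite ?mulr_ge0//.
    exact: semicircle_bounded.
  by apply: ler_pM => //; [exact: hB|exact: hM].
Qed.

Let weight_polyS N : weight_poly N.+1 = weight_poly N *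
  (((1 + q ^+ N.+1) ^+ 2)%:P - q ^+ N.+1 *: ((s *: 'X) * (s *: 'X))).
Proof. by rewrite /weight_poly big_nat_recr. Qed.

Let momentB (p r : {poly R}) : semicircle_moment q (p - r) =
  semicircle_moment q p - semicircle_moment q r.
Proof. by rewrite -scaleN1r semicircle_momentD// semicircle_momentZ mulN1r. Qed.

(** One more factor of the weight: (1 + Q)^2 - Q (s x)^2 =
    (1 + Q^2) - Q ((s x)^2 - 2), and (s x)^2 - 2 maps U_k to
    U_(k+2) + U_(k-2). *)
Let momentS N (p r : {poly R}) : (s *: 'X) * ((s *: 'X) * p) = r + 2 *: p ->
  semicircle_moment q (weight_poly N.+1 * p) =
  (1 + q ^+ N.+1 ^+ 2) * semicircle_moment q (weight_poly N * p)
  - q ^+ N.+1 * semicircle_moment q (weight_poly N * r).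
Proof.
move=> e; rewrite -!semicircle_momentZ -momentB; congr semicircle_moment.
rewrite weight_polyS; set Q := q ^+ N.+1.
rewrite -[_ * _ * p]mulrA mulrBl -scalerAl -mulrA e mul_polyC.
rewrite 2!scalerAr -mulrBr; congr (_ * _).
rewrite scalerDr opprD addrA addrAC; congr (_ - _).
by rewrite scalerA -scalerBl; congr (_ *: _); ring.
Qed.

Let cheb_sq_gen n : (s *: 'X) * ((s *: 'X) * cheb q n.+2) =
  (cheb q n.+4 + cheb q n) + 2 *: cheb q n.+2.
Proof.
rewrite cheb_rec mulrDr !cheb_rec /= scaler_nat mulr2n.
by rewrite [X in _ + X = _]addrC addrACA.
Qed.

Let cheb_sq0 : (s *: 'X) * ((s *: 'X) * cheb q 0) =
  (cheb q 2 - cheb q 0) + 2 *: cheb q 0.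
Proof.
rewrite cheb_rec addr0 cheb_rec /= scaler_nat mulr2n.
by rewrite -addrA; congr (_ + _); rewrite addrA addNr add0r.
Qed.

Let cheb_sq1 : (s *: 'X) * ((s *: 'X) * cheb q 1) = cheb q 3 + 2 *: cheb q 1.
Proof.
by rewrite cheb_rec mulrDr !cheb_rec /= addr0 scaler_nat mulr2n addrA.
Qed.

Let moment_odd N k :
  semicircle_moment q (weight_poly N * cheb q k.*2.+1) = 0.
Proof.
elim: N k => [|N IH] k.
  by rewrite /weight_poly big_geq// mul1r semicircle_cheb.
case: k => [|k].
  by rewrite (momentS N cheb_sq1) (IH 0%N) (IH 1%N); ring.
rewrite doubleS (momentS N (cheb_sq_gen k.*2.+1)) mulrDr semicircle_momentD//.
by rewrite -!doubleS !IH; ring.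
Qed.

Let fN_int_cheb_odd k : fN_int (horner (cheb q k.*2.+1)) = 0.
Proof.
have := @fN_int_cvg (cheb q k.*2.+1); under eq_fun do rewrite moment_odd mulr0.
by move/cvg_lim => <-//; rewrite lim_cst.
Qed.

Let fN_int_cheb_even k : fN_int (horner (cheb q k.+1.*2)) =
  - q ^+ k.+1 * fN_int (horner (cheb q k.*2)).
Proof.
have fin N := @cheb_finite_ratio _ _ hq
  (fun N k => semicircle_moment q (weight_poly N * cheb q k.*2)) _ _ _ N k.
have {fin} fin N : (1 - q ^+ (N + k).+2) *
    (c0 * semicircle_moment q (weight_poly N * cheb q k.+1.*2)) =
  - (q ^+ k.+1 - q ^+ N.+1) *
    (c0 * semicircle_moment q (weight_poly N * cheb q k.*2)).
  rewrite mulrCA fin; first by ring.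
  - by move=> j; rewrite /weight_poly big_geq// mul1r semicircle_cheb.
  - by move=> N'; rewrite (momentS N' cheb_sq0) mulrBr momentB.
  - move=> N' j; rewrite !doubleS (momentS N' (cheb_sq_gen j.*2)) mulrDr.
    rewrite semicircle_momentD [X in _ - _ * X = _]addrC.
    by [].
have q0 j : (fun N => q ^+ (N + j)) @ \oo --> (0 : R).
  by rewrite (cvg_shiftn j); apply: cvg_expr; exact: normq_lt1.
have l1 : (fun N => (1 - q ^+ (N + k).+2) *
    (c0 * semicircle_moment q (weight_poly N * cheb q k.+1.*2))) @ \oo -->
    (1 - 0) * fN_int (horner (cheb q k.+1.*2)).
  apply: cvgM; last exact: fN_int_cvg.
  apply: cvgB; first exact: cvg_cst.
  by under eq_fun do rewrite -2!addnS; exact: q0.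
have l2 : (fun N => - (q ^+ k.+1 - q ^+ N.+1) *
    (c0 * semicircle_moment q (weight_poly N * cheb q k.*2))) @ \oo -->
    - (q ^+ k.+1 - 0) * fN_int (horner (cheb q k.*2)).
  apply: cvgM; last exact: fN_int_cvg.
  apply: cvgN; apply: cvgB; first exact: cvg_cst.
  by under eq_fun do rewrite -addn1; exact: q0.
have E : (fun N => (1 - q ^+ (N + k).+2) *
    (c0 * semicircle_moment q (weight_poly N * cheb q k.+1.*2))) =
  (fun N => - (q ^+ k.+1 - q ^+ N.+1) *
    (c0 * semicircle_moment q (weight_poly N * cheb q k.*2))).
  by apply/funext => N; exact: fin.
rewrite E in l1; have := cvg_lim (@Rhausdorff R) l1.
by rewrite (cvg_lim (@Rhausdorff R) l2) !subr0 mul1r => ->.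
Qed.

Lemma fN_int_hermite n : fN_int (fun x => H n.+1 x) = 0.
Proof.
pose h n : {poly R} := s ^+ n *: qHermite q n.
have hE m x : (h m).[x] = s ^+ m * H m x by rewrite /h hornerZ.
pose M n k := fN_int (horner (h n * cheb q k)).
have MS m k : M m.+1 k = M m k.+1 + fN_int (horner (h m * cheb_prev q k))
    - (1 - q ^+ m) * M m.-1 k.
  rewrite /M -fN_intDp -mulNr -fN_intZp -fN_intDp.
  apply: eq_fN_int => x _.
  rewrite hornerD hornerZ hornerD !hornerM !hE hermite_scaledS//.
  have : s * x * (cheb q k).[x] = (cheb q k.+1).[x] + (cheb_prev q k).[x].
    by rewrite -hornerD -cheb_rec hornerM hornerZ hornerX.
  move=> e; rewrite mulrBl -[s * x * _ * _]mulrA [_ * (cheb q k).[x]]mulrC.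
  by rewrite mulrA [s * x * _]e; ring.
have h0 k : M 0%N k = fN_int (horner (cheb q k)).
  apply: eq_fN_int => x _.
  by rewrite hornerM hE expr0 hermite0 !mul1r.
have s0 : s ^+ n.+1 != 0 by rewrite lt0r_neq0// exprn_gt0// sqrt_onemq_gt0.
apply: (mulfI s0); rewrite mulr0.
have <- : M n.+1 0%N = s ^+ n.+1 * fN_int (fun x => H n.+1 x).
  rewrite /M cheb0 mulr1 -fN_intZ; last exact: bdd_meas_horner.
  by apply: eq_fN_int => x _; rewrite hE.
apply: (cheb_hermite_orth hq).
- move=> m; rewrite MS/= mulr0 (_ : fN_int (horner 0) = 0) ?addr0//.
  by rewrite -(scale0r 0) fN_intZp mul0r.
- by move=> m k; rewrite MS.
- by move=> j; rewrite h0 fN_int_cheb_odd.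
- by move=> j; rewrite !h0 fN_int_cheb_even.
Qed.

End HermiteFunctional.

(** * Integrals of products of functions of one variable *)

Section Tensor.
Context d1 d2 (T1 : measurableType d1) (T2 : measurableType d2) (R : realType).
Variables (m1 : {sigma_finite_measure set T1 -> \bar R})
  (m2 : {sigma_finite_measure set T2 -> \bar R}).
Variables (f1 : T1 -> R) (f2 : T2 -> R).
Hypotheses (if1 : m1.-integrable setT (EFin \o f1))
  (if2 : m2.-integrable setT (EFin \o f2)).

Let tensor (p : T1 * T2) : R := f1 p.1 * f2 p.2.

Let mtensor : measurable_fun setT (EFin \o tensor).
Proof.
apply/measurable_EFinP; apply: measurable_funM.
  apply: (measurableT_comp (f := f1)); last exact: measurable_fst.
  by apply/measurable_EFinP; exact: measurable_int if1.
apply: (measurableT_comp (f := f2)); last exact: measurable_snd.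
by apply/measurable_EFinP; exact: measurable_int if2.
Qed.

Lemma tensor_integrable : (m1 \x m2)%E.-integrable setT (EFin \o tensor).
Proof.
apply/(integrable12ltyP _ _ mtensor).
have in2 := integrable_norm if2.
have in1 := integrable_norm if1.
have E x : (\int[m2]_y `|(EFin \o tensor) (x, y)| =
    `|f1 x|%:E * (\int[m2]_y `|f2 y|)%:E)%E.
  rewrite (eq_integral (fun y => `|f1 x|%:E * (EFin \o (Num.norm \o f2)) y)%E).
    by rewrite (integralZl measurableT in2) fineK// (integrable_fin_num _ in2).
  by move=> y _; rewrite /= normrM EFinM.
rewrite (eq_integral (fun x => (EFin \o (Num.norm \o f1)) x *
  (\int[m2]_y `|f2 y|)%:E)%E); last by move=> x _; rewrite E.
rewrite (integralZr measurableT in1) -(fineK (integrable_fin_num measurableT in1)).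
by rewrite -EFinM ltry.
Qed.

Lemma Rintegral_tensor :
  \int[(m1 \x m2)%E]_p (f1 p.1 * f2 p.2) =
  (\int[m1]_x f1 x) * (\int[m2]_y f2 y).
Proof.
rewrite {1}/Rintegral -(integral12_prod_meas1 tensor_integrable).
have -> : (fun x => fubini_F m2 (EFin \o tensor) x) =
    (fun x => (f1 x)%:E * (\int[m2]_y f2 y)%:E)%E.
  apply/funext => x; rewrite /fubini_F /=.
  rewrite (eq_integral (fun y => (f1 x)%:E * (EFin \o f2) y)%E)//.
  by rewrite (integralZl measurableT if2) fineK// (integrable_fin_num _ if2).
have := integralZr measurableT if1 (\int[m2]_y f2 y); rewrite /= => ->.
by rewrite /Rintegral fineM// (integrable_fin_num _ if1).
Qed.

End Tensor.

(** Product of two copies of Lebesgue measure, under a name of its own so that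
    it carries the sigma-finite structure needed to apply Fubini a second
    time. *)
Definition lebesgue2 (R : realType) :=
  (@lebesgue_measure R \x @lebesgue_measure R)%E.

Section Lebesgue2.
Variable R : realType.
Local Notation mu := (@lebesgue_measure R).

HB.instance Definition _ := Measure.on (@lebesgue2 R).

Let lebesgue2_sigma_finite : sigma_finite setT (@lebesgue2 R).
Proof.
have /sigma_finiteP[F [TF ndF Foo]] := sigma_finiteT mu.
exists (fun n => F n `*` F n).
  rewrite -setXTT TF predeqE => -[x y]; split.
    move=> [/= [n _ Fnx] [k _ Fky]]; exists (maxn n k) => //; split.
    - by move: x Fnx; exact/subsetPset/ndF/leq_maxl.
    - by move: y Fky; exact/subsetPset/ndF/leq_maxr.
  by move=> [n _ []/= ? ?]; split; exists n.
move=> k; have [? ?] := Foo k; split; first exact: measurableX.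
by rewrite [X in (X < _)%E]product_measure1E// lte_mul_pinfty// ge0_fin_numE.
Qed.

HB.instance Definition _ := Measure_isSigmaFinite.Build _ _ _ (@lebesgue2 R)
  lebesgue2_sigma_finite.

End Lebesgue2.

Section TripleIntegral.
Variables (R : realType) (q : R).
Hypothesis hq : -1 < q < 1.
Local Notation mu := (@lebesgue_measure R).

Lemma measurable_Sq3 : measurable (Sq3 q).
Proof. by do 2?[apply: measurableX]; exact: measurable_itv. Qed.

Lemma Sq3_finite_measure : (@lebesgue3 R (Sq3 q) < +oo)%E.
Proof.
have mS : measurable (Sq q : set (measurableTypeR R)) := measurable_itv _.
have fS := Sq_finite_measure q.
have mS2 : measurable (Sq q `*` Sq q : set (measurableTypeR R * measurableTypeR R)).
  exact: measurableX.
rewrite /lebesgue3 /Sq3 [X in (X < _)%E]product_measure1E//.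
rewrite [X in (X * _)%E]product_measure1E//.
by rewrite lte_mul_pinfty// ?fin_numM// ?ge0_fin_numE// mule_ge0.
Qed.

Lemma triple_product_integral (g1 g2 g3 : R -> R) :
  bdd_meas q g1 -> bdd_meas q g2 -> bdd_meas q g3 ->
  \int[@lebesgue3 R]_(p in Sq3 q) ((g1 p.1.1 * fN q p.1.1) *
     (g2 p.1.2 * fN q p.1.2) * (g3 p.2 * fN q p.2)) =
  fN_int q g1 * fN_int q g2 * fN_int q g3.
Proof.
move=> b1 b2 b3.
pose f (g : R -> R) := (fun x => g x * fN q x) \_ (Sq q).
have fI g : bdd_meas q g -> mu.-integrable setT (EFin \o f g).
  move=> bg; rewrite /f -restrict_EFin; apply/integrable_restrict => //=.
    exact: measurable_Sq.
  rewrite setTI; exact: bdd_meas_integrable.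
have fE g : fN_int q g = \int[mu]_x f g x by rewrite /fN_int Rintegral_mkcond.
have I12 : (@lebesgue2 R).-integrable setT
    (EFin \o (fun p => f g1 p.1 * f g2 p.2)).
  exact: tensor_integrable (fI _ b1) (fI _ b2).
rewrite !fE -(Rintegral_tensor (fI _ b1) (fI _ b2)).
etransitivity; last exact: Rintegral_tensor I12 (fI _ b3).
rewrite Rintegral_mkcond; apply: eq_Rintegral => -[[x y] z] _ /=.
rewrite /f !patchE /Sq3.
have -> : ((x, y, z) \in Sq q `*` Sq q `*` Sq q) =
    [&& x \in Sq q, y \in Sq q & z \in Sq q].
  by rewrite !in_setX andbA.
case: (x \in Sq q); case: (y \in Sq q); case: (z \in Sq q);
  by rewrite /= ?(mul0r, mulr0).
Qed.

End TripleIntegral.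

(** * Orthogonality and Hermite moments *)

Section RintegralSum.
Context d (T : measurableType d) (R : realType).
Variables (mu : {measure set T -> \bar R}) (D : set T).
Hypothesis mD : measurable D.

Lemma sum_integrable_EFin (F : nat -> T -> R) n :
  (forall i, mu.-integrable D (EFin \o F i)) ->
  mu.-integrable D (EFin \o (fun x => \sum_(i < n) F i x)).
Proof.
move=> iF; elim: n => [|n IH].
  rewrite (_ : _ \o _ = cst 0%E); first exact: integrable0.
  by apply/funext => x /=; rewrite big_ord0.
pose G x := \sum_(i < n) F i x.
rewrite (_ : _ \o _ = (EFin \o G) \+ (EFin \o F n))%E.
  exact: integrableD.
by apply/funext => x /=; rewrite big_ord_recr.
Qed.

Lemma Rintegral_sum (F : nat -> T -> R) n :
  (forall i, mu.-integrable D (EFin \o F i)) ->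
  \int[mu]_(x in D) (\sum_(i < n) F i x) = \sum_(i < n) \int[mu]_(x in D) F i x.
Proof.
move=> iF; elim: n => [|n IH].
  rewrite big_ord0 -[RHS](mul0r (fine (mu D))) -Rintegral_cst//.
  by apply: eq_Rintegral => x _; rewrite big_ord0.
rewrite big_ord_recr/= -IH -RintegralD//; last exact: sum_integrable_EFin.
by apply: eq_Rintegral => x _; rewrite big_ord_recr.
Qed.

End RintegralSum.

Section HermiteOrthogonality.
Variables (R : realType) (q : R).
Hypothesis hq : -1 < q < 1.
Local Notation H n x := (qHermite q n).[x].
Local Notation fNint := (fN_int q).
Local Notation c := (fN_int q (fun=> 1)).

Lemma bdd_meas_cst a : bdd_meas q (fun=> a).
Proof.
by split; [exact: measurable_cst|exists `|a|].
Qed.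

Lemma bdd_meas_hermite n : bdd_meas q (fun x => H n x).
Proof. exact: bdd_meas_horner. Qed.

Lemma bdd_meas_sum (F : nat -> R -> R) n :
  (forall i, bdd_meas q (F i)) -> bdd_meas q (fun x => \sum_(i < n) F i x).
Proof.
move=> bF; elim: n => [|n [mS [M M0 hM]]].
  rewrite (_ : (fun x => _) = fun=> 0); first exact: bdd_meas_cst.
  by apply/funext => x; rewrite big_ord0.
rewrite (_ : (fun x => _) = fun x => \sum_(i < n) F i x + F n x); last first.
  by apply/funext => x; rewrite big_ord_recr.
have [mF [N N0 hN]] := bF n; split; first exact: measurable_funD.
exists (M + N); first exact: addr_ge0.
by move=> x Sx; apply: le_trans (ler_normD _ _) _; rewrite lerD ?hM ?hN.
Qed.

Lemma fN_int_sum (F : nat -> R -> R) n : (forall i, bdd_meas q (F i)) ->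
  fNint (fun x => \sum_(i < n) F i x) = \sum_(i < n) fNint (F i).
Proof.
move=> bF; rewrite /fN_int.
have := @Rintegral_sum _ _ R lebesgue_measure _ (measurable_Sq q)
  (fun i x => F i x * fN q x) n (fun i => bdd_meas_integrable hq (bF i)).
rewrite /= => <-.
by apply: eq_Rintegral => x _; rewrite big_distrl.
Qed.

Lemma fN_int_lincomb (a : nat -> R) (F : nat -> R -> R) n :
  (forall i, bdd_meas q (F i)) ->
  fNint (fun x => \sum_(i < n) a i * F i x) = \sum_(i < n) a i * fNint (F i).
Proof.
move=> bF; rewrite (@fN_int_sum (fun i x => a i * F i x)).
  by apply: eq_bigr => i _; rewrite fN_intZ.
by move=> i; apply: bdd_measM => //; exact: bdd_meas_cst.
Qed.

Lemma fN_int_hermite0 n : fNint (fun x => H n x) = (n == 0%N)%:R * c.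
Proof.
case: n => [|n]; last by rewrite fN_int_hermite// mul0r.
by rewrite mul1r; apply: eq_fN_int => x _; rewrite hermite0.
Qed.

(** In the linearization of H_i H_j only the term in H_0 survives, and it occurs
    only for i = j. *)
Lemma fN_int_orth i j :
  fNint (fun x => H i x * H j x) = (i == j)%:R * (qfact q i * c).
Proof.
have E x : H i x * H j x =
    \sum_(s < i.+1) qbinom q i s * qffact q j s * H (i + j - s.*2) x.
  exact: hermite_linearization.
rewrite (@eq_fN_int _ _ _ (fun x => \sum_(s < i.+1)
    (qbinom q i s * qffact q j s) * H (i + j - s.*2) x)); last by move=> x _; exact: E.
rewrite (@fN_int_lincomb (fun s => qbinom q i s * qffact q j s)
    (fun s x => H (i + j - s.*2) x)); last by move=> s; exact: bdd_meas_hermite.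
rewrite big_ord_recr/= big1 ?add0r; last first.
  move=> s _; have [js|sj] := ltnP j s.
    by rewrite qffact_small// mulr0 mul0r.
  rewrite fN_int_hermite0 (_ : (_ == _)%:R = 0) ?mul0r ?mulr0//.
  by case: eqP => //; have := ltn_ord s; lia.
rewrite qbinomnn// mul1r fN_int_hermite0.
have [ji|ij|ij] := ltngtP j i.
- by rewrite qffact_small// !mul0r.
- rewrite (_ : (_ == _)%:R = 0); last by case: eqP => //; lia.
  by rewrite !mul0r mulr0.
- have := @qffact_fact _ q i 0; rewrite add0n qfact0 mulr1 ij => ->.
  by rewrite (_ : (i + i - i.*2 == 0)%N) ?eqxx ?mul1r//; apply/eqP; lia.
Qed.

Lemma fN_int_three n i k :
  fNint (fun x => H n x * (H i x * H k x)) =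
  \sum_(s < n.+1) qbinom q n s * qffact q i s *
    ((n + i - s.*2 == k)%N%:R * (qfact q k * c)).
Proof.
rewrite (@eq_fN_int _ _ _ (fun x => \sum_(s < n.+1)
    (qbinom q n s * qffact q i s) * (H (n + i - s.*2) x * H k x))); last first.
  move=> x _; rewrite mulrA (hermite_linearization hq) big_distrl/=.
  by apply: eq_bigr => s _; rewrite mulrA.
rewrite (@fN_int_lincomb (fun s => qbinom q n s * qffact q i s)
    (fun s x => H (n + i - s.*2) x * H k x)); last first.
  by move=> s; apply: bdd_measM; exact: bdd_meas_hermite.
apply: eq_bigr => s _; rewrite fN_int_orth; congr (_ * _).
by case: eqP => [->|]//; rewrite !mul0r.
Qed.

Lemma bdd_meas_mehler_partial r k m N :
  bdd_meas q (fun z => series (mehler_term q r k m z z) N).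
Proof.
rewrite (_ : (fun z => _) = fun z => \sum_(j < N) mehler_term q r k m z z j).
  apply: (@bdd_meas_sum (fun j z => mehler_term q r k m z z j)) => j.
  apply: bdd_measM; first exact: bdd_meas_cst.
  by apply: bdd_measM; exact: bdd_meas_hermite.
by apply/funext => z; rewrite /series/= big_mkord.
Qed.

Lemma bdd_meas_mehler r k m : `|r| < 1 -> bdd_meas q (fun z => mehler q r k m z z).
Proof.
move=> r1; have [C C0 hC] := mehler_partial_bounded hq k m r1.
split.
  apply: (@measurable_fun_cvg _ _ _ _
    (fun N z => series (mehler_term q r k m z z) N)).
    by move=> N; have [] := bdd_meas_mehler_partial r k m N.
  by move=> z Sz; exact: mehler_cvg.
exists C => // z Sz.
have cv : (fun N => `|series (mehler_term q r k m z z) N|) @ \oo -->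
    `|mehler q r k m z z| by apply: cvg_norm; exact: mehler_cvg.
by apply: cvgr_to_le cv _; apply: nearW => N; exact: hC.
Qed.

Lemma fN_int_mehler_cvg g r k m : bdd_meas q g -> `|r| < 1 ->
  (fun N => \sum_(j < N) r ^+ j / qfact q j *
     fNint (fun z => g z * (H (j + k) z * H (j + m) z))) @ \oo -->
  fNint (fun z => g z * mehler q r k m z z).
Proof.
move=> bg r1; have [mg [M M0 hM]] := bg.
have [C C0 hC] := mehler_partial_bounded hq k m r1.
have [B B0 hB] := fN_bounded hq.
have E N : \sum_(j < N) r ^+ j / qfact q j *
     fNint (fun z => g z * (H (j + k) z * H (j + m) z)) =
     fNint (fun z => g z * series (mehler_term q r k m z z) N).
  rewrite -(@fN_int_lincomb (fun j => r ^+ j / qfact q j)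
    (fun j z => g z * (H (j + k) z * H (j + m) z))); last first.
    by move=> j; apply: bdd_measM => //; apply: bdd_measM; exact: bdd_meas_hermite.
  apply: eq_fN_int => z _; rewrite /series/= big_mkord big_distrr/=.
  by apply: eq_bigr => j _; rewrite /mehler_term mulrCA.
under eq_fun do rewrite E.
rewrite /fN_int.
apply: (@bounded_convergence _ _ _ lebesgue_measure _ (measurable_Sq q)
    (Sq_finite_measure q) (fun N z => g z * series (mehler_term q r k m z z) N * fN q z)
    (fun z => g z * mehler q r k m z z * fN q z) (M * C * B)).
- move=> N; apply: measurable_funM; last exact: measurable_fN.
  by apply: measurable_funM => //; have [] := bdd_meas_mehler_partial r k m N.
- move=> z Sz; apply: cvgM; last exact: cvg_cst.
  by apply: cvgM; [exact: cvg_cst|exact: mehler_cvg].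
- move=> N z Sz; rewrite normrM ler_pM// ?hB// normrM ler_pM// ?hM//.
  exact: hC.
Qed.

End HermiteOrthogonality.

(** * Integrals against the product of three kernels *)

Section Triple.
Variables (R : realType) (q : R).
Hypothesis hq : -1 < q < 1.
Local Notation H n x := (qHermite q n).[x].
Local Notation fNint := (fN_int q).
Local Notation c := (fN_int q (fun=> 1)).
Local Notation mu3 := (@lebesgue3 R).
Implicit Types (g : R -> R) (a b : R) (p : R * R * R).

Definition bdd_meas3 (G : R * R * R -> R) : Prop :=
  measurable_fun (Sq3 q) G /\
  exists2 M, 0 <= M & forall p, Sq3 q p -> `|G p| <= M.

Lemma bdd_meas3M F G : bdd_meas3 F -> bdd_meas3 G -> bdd_meas3 (fun p => F p * G p).
Proof.
move=> [mf [M M0 hM]] [mg [N N0 hN]]; split; first exact: measurable_funM.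
exists (M * N); first exact: mulr_ge0.
by move=> x Sx; rewrite normrM ler_pM ?hM ?hN.
Qed.

Lemma bdd_meas3_integrable G : bdd_meas3 G -> mu3.-integrable (Sq3 q) (EFin \o G).
Proof.
move=> [mG [M _ hM]].
exact: (@bounded_integrable _ _ _ mu3 _ (measurable_Sq3 q)
  (Sq3_finite_measure q) G M mG hM).
Qed.

Lemma bdd_meas3_proj (pr : R * R * R -> R) g : measurable_fun setT pr ->
  (forall p, Sq3 q p -> Sq q (pr p)) ->
  measurable_fun (Sq q) g ->
  (exists2 M, 0 <= M & forall x, Sq q x -> `|g x| <= M) ->
  bdd_meas3 (fun p => g (pr p)).
Proof.
move=> mpr hpr mg [M M0 hM]; split; last by exists M => // p /hpr; exact: hM.
apply: (@measurable_comp _ _ _ _ _ _ (Sq q)) => //.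
- exact: measurable_Sq.
- by move=> _ [p Sp <-]; exact: hpr.
- exact: measurable_funTS.
Qed.

Let m1 : measurable_fun setT (fun p : R * R * R => p.1.1).
Proof. by apply: measurableT_comp; exact: measurable_fst. Qed.

Let m2 : measurable_fun setT (fun p : R * R * R => p.1.2).
Proof.
by apply: measurableT_comp; [exact: measurable_snd|exact: measurable_fst].
Qed.

Let m3 : measurable_fun setT (fun p : R * R * R => p.2).
Proof. exact: measurable_snd. Qed.

Lemma bdd_meas3_1 g : bdd_meas q g -> bdd_meas3 (fun p => g p.1.1).
Proof. by move=> [mg bg]; apply: bdd_meas3_proj => // -[[x y] z] [[]]. Qed.

Lemma bdd_meas3_2 g : bdd_meas q g -> bdd_meas3 (fun p => g p.1.2).
Proof. by move=> [mg bg]; apply: bdd_meas3_proj => // -[[x y] z] [[]]. Qed.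

Lemma bdd_meas3_3 g : bdd_meas q g -> bdd_meas3 (fun p => g p.2).
Proof. by move=> [mg bg]; apply: bdd_meas3_proj => // -[[x y] z] []. Qed.

Lemma bdd_meas_fN : bdd_meas q (fN q).
Proof.
split; first exact: measurable_fN.
by have [B /ltW B0 hB] := fN_bounded hq; exists B.
Qed.

Definition weighted_tensor g1 g2 g3 p : R :=
  (g1 p.1.1 * fN q p.1.1) * (g2 p.1.2 * fN q p.1.2) * (g3 p.2 * fN q p.2).

Lemma bdd_meas3_weighted_tensor g1 g2 g3 : bdd_meas q g1 -> bdd_meas q g2 -> bdd_meas q g3 ->
  bdd_meas3 (weighted_tensor g1 g2 g3).
Proof.
move=> b1 b2 b3; have bf := bdd_meas_fN.
apply: bdd_meas3M; [apply: bdd_meas3M|].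
- by apply: (@bdd_meas3_1 (fun x => g1 x * fN q x)); exact: bdd_measM.
- by apply: (@bdd_meas3_2 (fun x => g2 x * fN q x)); exact: bdd_measM.
- by apply: (@bdd_meas3_3 (fun x => g3 x * fN q x)); exact: bdd_measM.
Qed.

Definition kernel3 (r12 r13 r23 : R) p : R :=
  mehler q r12 0 0 p.1.1 p.1.2 * mehler q r13 0 0 p.1.1 p.2 *
  mehler q r23 0 0 p.1.2 p.2.

Definition triple_integral g1 g2 g3 (r12 r13 r23 : R) : R :=
  \int[mu3]_(p in Sq3 q) (weighted_tensor g1 g2 g3 p * kernel3 r12 r13 r23 p).

Definition kernel3_part (r12 r13 r23 : R) N1 N2 N3 p : R :=
  series (mehler_term q r12 0 0 p.1.1 p.1.2) N1 *
  series (mehler_term q r13 0 0 p.1.1 p.2) N2 *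
  series (mehler_term q r23 0 0 p.1.2 p.2) N3.

Definition hermite_moment g i j : R := fNint (fun x => g x * (H i x * H j x)).

Lemma hermite_momentC g i j : hermite_moment g i j = hermite_moment g j i.
Proof. by apply: eq_fN_int => x _; rewrite [H i x * _]mulrC. Qed.

Definition triple_sum g1 g2 g3 (r12 r13 r23 : R) N1 N2 N3 : R :=
  \sum_(i < N1) \sum_(j < N2) \sum_(l < N3)
    (r12 ^+ i / qfact q i) * (r13 ^+ j / qfact q j) * (r23 ^+ l / qfact q l) *
    (hermite_moment g1 i j * hermite_moment g2 i l * hermite_moment g3 j l).

Lemma triple_integral_partE g1 g2 g3 r12 r13 r23 N1 N2 N3 :
  bdd_meas q g1 -> bdd_meas q g2 -> bdd_meas q g3 ->
  \int[mu3]_(p in Sq3 q)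
     (weighted_tensor g1 g2 g3 p * kernel3_part r12 r13 r23 N1 N2 N3 p) =
  triple_sum g1 g2 g3 r12 r13 r23 N1 N2 N3.
Proof.
move=> b1 b2 b3.
pose gH (g : R -> R) i j := (fun x => g x * (H i x * H j x)).
have bgH g i j : bdd_meas q g -> bdd_meas q (gH g i j).
  by move=> bg; apply: bdd_measM => //; apply: bdd_measM; exact: bdd_meas_hermite.
pose k i j l := (r12 ^+ i / qfact q i) * (r13 ^+ j / qfact q j) *
  (r23 ^+ l / qfact q l).
pose F i j l p := k i j l * weighted_tensor (gH g1 i j) (gH g2 i l) (gH g3 j l) p.
have iF i j l : mu3.-integrable (Sq3 q) (EFin \o F i j l).
  apply: bdd_meas3_integrable; apply: bdd_meas3M.
    by split; [exact: measurable_cst|exists `|k i j l|].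
  by apply: bdd_meas3_weighted_tensor; exact: bgH.
have mS := measurable_Sq3 q.
have E p : weighted_tensor g1 g2 g3 p * kernel3_part r12 r13 r23 N1 N2 N3 p =
    \sum_(i < N1) \sum_(j < N2) \sum_(l < N3) F i j l p.
  rewrite /kernel3_part /series/= !big_mkord -mulrA big_distrl big_distrr/=.
  apply: eq_bigr => i _; rewrite big_distrl !big_distrr/=.
  apply: eq_bigr => j _; rewrite !big_distrr/=.
  apply: eq_bigr => l _; rewrite /F /weighted_tensor /gH /k /mehler_term !addn0.
  by ring.
transitivity (\int[mu3]_(p in Sq3 q)
    (\sum_(i < N1) \sum_(j < N2) \sum_(l < N3) F i j l p)).
  by apply: eq_Rintegral => p _; exact: E.
have i3 i j : mu3.-integrable (Sq3 q) (EFin \o (fun p => \sum_(l < N3) F i j l p)).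
  by apply: (@sum_integrable_EFin _ _ _ mu3 _ mS (F i j)) => l; exact: iF.
have i2 i : mu3.-integrable (Sq3 q)
    (EFin \o (fun p => \sum_(j < N2) \sum_(l < N3) F i j l p)).
  exact: (@sum_integrable_EFin _ _ _ mu3 _ mS (fun j p => \sum_(l < N3) F i j l p)).
rewrite (@Rintegral_sum _ _ _ mu3 _ mS
  (fun i p => \sum_(j < N2) \sum_(l < N3) F i j l p))//.
apply: eq_bigr => i _.
rewrite (@Rintegral_sum _ _ _ mu3 _ mS (fun j p => \sum_(l < N3) F i j l p))//.
apply: eq_bigr => j _.
rewrite (@Rintegral_sum _ _ _ mu3 _ mS (F i j))//.
apply: eq_bigr => l _.
rewrite /F RintegralZl//; last first.
  by apply: bdd_meas3_integrable; apply: bdd_meas3_weighted_tensor; exact: bgH.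
congr (_ * _); exact: (triple_product_integral hq (bgH _ i j b1) (bgH _ i l b2) (bgH _ j l b3)).
Qed.

Lemma bdd_meas3_kernel_part r12 r13 r23 N1 N2 N3 :
  measurable_fun (Sq3 q) (kernel3_part r12 r13 r23 N1 N2 N3).
Proof.
have mH (pr : R * R * R -> R) n : measurable_fun setT pr ->
    measurable_fun (Sq3 q) (fun p => H n (pr p)).
  move=> mpr; apply: measurable_funTS; apply: measurableT_comp => //.
  by apply: continuous_measurable_fun; exact: continuous_horner.
have mT (pr pr' : R * R * R -> R) r N : measurable_fun setT pr ->
    measurable_fun setT pr' -> measurable_fun (Sq3 q)
      (fun p => series (mehler_term q r 0 0 (pr p) (pr' p)) N).
  move=> mpr mpr'; elim: N => [|N IH].
    rewrite (_ : (fun p => _) = fun=> 0); first exact: measurable_cst.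
    by apply/funext => p; rewrite /series/= big_geq.
  rewrite (_ : (fun p => _) = fun p => series (mehler_term q r 0 0 (pr p) (pr' p)) N
      + mehler_term q r 0 0 (pr p) (pr' p) N); last first.
    by apply/funext => p; rewrite /series/= big_nat_recr.
  apply: measurable_funD => //; apply: measurable_funM; first exact: measurable_cst.
  by apply: measurable_funM; exact: mH.
by apply: measurable_funM; [apply: measurable_funM|]; exact: mT.
Qed.

(** The shift k in the last range leaves room, for H_n in the second slot, to
    include all the indices l <= i + n that linearization couples to i < N. *)
Lemma triple_integral_cvg g1 g2 g3 r12 r13 r23 k :
  bdd_meas q g1 -> bdd_meas q g2 -> bdd_meas q g3 ->
  `|r12| < 1 -> `|r13| < 1 -> `|r23| < 1 ->
  (fun N => triple_sum g1 g2 g3 r12 r13 r23 N N (N + k)) @ \oo -->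
  triple_integral g1 g2 g3 r12 r13 r23.
Proof.
move=> b1 b2 b3 h12 h13 h23.
have [mt [M M0 hM]] := bdd_meas3_weighted_tensor b1 b2 b3.
have [C12 p12 b12] := mehler_partial_bounded hq 0 0 h12.
have [C13 p13 b13] := mehler_partial_bounded hq 0 0 h13.
have [C23 p23 b23] := mehler_partial_bounded hq 0 0 h23.
under eq_fun do rewrite -triple_integral_partE//.
apply: (@bounded_convergence _ _ _ mu3 _ (measurable_Sq3 q)
  (Sq3_finite_measure q) (fun N p => weighted_tensor g1 g2 g3 p *
    kernel3_part r12 r13 r23 N N (N + k) p)
  (fun p => weighted_tensor g1 g2 g3 p * kernel3 r12 r13 r23 p) (M * (C12 * C13 * C23))).
- by move=> N; apply: measurable_funM => //; exact: bdd_meas3_kernel_part.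
- move=> [[x y] z] [[/= Sx Sy] Sz]; apply: cvgM; first exact: cvg_cst.
  apply: cvgM; first by apply: cvgM; exact: mehler_cvg.
  rewrite (cvg_shiftn k (series (mehler_term q r23 0 0 y z))).
  exact: mehler_cvg.
- move=> N p Sp; rewrite normrM; apply: ler_pM => //; first exact: hM.
  case: p Sp => -[x y] z [[/= Sx Sy] Sz].
  rewrite /kernel3_part !normrM; apply: ler_pM => //=.
  + by apply: ler_pM => //; [exact: b12|exact: b13].
  + exact: b23.
Qed.

(** The approximating triple sums are literally symmetric. *)
Lemma triple_integral_swap12 g1 g2 g3 r12 r13 r23 :
  bdd_meas q g1 -> bdd_meas q g2 -> bdd_meas q g3 ->
  `|r12| < 1 -> `|r13| < 1 -> `|r23| < 1 ->
  triple_integral g1 g2 g3 r12 r13 r23 = triple_integral g2 g1 g3 r12 r23 r13.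
Proof.
move=> b1 b2 b3 h12 h13 h23.
have t1 := triple_integral_cvg 0 b1 b2 b3 h12 h13 h23.
have t2 := triple_integral_cvg 0 b2 b1 b3 h12 h23 h13.
rewrite -(cvg_lim (@Rhausdorff R) t1) -(cvg_lim (@Rhausdorff R) t2).
congr (limn _); apply/funext => N; rewrite addn0 /triple_sum.
apply: eq_bigr => i _; rewrite exchange_big/=.
apply: eq_bigr => j _; apply: eq_bigr => l _.
by rewrite (hermite_momentC g3 j l); ring.
Qed.

Lemma triple_integral_swap23 g1 g2 g3 r12 r13 r23 :
  bdd_meas q g1 -> bdd_meas q g2 -> bdd_meas q g3 ->
  `|r12| < 1 -> `|r13| < 1 -> `|r23| < 1 ->
  triple_integral g1 g2 g3 r12 r13 r23 = triple_integral g1 g3 g2 r13 r12 r23.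
Proof.
move=> b1 b2 b3 h12 h13 h23.
have t1 := triple_integral_cvg 0 b1 b2 b3 h12 h13 h23.
have t2 := triple_integral_cvg 0 b1 b3 b2 h13 h12 h23.
rewrite -(cvg_lim (@Rhausdorff R) t1) -(cvg_lim (@Rhausdorff R) t2).
congr (limn _); apply/funext => N; rewrite addn0 /triple_sum exchange_big/=.
apply: eq_bigr => i _; apply: eq_bigr => j _; apply: eq_bigr => l _.
by rewrite (hermite_momentC g1 i j); ring.
Qed.

(** The moment of H_i H_j in the first variable forces i = j; the moment of
    H_n H_i H_l in the second forces l = n + i - 2s for some s <= n.  Writing
    i = j + s, what is left are partial sums of the diagonal kernels with
    indices s and n - s. *)
Lemma triple_sum_hermite n g a b r23 N : (n <= N)%N ->
  triple_sum (fun=> 1) (fun y => H n y) g a b r23 N N (N + n) =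
  c ^+ 2 * \sum_(s < n.+1) qbinom q n s * ((a * b) ^+ s * r23 ^+ (n - s)) *
    \sum_(j < N - s) (a * b * r23) ^+ j / qfact q j * hermite_moment g (j + s) (j + (n - s)).
Proof.
move=> nN; rewrite /triple_sum.
have h1 i j : hermite_moment (fun=> 1) i j = (i == j)%:R * (qfact q i * c).
  by rewrite -fN_int_orth//; apply: eq_fN_int => x _; rewrite mul1r.
have h2 i l : hermite_moment (fun y => H n y) i l = \sum_(s < n.+1) qbinom q n s *
    qffact q i s * ((n + i - s.*2 == l)%N%:R * (qfact q l * c)).
  exact: fN_int_three.
have nf m := qfact_neq0 hq m.
transitivity (c ^+ 2 * \sum_(i < N) \sum_(s < n.+1)
    qbinom q n s * (qffact q i s * ((a * b) ^+ i / qfact q i) *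
    r23 ^+ (n + i - s.*2) * hermite_moment g i (n + i - s.*2))).
  rewrite big_distrr/=; apply: eq_bigr => i _.
  rewrite (bigD1 i)//= [X in _ + X]big1 ?addr0; last first.
    move=> j ij; rewrite big1// => l _; rewrite h1.
    by rewrite (_ : (i == j :> nat) = false) ?mul0r ?mulr0// eq_sym; apply/negbTE.
  pose G s (l : nat) := qbinom q n s * (qffact q i s * ((a * b) ^+ i / qfact q i)) *
    ((n + i - s.*2 == l)%N%:R * (r23 ^+ l * hermite_moment g i l)) * c ^+ 2.
  rewrite (eq_bigr (fun l : 'I_(N + n) => \sum_(s < n.+1) G s l)); last first.
    move=> l _; rewrite h1 eqxx mul1r h2.
    rewrite -!mulrA big_distrl/= !big_distrr/=; apply: eq_bigr => s _.
    rewrite /G exprMn; field; rewrite !nf.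
    by [].
  rewrite exchange_big/= big_distrr/=; apply: eq_bigr => s _.
  have [si|si] := ltnP i s.
    by rewrite big1 ?qffact_small ?mul0r ?mulr0// => l _;
       rewrite /G qffact_small// ?mul0r ?mulr0 ?mul0r.
  have lt : (n + i - s.*2 < N + n)%N by have := ltn_ord i; lia.
  rewrite (bigD1 (Ordinal lt))//= [X in _ + X]big1 ?addr0; last first.
    move=> l hl; rewrite /G (_ : (_ == _) = false) ?mul0r ?mulr0 ?mul0r//.
    by apply/negbTE; apply: contra hl => /eqP e; apply/eqP/val_inj.
  by rewrite /G eqxx mul1r; ring.
congr (_ * _); rewrite exchange_big/=; apply: eq_bigr => s _.
have sn : (s <= n)%N by rewrite -ltnS.
have sN : (s <= N)%N := leq_trans sn nN.
pose F i := qbinom q n s * (qffact q i s * ((a * b) ^+ i / qfact q i) *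
    r23 ^+ (n + i - s.*2) * hermite_moment g i (n + i - s.*2)).
rewrite -(big_mkord xpredT F) (@big_cat_nat _ _ _ s)//= [X in X + _]big1_seq ?add0r.
  rewrite -{1}(add0n s) big_addn big_mkord big_distrr/=.
  apply: eq_bigr => j _; rewrite /F.
  rewrite (_ : (n + (j + s) - s.*2 = j + (n - s))%N); last lia.
  have -> : qffact q (j + s) s = qfact q (j + s) / qfact q j.
    by rewrite -(qffact_fact _ s j) mulfK.
  rewrite !exprD !exprMn; field; rewrite !nf.
  by [].
move=> i; rewrite /= mem_index_iota => /andP[_ si].
by rewrite /F qffact_small// !mul0r mulr0.
Qed.

Lemma triple_integral_hermite n g a b r23 : bdd_meas q g ->
  `|a| < 1 -> `|b| < 1 -> `|r23| < 1 ->
  triple_integral (fun=> 1) (fun y => H n y) g a b r23 =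
  c ^+ 2 * fNint (fun z => g z * \sum_(s < n.+1) qbinom q n s *
    ((a * b) ^+ s * r23 ^+ (n - s)) * mehler q (a * b * r23) s (n - s) z z).
Proof.
move=> bg ha hb h23.
have r1 : `|a * b * r23| < 1.
  rewrite !normrM; apply: le_lt_trans ha; rewrite -mulrA ler_piMr// mulr_ile1//.
    exact: ltW.
  exact: ltW.
have t1 := triple_integral_cvg n (bdd_meas_cst q 1) (bdd_meas_hermite q n) bg ha hb h23.
apply: (cvg_unique _ t1); first exact: Rhausdorff.
pose S N := c ^+ 2 * \sum_(s < n.+1) qbinom q n s * ((a * b) ^+ s * r23 ^+ (n - s)) *
    \sum_(j < N - s) (a * b * r23) ^+ j / qfact q j * hermite_moment g (j + s) (j + (n - s)).
have SE : \forall N \near \oo, S N =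
    triple_sum (fun=> 1) (fun y => H n y) g a b r23 N N (N + n).
  near=> N; rewrite triple_sum_hermite//.
  by near: N; exact: nbhs_infty_ge.
apply: cvg_trans (near_eq_cvg SE) _.
apply: cvgM; first exact: cvg_cst.
have -> : fNint (fun z => g z * \sum_(s < n.+1) qbinom q n s *
    ((a * b) ^+ s * r23 ^+ (n - s)) * mehler q (a * b * r23) s (n - s) z z) =
  \sum_(s < n.+1) qbinom q n s * ((a * b) ^+ s * r23 ^+ (n - s)) *
    fNint (fun z => g z * mehler q (a * b * r23) s (n - s) z z).
  rewrite -(@fN_int_lincomb _ _ hq
    (fun s => qbinom q n s * ((a * b) ^+ s * r23 ^+ (n - s)))
    (fun s z => g z * mehler q (a * b * r23) s (n - s) z z)); last first.
    by move=> s; apply: bdd_measM => //; exact: bdd_meas_mehler.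
  apply: eq_fN_int => z _; rewrite big_distrr/=; apply: eq_bigr => s _.
  by rewrite mulrCA.
apply: cvg_big => [|s _]; [exact: add_continuous|apply: cvgM; first exact: cvg_cst].
rewrite -(cvg_shiftn s); under eq_fun do rewrite addnK.
exact: (fN_int_mehler_cvg hq bg r1).
Unshelve. all: by end_near.
Qed.

End Triple.

(** * Expectations under a law with a density *)

Section Density.
Context d d' (W : measurableType d) (E : measurableType d') (R : realType).
Variables (P : {measure set W -> \bar R}) (mu : {measure set E -> \bar R}).
Variables (phi : W -> E) (D : set E) (f : E -> R).
Hypotheses (mphi : measurable_fun setT phi) (mD : measurable D).
Hypotheses (mf : measurable_fun D f) (f0 : forall x, D x -> 0 <= f x).
Hypothesis hP : forall A : set E, measurable A ->
  P (phi @^-1` A) = (\int[mu]_(x in A `&` D) (f x)%:E)%E.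

Import HBNNSimple.

Let mpre (A : set E) : measurable A -> measurable (phi @^-1` A).
Proof. by move=> mA; rewrite -(setTI (_ @^-1` _)); exact: mphi. Qed.

(** For an indicator this is the hypothesis on the law of phi; simple functions
    and monotone limits follow. *)
Lemma ge0_integral_density (g : E -> R) : measurable_fun setT g ->
  (forall x, 0 <= g x) ->
  (\int[P]_w (g (phi w))%:E = \int[mu]_(x in D) (g x * f x)%:E)%E.
Proof.
move=> mg g0; have mG : measurable_fun setT (EFin \o g) by exact/measurable_EFinP.
pose h := nnsfun_approx measurableT mG.
have hcv x : (fun n => (h n x)%:E) @ \oo --> (g x)%:E.
  by apply: (cvg_nnsfun_approx _ mG) => // y _; rewrite lee_fin.
transitivity (limn (fun n => \int[P]_w (h n (phi w))%:E))%E.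
  rewrite -monotone_convergence//.
  - by apply: eq_integral => w _; apply/esym/cvg_lim => //; exact: hcv.
  - by move=> n; apply/measurable_EFinP; exact: measurableT_comp.
  - by move=> n w _; rewrite lee_fin.
  - by move=> w _ m n mn; rewrite lee_fin; exact/lefP/nd_nnsfun_approx.
have hf_mes n : measurable_fun D (fun x => (h n x * f x)%:E).
  by apply/measurable_EFinP; apply: measurable_funM => //; exact: measurable_funTS.
have -> : (\int[mu]_(x in D) (g x * f x)%:E)%E =
    limn (fun n => \int[mu]_(x in D) (h n x * f x)%:E)%E.
  rewrite -monotone_convergence//.
  - apply: eq_integral => x _; apply/esym/cvg_lim => //.
    under eq_fun do rewrite EFinM; rewrite EFinM.
    by apply: cvgeZr => //; exact: hcv.
  - by move=> n x Dx; rewrite lee_fin mulr_ge0// f0.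
  - move=> x Dx m n mn; rewrite lee_fin ler_wpM2r ?f0//.
    exact/lefP/nd_nnsfun_approx.
congr (limn _); apply/funext => n.
have mset (r : R) : measurable (h n @^-1` [set r]).
  by rewrite -(setTI (_ @^-1` _)); exact: (measurable_funP (h n)).
transitivity (\sum_(r \in range (h n)) r%:E * P (phi @^-1` (h n @^-1` [set r])))%E.
  under eq_integral do rewrite fimfunE -fsumEFin//.
  rewrite ge0_integral_fsum//; last 2 first.
  - move=> r; apply/measurable_EFinP; apply: measurable_funM => //.
    by apply: measurableT_comp => //; exact: measurable_indic.
  - by move=> r w _; rewrite nnfun_muleindic_ge0.
  apply: eq_fsbigr => r rh.
  rewrite (eq_integral (fun w => r%:E *
    (\1_(phi @^-1` (h n @^-1` [set r])) w)%:E)%E); last first.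
    by move=> w _; rewrite EFinM.
  rewrite ge0_integralZl//.
  - by rewrite integral_indic ?setIT//; exact: mpre.
  - by apply/measurable_EFinP; apply: measurable_indic; exact: mpre.
  - by move: rh; rewrite inE => -[t _ <-]; rewrite lee_fin.
rewrite [RHS](eq_integral (fun x => \sum_(r \in range (h n))
    (r * \1_(h n @^-1` [set r]) x * f x)%:E)%E); last first.
  move=> x /[!inE] Dx; rewrite fimfunE EFinM -fsumEFin// ge0_mule_fsuml.
    by apply: eq_fsbigr => r _; rewrite -EFinM.
  by move=> r; exact: nnfun_muleindic_ge0.
rewrite ge0_integral_fsum//; last 2 first.
- move=> r; apply/measurable_EFinP; apply: measurable_funM => //.
  by apply: measurable_funM => //; apply: measurable_funTS; exact: measurable_indic.
- move=> r x Dx; rewrite EFinM mule_ge0 ?lee_fin ?f0//.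
  exact: nnfun_muleindic_ge0.
apply: eq_fsbigr => r rh.
rewrite (eq_integral (fun x => r%:E * (\1_(h n @^-1` [set r]) x * f x)%:E)%E); last first.
  by move=> x _; rewrite -EFinM mulrA.
rewrite ge0_integralZl//.
- congr (_ * _)%E; rewrite hP// setIC integral_mkcondr.
  apply: eq_integral => x _; rewrite patchE indicE.
  by case: ifPn => _; rewrite /= ?mul1r ?mul0r.
- by apply/measurable_EFinP; apply: measurable_funM.
- by move=> x Dx; rewrite lee_fin mulr_ge0 ?f0// indicE.
- by move: rh; rewrite inE => -[t _ <-]; rewrite lee_fin.
Qed.

Lemma density_integrable (g : E -> R) : measurable_fun setT g ->
  mu.-integrable D (EFin \o (fun x => g x * f x)) ->
  P.-integrable setT (EFin \o (g \o phi)).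
Proof.
move=> mg /integrableP[_ ig]; apply/integrableP; split.
  by apply/measurable_EFinP; exact: measurableT_comp.
rewrite (ge0_integral_density (g := fun x => `|g x|)); last 2 first.
- exact: measurableT_comp.
- by [].
move: ig; congr (_ < _)%E; apply: eq_integral => x /[!inE] Dx /=.
by rewrite normrM (ger0_norm (f0 Dx)).
Qed.

Lemma integral_density (g : E -> R) : measurable_fun setT g ->
  mu.-integrable D (EFin \o (fun x => g x * f x)) ->
  (\int[P]_w (g (phi w))%:E = \int[mu]_(x in D) (g x * f x)%:E)%E.
Proof.
move=> mg ig.
pose gp x := (`|g x| + g x) / 2; pose gn x := (`|g x| - g x) / 2.
have mng : measurable_fun setT (fun x => `|g x|) by exact: measurableT_comp.
have mgp : measurable_fun setT gp.
  by apply: measurable_funM; [exact: measurable_funD|exact: measurable_cst].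
have mgn : measurable_fun setT gn.
  by apply: measurable_funM; [exact: measurable_funB|exact: measurable_cst].
have gp0 x : 0 <= gp x.
  by rewrite divr_ge0//; have := ler_norm (- g x); rewrite normrN; lra.
have gn0 x : 0 <= gn x by rewrite divr_ge0// subr_ge0 ler_norm.
have small (k : E -> R) : measurable_fun setT k -> (forall x, `|k x| <= `|g x|) ->
    mu.-integrable D (EFin \o (fun x => k x * f x)).
  move=> mk hk; apply: le_integrable ig => //.
    by apply/measurable_EFinP; apply: measurable_funM => //; exact: measurable_funTS.
  by move=> x Dx /=; rewrite lee_fin !normrM ler_wpM2r.
have igp : mu.-integrable D (EFin \o (fun x => gp x * f x)).
  apply: small => // x; rewrite ger0_norm// /gp.
  by have := ler_norm (g x); lra.
have ign : mu.-integrable D (EFin \o (fun x => gn x * f x)).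
  apply: small => // x; rewrite ger0_norm// /gn.
  by have := ler_norm (- g x); rewrite normrN; lra.
have gE x : g x = gp x - gn x by rewrite /gp /gn; field.
rewrite (eq_integral (fun w => (gp (phi w))%:E - (gn (phi w))%:E)%E); last first.
  by move=> w _; rewrite gE EFinB.
have -> : (\int[mu]_(x in D) (g x * f x)%:E =
    \int[mu]_(x in D) ((gp x * f x)%:E - (gn x * f x)%:E))%E.
  by apply: eq_integral => x _; rewrite -EFinB -mulrBl -gE.
rewrite integralB//; last 2 first.
- exact: (density_integrable mgp igp).
- exact: (density_integrable mgn ign).
rewrite integralB// !ge0_integral_density//.
Qed.

End Density.

(** * Regression polynomials *)

Section Regression.
Variables (R : realType) (q : R).
Hypothesis hq : -1 < q < 1.
Local Notation H n x := (qHermite q n).[x].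
Local Notation fNint := (fN_int q).
Local Notation mu3 := (@lebesgue3 R).
Variables a b r : R.
Hypotheses (ha : `|a| < 1) (hb : `|b| < 1) (hr : `|r| < 1).
Implicit Types (g : R -> R) (u v : {poly R}).

Local Notation one := (fun=> 1 : R).

Lemma bdd_meas_kernel3 : bdd_meas3 q (kernel3 q a b r).
Proof.
have [C12 p12 b12] := mehler_partial_bounded hq 0 0 ha.
have [C13 p13 b13] := mehler_partial_bounded hq 0 0 hb.
have [C23 p23 b23] := mehler_partial_bounded hq 0 0 hr.
have cv (p : R * R * R) : Sq3 q p ->
    (fun N => kernel3_part q a b r N N N p) @ \oo --> kernel3 q a b r p.
  move: p => [[x y] z] [[/= Sx Sy] Sz].
  by apply: cvgM; [apply: cvgM|]; exact: mehler_cvg.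
split.
  apply: (@measurable_fun_cvg _ _ _ _ (fun N p => kernel3_part q a b r N N N p)) => //.
  by move=> N; exact: bdd_meas3_kernel_part.
exists (C12 * C13 * C23); first by rewrite !mulr_ge0.
move=> p Sp.
have cvn : (fun N => `|kernel3_part q a b r N N N p|) @ \oo -->
    `|kernel3 q a b r p| by apply: cvg_norm; exact: cv.
apply: cvgr_to_le cvn _; apply: nearW => N.
case: p Sp {cv} => -[x y] z [[/= Sx Sy] Sz].
rewrite /kernel3_part !normrM; apply: ler_pM => //=.
+ by apply: ler_pM => //; [exact: b12|exact: b13].
+ exact: b23.
Qed.

Lemma triple_integral_lin2 k u v g : bdd_meas q g ->
  triple_integral q one (horner (k *: u + v)) g a b r =
  k * triple_integral q one (horner u) g a b r + triple_integral q one (horner v) g a b r.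
Proof.
move=> bg; have mS := measurable_Sq3 q.
have I w : mu3.-integrable (Sq3 q)
    (EFin \o (fun p => weighted_tensor q one (horner w) g p * kernel3 q a b r p)).
  apply: bdd_meas3_integrable; apply: bdd_meas3M; last exact: bdd_meas_kernel3.
  by apply: bdd_meas3_weighted_tensor => //; [exact: bdd_meas_cst|exact: bdd_meas_horner].
rewrite /triple_integral -(@RintegralZl _ _ _ mu3 _ _ k mS (I u)).
rewrite -(@RintegralD _ _ _ mu3 _ _ _ mS _ (I v)); last first.
  apply: bdd_meas3_integrable.
  apply: (@bdd_meas3M _ _ (fun=> k)); last first.
    apply: bdd_meas3M; last exact: bdd_meas_kernel3.
    by apply: bdd_meas3_weighted_tensor => //; [exact: bdd_meas_cst|exact: bdd_meas_horner].
  by split; [exact: measurable_cst|exists `|k|].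
by apply: eq_Rintegral => p _; rewrite /weighted_tensor hornerD hornerZ; ring.
Qed.

Lemma triple_integral_lin3 k g h : bdd_meas q g -> bdd_meas q h ->
  triple_integral q one one (fun z => k * g z + h z) a b r =
  k * triple_integral q one one g a b r + triple_integral q one one h a b r.
Proof.
move=> bg bh; have mS := measurable_Sq3 q.
have I w : bdd_meas q w -> bdd_meas3 q (fun p => weighted_tensor q one one w p * kernel3 q a b r p).
  move=> bw; apply: bdd_meas3M; last exact: bdd_meas_kernel3.
  by apply: bdd_meas3_weighted_tensor => //; exact: bdd_meas_cst.
rewrite /triple_integral -(@RintegralZl _ _ _ mu3 _ _ k mS (bdd_meas3_integrable (I _ bg))).
rewrite -(@RintegralD _ _ _ mu3 _ _ _ mS _ (bdd_meas3_integrable (I _ bh)));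
  last first.
  apply: bdd_meas3_integrable.
  apply: (@bdd_meas3M _ _ (fun=> k)); last exact: I.
  by split; [exact: measurable_cst|exists `|k|].
by apply: eq_Rintegral => p _; rewrite /weighted_tensor; ring.
Qed.

(** The defining property of E(u(Y) | Z) = v(Z) for the unnormalized density,
    with kernel parameters a, b, r for the pairs (X,Y), (X,Z), (Y,Z). *)
Definition regression u v : Prop := forall g, bdd_meas q g ->
  triple_integral q one (horner u) g a b r = triple_integral q one one (fun z => g z * v.[z]) a b r.

Lemma regressionD k u1 u2 v1 v2 : regression u1 v1 -> regression u2 v2 ->
  regression (k *: u1 + u2) (k *: v1 + v2).
Proof.
move=> r1 r2 g bg; rewrite triple_integral_lin2// r1// r2//.
have bv v : bdd_meas q (fun z => g z * v.[z]) by apply: bdd_measM => //; exact: bdd_meas_horner.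
rewrite -(triple_integral_lin3 k (bv v1) (bv v2)); congr (triple_integral _ _ _ _ _ _ _).
by apply/funext => z; rewrite hornerD hornerZ; ring.
Qed.

Lemma normr_mul3_lt1 : `|a * b * r| < 1.
Proof.
rewrite !normrM; apply: le_lt_trans ha; rewrite -mulrA ler_piMr// mulr_ile1//.
  exact: ltW.
exact: ltW.
Qed.

Definition kernel_moment n z : R := \sum_(s < n.+1) qbinom q n s *
  ((a * b) ^+ s * r ^+ (n - s)) * mehler q (a * b * r) s (n - s) z z.

(** Both integrals are computed by [triple_integral_hermite], the second one
    with n = 0; this is where the common factor K_(a b r)(z, z) cancels. *)
Lemma regression_hermite n v :
  (forall z, Sq q z ->
     kernel_moment n z = mehler q (a * b * r) 0 0 z z * v.[z]) ->
  regression (qHermite q n) v.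
Proof.
move=> hv g bg; rewrite triple_integral_hermite//.
have -> : triple_integral q one one (fun z => g z * v.[z]) a b r =
    triple_integral q one (fun y => H 0 y) (fun z => g z * v.[z]) a b r.
  by congr (triple_integral _ _ _ _ _ _ _); apply/funext => y; rewrite hermite0.
rewrite triple_integral_hermite//; last by apply: bdd_measM => //; exact: bdd_meas_horner.
congr (_ * _); apply: eq_fN_int => z Sz.
rewrite big_ord1/= qbinom0// !expr0 !mul1r -/(kernel_moment n z) hv//.
by rewrite [_ * v.[z]]mulrC mulrA.
Qed.

Definition regression_poly n : {poly R} := \sum_(s < n.+1)
  (qbinom q n s * ((a * b) ^+ s * r ^+ (n - s))) *: Wpoly (a * b * r) q s (n - s).

Lemma regression_polyP n : regression (qHermite q n) (regression_poly n).
Proof.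
apply: regression_hermite => z Sz; rewrite horner_sum big_distrr/=.
apply: eq_bigr => s _; rewrite mehler_Wpoly ?normr_mul3_lt1// hornerZ.
by rewrite mulrCA.
Qed.

Lemma size_regression_poly n : (size (regression_poly n) <= n.+1)%N.
Proof.
apply: leq_trans (size_sum _ _ _) _; apply/bigmax_leqP => s _.
apply: leq_trans (size_scale_leq _ _) _; apply: leq_trans (size_Wpoly _ _ _ _) _.
by have := ltn_ord s; lia.
Qed.

(** Since H_n is monic of degree n, the H_n span all polynomials, and the
    degree bound of the regression is that of the H_n. *)
Lemma regression_exists n u : (size u <= n)%N ->
  exists2 v : {poly R}, (size v <= n)%N & regression u v.
Proof.
elim: n u => [|n IH] u su.
  exists 0; first by rewrite size_poly0.
  have -> : u = 0 by apply/eqP; rewrite -size_poly_leq0.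
  by move=> g _; apply: eq_Rintegral => p _; rewrite /weighted_tensor !horner0; ring.
have [mH sH] := monic_rec_size_monic (qnum q) n.
pose u' := u - u`_n *: qHermite q n.
have su' : (size u' <= n)%N.
  apply/leq_sizeP => j; rewrite leq_eqVlt => /orP[/eqP <-|nj].
    rewrite coefB coefZ; have := monicP mH; rewrite /lead_coef sH/= => ->.
    by rewrite mulr1 subrr.
  rewrite coefB coefZ (nth_default _ (leq_trans su nj)) sub0r.
  by rewrite (nth_default _ (_ : size (qHermite q n) <= j)%N) ?sH// mulr0 oppr0.
have [v sv rv] := IH u' su'.
exists (u`_n *: regression_poly n + v).
  apply: leq_trans (size_polyD _ _) _; rewrite geq_max; apply/andP; split.
    exact: leq_trans (size_scale_leq _ _) (size_regression_poly n).
  exact: leq_trans sv (leqnSn _).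
have e : u`_n *: qHermite q n + u' = u by rewrite /u' addrC subrK.
by rewrite -[X in regression X _]e; exact: regressionD (regression_polyP n) rv.
Qed.

End Regression.

(** * The density in terms of the kernels *)

Section DensityFormula.
Variables (R : realType) (q r12 r13 r23 : R).
Hypotheses (hq : -1 < q < 1) (h12 : `|r12| < 1) (h13 : `|r13| < 1)
  (h23 : `|r23| < 1).

Local Notation one := (fun=> 1 : R).

Lemma f3D_unnormE p : Sq3 q p -> f3D_unnorm r12 r13 r23 q p =
  weighted_tensor q one one one p * kernel3 q r12 r13 r23 p.
Proof.
case: p => -[x y] z [[/= Sx Sy] Sz].
have [K12 c12] := mehler_product_cvg hq h12 Sx Sy.
have [K13 c13] := mehler_product_cvg hq h13 Sx Sz.
have [K23 c23] := mehler_product_cvg hq h23 Sy Sz.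
have Q r : `|r| < 1 -> 0 < qpoch_inf (r ^+ 2) q.
  by move=> r1; apply: qpoch_inf_gt0 => //; rewrite normrX exprn_ilt1.
have -> : infprod (fun i => omegaq q x y (r12 * q ^+ i)
    * omegaq q x z (r13 * q ^+ i) * omegaq q y z (r23 * q ^+ i)) =
  qpoch_inf (r12 ^+ 2) q / mehler q r12 0 0 x y *
  (qpoch_inf (r13 ^+ 2) q / mehler q r13 0 0 x z) *
  (qpoch_inf (r23 ^+ 2) q / mehler q r23 0 0 y z).
  apply: cvg_lim => //.
  under eq_fun do rewrite !big_split/=.
  by apply: cvgM => //; exact: cvgM.
rewrite /weighted_tensor /kernel3/= !mul1r; congr (_ * _).
have := Q _ h12; have := Q _ h13; have := Q _ h23.
move: K12 K13 K23 => /lt0r_neq0 k12 /lt0r_neq0 k13 /lt0r_neq0 k23.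
move=> /lt0r_neq0 q23 /lt0r_neq0 q13 /lt0r_neq0 q12.
by field; rewrite k12 k13 k23 q12 q13 q23.
Qed.

Lemma weighted_tensor_kernel_ge0 p : Sq3 q p ->
  0 <= weighted_tensor q one one one p * kernel3 q r12 r13 r23 p.
Proof.
case: p => -[x y] z [[/= Sx Sy] Sz].
have [K12 _] := mehler_product_cvg hq h12 Sx Sy.
have [K13 _] := mehler_product_cvg hq h13 Sx Sz.
have [K23 _] := mehler_product_cvg hq h23 Sy Sz.
move: K12 K13 K23 => /ltW K12 /ltW K13 /ltW K23.
have := fN_ge0 hq Sx; have := fN_ge0 hq Sy; have := fN_ge0 hq Sz => *.
by rewrite /weighted_tensor /kernel3/= !mul1r; do 4?[apply: mulr_ge0 => //].
Qed.

Lemma C3D_ge0 : 0 <= C3D r12 r13 r23 q.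
Proof.
rewrite invr_ge0 fine_ge0//; apply: integral_ge0 => p Sp.
by rewrite lee_fin f3D_unnormE// weighted_tensor_kernel_ge0.
Qed.

End DensityFormula.

(** * The law of the three variables *)

Section Law.
Context (R : realType) (q r12 r13 r23 : R) (d : measure_display)
  (T : measurableType d) (P : probability T R) (X Y Z : {RV P >-> R}).
Hypotheses (hq : -1 < q < 1) (h12 : `|r12| < 1) (h13 : `|r13| < 1)
  (h23 : `|r23| < 1).
Hypothesis hXYZ : has_density_f3D X Y Z r12 r13 r23 q.
Local Notation one := (fun=> 1 : R).
Local Notation mu3 := (@lebesgue3 R).
Local Notation C := (C3D r12 r13 r23 q).

Let f (p : R * R * R) : R := C * (weighted_tensor q one one one p * kernel3 q r12 r13 r23 p).

Let bf : bdd_meas3 q f.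
Proof.
apply: (@bdd_meas3M _ _ (fun=> C)); first by split; [exact: measurable_cst|exists `|C|].
apply: bdd_meas3M; last exact: bdd_meas_kernel3.
by apply: bdd_meas3_weighted_tensor => //; exact: bdd_meas_cst.
Qed.

Let law (A : set (R * R * R)) : measurable A ->
  P ((fun w => (X w, Y w, Z w)) @^-1` A) =
  (\int[mu3]_(p in A `&` Sq3 q) (f p)%:E)%E.
Proof.
move=> mA; rewrite hXYZ//; apply: eq_integral => p /[!inE] -[_ Sp].
by rewrite /f3D f3D_unnormE.
Qed.

Let mXYZ : measurable_fun setT (fun w => (X w, Y w, Z w)).
Proof. by apply: measurable_fun_pair => //; exact: measurable_fun_pair. Qed.

Let f0 p : Sq3 q p -> 0 <= f p.
Proof. by move=> Sp; rewrite mulr_ge0 ?C3D_ge0// weighted_tensor_kernel_ge0. Qed.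

Lemma law_integral (G : R * R * R -> R) : measurable_fun setT G -> bdd_meas3 q G ->
  P.-integrable setT (EFin \o (fun w => G (X w, Y w, Z w))) /\
  (\int[P]_w (G (X w, Y w, Z w))%:E =
   (\int[mu3]_(p in Sq3 q) (G p * f p))%:E)%E.
Proof.
move=> mG bG.
have iG : mu3.-integrable (Sq3 q) (EFin \o (fun p => G p * f p)).
  by apply: bdd_meas3_integrable; exact: bdd_meas3M.
have [mf _] := bf.
split.
  exact: (@density_integrable _ _ _ _ _ P mu3 _ _ f mXYZ (measurable_Sq3 q)
    mf f0 law G mG iG).
rewrite (@integral_density _ _ _ _ _ P mu3 _ _ f mXYZ (measurable_Sq3 q)
  mf f0 law G mG iG).
rewrite /Rintegral fineK//.
by apply: (@integrable_fin_num _ _ _ mu3); [exact: measurable_Sq3|exact: iG].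
Qed.

Definition test_function (g : R -> R) := measurable_fun setT g /\ bdd_meas q g.

Lemma law_triple g1 g2 g3 : test_function g1 -> test_function g2 -> test_function g3 ->
  P.-integrable setT (EFin \o (fun w => g1 (X w) * g2 (Y w) * g3 (Z w))) /\
  (\int[P]_w (g1 (X w) * g2 (Y w) * g3 (Z w))%:E =
   (C * triple_integral q g1 g2 g3 r12 r13 r23)%:E)%E.
Proof.
move=> [m1 b1] [m2 b2] [m3 b3].
pose G (p : R * R * R) := g1 p.1.1 * g2 p.1.2 * g3 p.2.
have mG : measurable_fun setT G.
  apply: measurable_funM; first apply: measurable_funM.
  - by apply: measurableT_comp => //; apply: measurableT_comp;
      [exact: measurable_fst|exact: measurable_fst].
  - by apply: measurableT_comp => //; apply: measurableT_comp;
      [exact: measurable_snd|exact: measurable_fst].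
  - by apply: measurableT_comp => //; exact: measurable_snd.
have bG : bdd_meas3 q G.
  apply: bdd_meas3M; last exact: bdd_meas3_3.
  by apply: bdd_meas3M; [exact: bdd_meas3_1|exact: bdd_meas3_2].
have [iG eG] := law_integral mG bG; split; first exact: iG.
rewrite [LHS]eG; congr (_%:E); rewrite /triple_integral -RintegralZl.
- by apply: eq_Rintegral => p _; rewrite /G /f /weighted_tensor; ring.
- exact: measurable_Sq3.
apply: bdd_meas3_integrable; apply: bdd_meas3M; last exact: bdd_meas_kernel3.
exact: bdd_meas3_weighted_tensor.
Qed.

End Law.

(** * Conditional expectations for pairs of coordinates *)

Section CondExp.
Context (R : realType) (q r12 r13 r23 : R) (d : measure_display)
  (T : measurableType d) (P : probability T R) (X Y Z : {RV P >-> R}).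
Hypotheses (hq : -1 < q < 1) (h12 : `|r12| < 1) (h13 : `|r13| < 1)
  (h23 : `|r23| < 1).
Hypothesis hXYZ : has_density_f3D X Y Z r12 r13 r23 q.
Local Notation one := (fun=> 1 : R).
Local Notation C := (C3D r12 r13 r23 q).
Local Notation test_function := (@test_function R q).

Lemma test_function_one : test_function one.
Proof. by split; [exact: measurable_cst|exact: bdd_meas_cst]. Qed.

Lemma test_function_horner u : test_function (horner u).
Proof.
split; last exact: bdd_meas_horner.
by apply: continuous_measurable_fun; exact: continuous_horner.
Qed.

Lemma test_function_indic (B : set R) : measurable B -> test_function (\1_B).
Proof.
move=> mB; split; first exact: measurable_indic.
split; first by apply: measurable_funTS; exact: measurable_indic.
by exists 1 => // x _; rewrite indicE ger0_norm// lern1 leq_b1.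
Qed.

Lemma test_functionM f g : test_function f -> test_function g -> test_function (fun x => f x * g x).
Proof.
by move=> [mf bf] [mg bg]; split; [exact: measurable_funM|exact: bdd_measM].
Qed.

(** The pair (U, V) behaves like (Y, Z) for a density with kernel parameters
    a, b, r: by the symmetry of the triple integral each of the six ordered
    pairs has this form, r being the parameter that joins U and V. *)
Definition pair_law (U V : {RV P >-> R}) (a b r : R) : Prop :=
  forall u g : R -> R, test_function u -> test_function g ->
  P.-integrable setT (EFin \o (fun w => u (U w) * g (V w))) /\
  (\int[P]_w (u (U w) * g (V w))%:E = (C * triple_integral q one u g a b r)%:E)%E.

Lemma pair_law_cond_exp U V a b r (u v : {poly R}) :
  pair_law U V a b r -> regression q a b r u v ->
  cond_exp_is (fun w => u.[U w]) V (fun z => v.[z]).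
Proof.
move=> L reg; split.
- have [+ _] := L _ _ (test_function_horner u) test_function_one.
  by apply: eq_integrable => // w _ /=; rewrite mulr1.
- by have [] := test_function_horner v.
- have [+ _] := L _ _ test_function_one (test_function_horner v).
  by apply: eq_integrable => // w _ /=; rewrite mul1r.
move=> B mB; have nB := test_function_indic mB.
have E (F : T -> R) : (\int[P]_(w in V @^-1` B) (F w)%:E =
    \int[P]_w (F w * \1_B (V w))%:E)%E.
  rewrite integral_mkcond; apply: eq_integral => w _.
  rewrite patchE indicE -[V w \in B]/(w \in V @^-1` B).
  by case: ifPn => _; rewrite ?mulr1 ?mulr0.
rewrite !E; have [_ ->] := L _ _ (test_function_horner u) nB.
have [_ e] := L _ _ test_function_one (test_functionM nB (test_function_horner v)).
rewrite reg; last by case: nB.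
by rewrite -e; apply: eq_integral => w _; rewrite mul1r mulrC.
Qed.

Lemma pair_law_moments U V a b r : `|a| < 1 -> `|b| < 1 -> `|r| < 1 ->
  pair_law U V a b r -> poly_cond_moments q U V.
Proof.
move=> ha hb hr L n; split.
  exists (regression_poly q a b r n); first exact: size_regression_poly.
  by apply: pair_law_cond_exp L _; exact: regression_polyP.
have [|v sv rv] := @regression_exists _ _ hq _ _ _ ha hb hr n.+1 ('X^n).
  by rewrite size_polyXn.
exists v => //.
rewrite (_ : (fun w => _) = fun w => ('X^n).[U w]).
  exact: pair_law_cond_exp L rv.
by apply/funext => w; rewrite hornerXn.
Qed.

Let lt := (law_triple hq h12 h13 h23 hXYZ).
Let b1 : bdd_meas q one := bdd_meas_cst q 1.

Lemma pair_law_YZ : pair_law Y Z r12 r13 r23.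
Proof.
move=> u g nu ng; have [iG eG] := lt test_function_one nu ng; split.
  by apply: eq_integrable iG => // w _ /=; rewrite mul1r.
by rewrite -eG; apply: eq_integral => w _; rewrite mul1r.
Qed.

Lemma pair_law_ZY : pair_law Z Y r13 r12 r23.
Proof.
move=> u g nu ng; have [iG eG] := lt test_function_one ng nu; split.
  by apply: eq_integrable iG => // w _ /=; rewrite mul1r mulrC.
rewrite (triple_integral_swap23 hq b1 (proj2 nu) (proj2 ng) h13 h12 h23).
by rewrite -eG; apply: eq_integral => w _; rewrite mul1r mulrC.
Qed.

Lemma pair_law_XZ : pair_law X Z r12 r23 r13.
Proof.
move=> u g nu ng; have [iG eG] := lt nu test_function_one ng; split.
  by apply: eq_integrable iG => // w _ /=; rewrite mulr1.
rewrite (triple_integral_swap12 hq b1 (proj2 nu) (proj2 ng) h12 h23 h13).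
by rewrite -eG; apply: eq_integral => w _; rewrite mulr1.
Qed.

Lemma pair_law_XY : pair_law X Y r13 r23 r12.
Proof.
move=> u g nu ng; have [iG eG] := lt nu ng test_function_one.
have [_ bu] := nu; have [_ bg] := ng; split.
  by apply: eq_integrable iG => // w _ /=; rewrite mulr1.
rewrite (triple_integral_swap12 hq b1 bu bg h13 h23 h12).
rewrite (triple_integral_swap23 hq bu b1 bg h13 h12 h23).
by rewrite -eG; apply: eq_integral => w _; rewrite mulr1.
Qed.

Lemma pair_law_YX : pair_law Y X r23 r13 r12.
Proof.
move=> u g nu ng; have [iG eG] := lt ng nu test_function_one.
have [_ bu] := nu; have [_ bg] := ng; split.
  by apply: eq_integrable iG => // w _ /=; rewrite mulr1 mulrC.
rewrite (triple_integral_swap12 hq b1 bu bg h23 h13 h12).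
rewrite (triple_integral_swap23 hq bu b1 bg h23 h12 h13).
rewrite (triple_integral_swap12 hq bu bg b1 h12 h23 h13).
by rewrite -eG; apply: eq_integral => w _; rewrite mulr1 mulrC.
Qed.

Lemma pair_law_ZX : pair_law Z X r23 r12 r13.
Proof.
move=> u g nu ng; have [iG eG] := lt ng test_function_one nu.
have [_ bu] := nu; have [_ bg] := ng; split.
  by apply: eq_integrable iG => // w _ /=; rewrite mulr1 mulrC.
rewrite (triple_integral_swap12 hq b1 bu bg h23 h12 h13).
rewrite (triple_integral_swap23 hq bu b1 bg h23 h13 h12).
rewrite (triple_integral_swap12 hq bu bg b1 h13 h23 h12).
rewrite (triple_integral_swap23 hq bg bu b1 h13 h12 h23).
by rewrite -eG; apply: eq_integral => w _; rewrite mulr1 mulrC.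
Qed.

End CondExp.

(** * Closed forms *)

Section Folding.
Variable R : realType.

Lemma sum_reflect (F : nat -> R) n k : (k <= n.+1)%N ->
  \sum_(0 <= i < k) F (n - i)%N = \sum_(n.+1 - k <= i < n.+1) F i.
Proof.
elim: k => [|k IH] kn; first by rewrite subn0 !big_geq.
rewrite big_nat_recr//= IH ?(ltnW kn)// addrC [RHS]big_ltn; last by lia.
by rewrite subSS; congr (_ + _); congr (bigop _ _ _); congr (index_iota _ _); lia.
Qed.

Lemma sum_fold_odd (F : nat -> R) m :
  \sum_(s < (2 * m + 1).+1) F s =
  \sum_(0 <= s < m.+1) (F s + F (2 * m + 1 - s)%N).
Proof.
rewrite -(big_mkord xpredT F) big_split/= sum_reflect; last by lia.
rewrite (@big_cat_nat _ _ _ m.+1)//=; last by lia.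
by congr (_ + _); congr (bigop _ _ _); congr (index_iota _ _); lia.
Qed.

Lemma sum_fold_even (F : nat -> R) m :
  \sum_(s < (2 * m).+1) F s =
  F m + \sum_(0 <= s < m) (F s + F (2 * m - s)%N).
Proof.
rewrite -(big_mkord xpredT F) big_split/= sum_reflect; last by lia.
rewrite (@big_cat_nat _ _ _ m)//=; last by lia.
rewrite addrCA; congr (_ + _); rewrite big_ltn; last by lia.
by congr (_ + _); congr (bigop _ _ _); congr (index_iota _ _); lia.
Qed.

End Folding.

Section ClosedForms.
Variables (R : realType) (q a b r : R).
Hypotheses (hq : -1 < q < 1) (ha : `|a| < 1) (hb : `|b| < 1) (hr : `|r| < 1).
Local Notation rho := (a * b * r).
Local Notation W := (Wpoly rho q).
Local Notation V k m z := (mehler q rho k m z z).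

Let h1 : `|rho| < 1 := normr_mul3_lt1 ha hb hr.

(** The terms with indices s and n - s carry the same kernel, so their
    coefficients add up. *)
Let pair_terms n s z : (2 * s <= n)%N ->
  qbinom q n s * ((a * b) ^+ s * r ^+ (n - s)) * V s (n - s) z +
  qbinom q n (n - s) * ((a * b) ^+ (n - s) * r ^+ (n - (n - s))) *
    V (n - s) (n - (n - s)) z =
  qbinom q n s * (rho ^+ s * (r ^+ (n - 2 * s) + (a * b) ^+ (n - 2 * s))) *
    V s (n - s) z.
Proof.
move=> sn; have sn' : (s <= n)%N by lia.
rewrite subKn// qbinom_sub// (mehlerC q rho (n - s) s).
have -> : (n - s)%N = (s + (n - 2 * s))%N by lia.
by rewrite !exprD !exprMn; ring.
Qed.

Definition odd_regression m : {poly R} := \sum_(0 <= s < m.+1)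
  (qbinom q (2 * m + 1) s * (rho ^+ s * (r ^+ (2 * m + 1 - 2 * s)
     + (a * b) ^+ (2 * m + 1 - 2 * s)))) *: W s (2 * m + 1 - s).

Lemma regression_odd m :
  regression q a b r (qHermite q (2 * m + 1)) (odd_regression m).
Proof.
apply: regression_hermite => // z Sz; rewrite /kernel_moment.
rewrite (sum_fold_odd (fun s => qbinom q (2 * m + 1) s *
  ((a * b) ^+ s * r ^+ (2 * m + 1 - s)) * V s (2 * m + 1 - s) z)).
rewrite horner_sum big_distrr/=; apply: eq_big_nat => s /andP[_ sm].
rewrite pair_terms; last by lia.
by rewrite (mehler_Wpoly hq _ _ h1 Sz) hornerZ mulrCA.
Qed.

Definition even_regression m : {poly R} :=
  (qbinom q (2 * m) m * rho ^+ m) *: W m m + \sum_(0 <= s < m)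
  (qbinom q (2 * m) s * (rho ^+ s * (r ^+ (2 * m - 2 * s)
     + (a * b) ^+ (2 * m - 2 * s)))) *: W s (2 * m - s).

Lemma regression_even m :
  regression q a b r (qHermite q (2 * m)) (even_regression m).
Proof.
apply: regression_hermite => // z Sz; rewrite /kernel_moment.
rewrite (sum_fold_even (fun s => qbinom q (2 * m) s *
  ((a * b) ^+ s * r ^+ (2 * m - s)) * V s (2 * m - s) z)).
rewrite hornerD mulrDr; congr (_ + _).
  rewrite (_ : (2 * m - m = m)%N); last lia.
  by rewrite hornerZ (mehler_Wpoly hq _ _ h1 Sz) !exprMn; ring.
rewrite horner_sum big_distrr/=; apply: eq_big_nat => s /andP[_ sm].
rewrite pair_terms; last by lia.
by rewrite (mehler_Wpoly hq _ _ h1 Sz) hornerZ mulrCA.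
Qed.

Let rho2 : `|rho ^+ 2| < 1. Proof. by rewrite normrX exprn_ilt1. Qed.

Let V01 z : Sq q z -> V 0 1 z = V 0 0 z * (z / (1 + rho)).
Proof.
move=> Sz; rewrite (mehler_Rogers hq _ h1 Sz) !qpochS !qpoch0 !expr0 !mul1r !mulr1.
rewrite /Rogers monic_rec1 hornerX.
have := onem_mul_expr_gt0 hq 0 h1; have := onem_mul_expr_gt0 hq 0 rho2.
rewrite !expr0 !mulr1 => /lt0r_neq0 n2 /lt0r_neq0 n1.
have np : 1 + rho != 0.
  apply: contra n2 => /eqP e; apply/eqP.
  have -> : 1 - rho ^+ 2 = (1 - rho) * (1 + rho) by ring.
  by rewrite e mulr0.
move: n1 n2 np; move: rho => t n1 n2 np.
by congr (_ * _); field; rewrite n2 np.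
Qed.

Lemma regression_first : regression q a b r (qHermite q 1)
  (((r + a * b) / (1 + rho)) *: 'X).
Proof.
apply: regression_hermite => // z Sz; rewrite /kernel_moment.
rewrite !big_ord_recl big_ord0 /= /bump/= qbinom0// qbinomnn// (mehlerC q rho 1 0).
rewrite !expr0 !expr1 V01// hornerZ hornerX; ring.
Qed.

(** V_(1,1) is expressed through V_(0,1) and V_(0,2) by the shift recurrence. *)
Lemma regression_second : regression q a b r (qHermite q 2)
  ((((r ^+ 2 + (a * b) ^+ 2) * (1 - q * rho) + rho * (1 - rho) * (1 + q))
     / ((1 + rho) * (1 - q * rho ^+ 2))) *: 'X^2 +
   ((1 + rho ^+ 2 - r ^+ 2 - (a * b) ^+ 2) / (1 - q * rho ^+ 2) - 1)%:P).
Proof.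
apply: regression_hermite => // z Sz; rewrite /kernel_moment.
rewrite !big_ord_recl big_ord0 /= /bump/= qbinom0// qbinomnn// (mehlerC q rho 2 0).
have -> : qbinom q 2 1 = 1 + q.
  by rewrite (qbinomD q 1 1) !qfactS qfact0 qnumSr qnumr1 expr1; field.
rewrite (mehler_shift hq 0 1 h1 Sz Sz) qnumr0 expr0 mul0r subr0 mul1r V01//.
rewrite (mehler_Rogers hq 2 h1 Sz) !qpochS !qpoch0 RogersSS.
have -> : (Rogers rho q 1).[z] = z by rewrite /Rogers monic_rec1 hornerX.
have -> : (Rogers rho q 0).[z] = 1 by rewrite /Rogers monic_rec0 -polyC1 hornerC.
rewrite hornerD hornerZ hornerXn hornerC qnumr1 !subn0 !expr0 !expr1 !mul1r !mulr1.
have := onem_mul_expr_gt0 hq 0 h1; have := onem_mul_expr_gt0 hq 0 rho2.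
have := onem_mul_expr_gt0 hq 1 h1; have := onem_mul_expr_gt0 hq 1 rho2.
rewrite !expr0 !expr1 !mulr1.
move=> /lt0r_neq0 n4 /lt0r_neq0 n3 /lt0r_neq0 n2 /lt0r_neq0 n1.
have np : 1 + rho != 0.
  apply: contra n2 => /eqP e; apply/eqP.
  have -> : 1 - rho ^+ 2 = (1 - rho) * (1 + rho) by ring.
  by rewrite e mulr0.
move: n1 n2 n3 n4 np; move: (V 0 0 z) => K; move: rho => t n1 n2 n3 n4 np.
have n3' : 1 - q * t != 0 by rewrite mulrC.
have n4' : 1 - q * t ^+ 2 != 0 by rewrite mulrC.
rewrite -[(1 + (1 + 0))%N]/2%N; move: (a * b) => p.
by field; rewrite ?np ?n1 ?n2 ?n3 ?n4 ?n3' ?n4'.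
Qed.


End ClosedForms.

Theorem theorem2 (R : realType) (q rho12 rho13 rho23 : R)
    (hq : -1 < q < 1) (h12 : -1 < rho12 < 1) (h13 : -1 < rho13 < 1)
    (h23 : -1 < rho23 < 1)
    (d : measure_display) (T : measurableType d) (P : probability T R)
    (X Y Z : {RV P >-> R})
    (hXYZ : has_density_f3D X Y Z rho12 rho13 rho23 q) :
  let r := rho12 * rho13 * rho23 in
  [/\ [/\ poly_cond_moments q Y Z, poly_cond_moments q Z Y,
          poly_cond_moments q X Z, poly_cond_moments q Z X &
          poly_cond_moments q X Y /\ poly_cond_moments q Y X],
      forall m : nat,
        cond_exp_is (fun w => (qHermite q (2 * m + 1)).[Y w]) Z
          (fun z => \sum_(0 <= s < m.+1)
             qbinom q (2 * m + 1) s
             * (r ^+ s * (rho23 ^+ (2 * m + 1 - 2 * s)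
                          + (rho12 * rho13) ^+ (2 * m + 1 - 2 * s)))
             * (Wpoly r q s (2 * m + 1 - s)).[z]),
      forall m : nat, (1 <= m)%N ->
        cond_exp_is (fun w => (qHermite q (2 * m)).[Y w]) Z
          (fun z => qbinom q (2 * m) m * r ^+ m * (Wpoly r q m m).[z]
             + \sum_(0 <= s < m)
                 qbinom q (2 * m) s
                 * (r ^+ s * (rho23 ^+ (2 * m - 2 * s)
                              + (rho12 * rho13) ^+ (2 * m - 2 * s)))
                 * (Wpoly r q s (2 * m - s)).[z]),
      cond_exp_is Y Z (fun z => (rho23 + rho12 * rho13) / (1 + r) * z) &
      cond_exp_is (fun w => Y w ^+ 2) Z
        (fun z =>
           ((rho23 ^+ 2 + rho12 ^+ 2 * rho13 ^+ 2) * (1 - q * r)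
            + r * (1 - r) * (1 + q)) / ((1 + r) * (1 - q * r ^+ 2)) * z ^+ 2
           + (1 + r ^+ 2 - rho23 ^+ 2 - rho12 ^+ 2 * rho13 ^+ 2)
             / (1 - q * r ^+ 2))].
Proof.
move=> r; rewrite -!ltr_norml in h12 h13 h23.
have LYZ := pair_law_YZ hq h12 h13 h23 hXYZ.
have cond := pair_law_cond_exp LYZ.
split.
- split; [| | | |split].
  + exact: (pair_law_moments hq h12 h13 h23 LYZ).
  + exact: (pair_law_moments hq h13 h12 h23 (pair_law_ZY hq h12 h13 h23 hXYZ)).
  + exact: (pair_law_moments hq h12 h23 h13 (pair_law_XZ hq h12 h13 h23 hXYZ)).
  + exact: (pair_law_moments hq h23 h12 h13 (pair_law_ZX hq h12 h13 h23 hXYZ)).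
  + exact: (pair_law_moments hq h13 h23 h12 (pair_law_XY hq h12 h13 h23 hXYZ)).
  + exact: (pair_law_moments hq h23 h13 h12 (pair_law_YX hq h12 h13 h23 hXYZ)).
- move=> m; have := cond _ _ (regression_odd hq h12 h13 h23 m).
  congr (cond_exp_is _ _ _); apply/funext => z; rewrite horner_sum.
  by apply: eq_bigr => s _; rewrite hornerZ.
- move=> m _; have := cond _ _ (regression_even hq h12 h13 h23 m).
  congr (cond_exp_is _ _ _); apply/funext => z.
  rewrite /even_regression hornerD hornerZ; congr (_ + _).
  by rewrite horner_sum; apply: eq_bigr => s _; rewrite hornerZ.
- have := cond _ _ (regression_first hq h12 h13 h23).
  rewrite (_ : (fun w => _) = Y); last by apply/funext => w; rewrite hermite1.
  congr (cond_exp_is _ _ _); apply/funext => z.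
  by rewrite hornerZ hornerX.
- have c1 : regression q rho12 rho13 rho23 (qHermite q 0) 1.
    apply: regression_hermite => // z Sz.
    by rewrite /kernel_moment big_ord1 qbinom0// !expr0 !mul1r -polyC1 hornerC mulr1.
  have c2 := regression_second hq h12 h13 h23.
  have := cond _ _ (regressionD hq h12 h13 h23 1 c2 c1).
  rewrite (_ : (fun w => (_ + qHermite q 0).[_]) = fun w => Y w ^+ 2); last first.
    apply/funext => w; rewrite hornerD hornerZ hermiteS hermite1 hermite0.
    by rewrite qnumr1; ring.
  congr (cond_exp_is _ _ _); apply/funext => z.
  rewrite hornerD hornerZ hornerD hornerZ hornerXn -polyC1 !hornerC exprMn.
  by rewrite /r; ring.
Qed.
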